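(* Suppose $(\Omega,T,\mu)$ is an ergodic topological dynamical system with $\operatorname{supp}\mu=\Omega$. If $\mathfrak A(\Omega,T,\mu)=\mathbb Z$, then $\Sigma_{\mu,f}$ is an interval for every $f\in C(\Omega,\mathbb R)$. More generally, if $\mathfrak A(\Omega,T,\mu)=n^{-1}\mathbb Z$ for some $n\in\mathbb N$, then $\Sigma_{\mu,f}$ is a finite union of no more than $n$ intervals for every $f\in C(\Omega,\mathbb R)$.
   Context: $\mathbb T=\mathbb R/\mathbb Z$. An ergodic topological dynamical system $(\Omega,T,\mu)$ consists of a compact metric space $\Omega$, a homeomorphism $T:\Omega\to\Omega$, and a $T$-ergodic Borel probability measure $\mu$ on $\Omega$. For $f\in C(\Omega,\mathbb R)$ and $\omega\in\Omega$, $H_{f,\omega}$ acts on $\ell^2(\mathbb Z)$ by $[H_{f,\omega}\psi](n)=\psi(n-1)+\psi(n+1)+f(T^n\omega)\psi(n)$. By ergodicity there is a compact set $\Sigma_{\mu,f}\subseteq\mathbb R$ with $\sigma(H_{f,\omega})=\Sigma_{\mu,f}$ for $\mu$-a.e. $\omega$. Suspension: $X=X(\Omega,T)=(\Omega\times\mathbb R)/\!\sim$, where $(\omega,t)\sim(\omega',t')$ iff $(\omega',t')=(T^n\omega,t-n)$ for some $n\in\mathbb Z$; $[\omega,t]$ denotes the class of $(\omega,t)$. The flow $\overline T$ on $X$ is $\overline T^{t}[\omega,s]=[\omega,s+t]$, and $\overline\mu$ is given by $\int_X g\,d\overline\mu=\int_0^1\int_\Omega g[\omega,s]\,d\mu(\omega)\,ds$;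 it is $\overline T$-ergodic. Schwartzman homomorphism: $C^\sharp(X,\mathbb T)$ is the group of homotopy classes of continuous maps $X\to\mathbb T$ under $[\phi_1]+[\phi_2]=[\phi_1+\phi_2]$. For $\phi\in C(X,\mathbb T)$ and $x\in X$ let $\widetilde\phi_x:\mathbb R\to\mathbb R$ be a continuous lift of $t\mapsto\phi(\overline T^{t}x)$. For $\overline\mu$-a.e. $x$ the limit $\lim_{t\to\infty}\widetilde\phi_x(t)/t$ exists and equals a constant that depends only on $[\phi]$; this constant is $\mathfrak A_{\overline\mu}([\phi])$. The group $\mathfrak A(\Omega,T,\mu)\subseteq\mathbb R$ is the range $\mathfrak A_{\overline\mu}(C^\sharp(X,\mathbb T))$. *)

(* Defs.v *)
From HB Require Import structures.
From mathcomp Require Import all_boot all_order all_algebra.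
From mathcomp Require Import complex.
From mathcomp Require Import all_classical all_reals all_analysis.

Set Implicit Arguments.
Unset Strict Implicit.
Unset Printing Implicit Defensive.

Import Order.TTheory GRing.Theory Num.Theory.
Import numFieldNormedType.Exports.

Local Open Scope classical_set_scope.
Local Open Scope ring_scope.
Local Open Scope quotient_scope.

(* The library's sigma-algebras live on pointed types. Nothing is lost here: a
   space that carries a probability measure is nonempty. *)
#[short(type="pmetricType")]
HB.structure Definition PointedMetric (R : numDomainType) :=
  {M of Metric R M & Pointed M}.

Definition borel (X : ptopologicalType) := g_sigma_algebraType (@open X).

HB.instance Definition _ (X : ptopologicalType) :=
  Measurable.copy (borel X) (g_sigma_algebraType (@open X)).

Record homeomorphism (X : topologicalType) := Homeomorphism {
  homeo_fun :> X -> X ;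
  homeo_inv : X -> X ;
  homeo_continuous : continuous homeo_fun ;
  homeo_inv_continuous : continuous homeo_inv ;
  homeoK : cancel homeo_fun homeo_inv ;
  homeo_invK : cancel homeo_inv homeo_fun }.

Section iterz.
Context {X : topologicalType} (T : homeomorphism X).

Definition iterz (n : int) : X -> X :=
  match n with
  | Posz k => iter k T
  | Negz k => iter k.+1 (homeo_inv T)
  end.

Lemma iterzS n x : iterz (n + 1) x = T (iterz n x).
Proof.
case: n => [k|k]; first by rewrite -PoszD addn1.
have -> : Negz k + 1 = - (k%:Z) by rewrite NegzE -addn1 PoszD opprD addrNK.
rewrite /= homeo_invK.
by case: k => [|k] //=; rewrite -NegzE.
Qed.

Lemma iterzD m n x : iterz (m + n) x = iterz m (iterz n x).
Proof.
have D1 (k : nat) p y : iterz (k%:Z + p) y = iterz k%:Z (iterz p y).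
  elim: k => [|k IH]; first by rewrite add0r.
  by rewrite -addn1 PoszD -addrA [1 + p]addrC addrA !iterzS IH.
case: m => k; first exact: D1.
have inj : injective (iterz (Posz k.+1)).
  by elim: k.+1 => [|j IH] a b //= /(can_inj (homeoK T)) /IH.
by apply: inj; rewrite -!D1 NegzE !addrA subrr add0r.
Qed.

End iterz.

Section ergodic.
Context {R : realType} {Omega : pmetricType R}.
Variables (T : homeomorphism Omega) (mu : probability (borel Omega) R).

Definition ergodic :=
  (forall A : set (borel Omega), measurable A -> mu (T @^-1` A) = mu A) /\
  (forall A : set (borel Omega), measurable A -> T @^-1` A = A ->
     mu A = 0%E \/ mu A = 1%E).

Definition supp : set Omega :=
  [set w | forall U : set Omega, open U -> U w -> (0 < mu U)%E].

End ergodic.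

Section l2.
Context {R : realType}.
Implicit Types (psi : int -> R[i]) (A B : (int -> R[i]) -> (int -> R[i])).

Definition l2norm2 psi : \bar R :=
  (\esum_(n in [set: int]) (Normc.normc (psi n) ^+ 2)%:E)%E.

Definition l2 : set (int -> R[i]) := [set psi | (l2norm2 psi < +oo)%E].

Definition bounded_l2_operator A :=
  (forall (a : R[i]) psi1 psi2, l2 psi1 -> l2 psi2 ->
     A (a *: psi1 + psi2) = a *: A psi1 + A psi2) /\
  (exists M : R, forall psi, l2 psi ->
     (l2norm2 (A psi) <= M%:E * l2norm2 psi)%E).

Definition l2_resolvent_set A : set R[i] :=
  [set z | exists B, bounded_l2_operator B /\
     forall psi, l2 psi ->
       A (B psi) - z *: B psi = psi /\ B (A psi - z *: psi) = psi].

Definition l2_spectrum A : set R[i] := ~` l2_resolvent_set A.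

End l2.

Section schroedinger.
Context {R : realType} {Omega : pmetricType R} (T : homeomorphism Omega).

Definition schroedinger (f : Omega -> R) (w : Omega)
    (psi : int -> R[i]) : int -> R[i] :=
  fun n => psi (n - 1) + psi (n + 1) + (f (iterz T n w))%:C%C * psi n.

(* S is the set Sigma_{mu,f}; it is unique, since mu is a probability. *)
Definition almost_sure_spectrum (mu : probability (borel Omega) R)
    (f : Omega -> R) (S : set R) :=
  compact S /\
  {ae mu, forall w, l2_spectrum (schroedinger f w) = [set (E%:C)%C | E in S]}.

End schroedinger.

Section circle.
Context (R : realType).

Let mod1' (x y : R) := `[< exists n : int, y = x - n%:~R >].

Local Lemma mod1_refl : reflexive mod1'.
Proof. by move=> x; apply/asboolP; exists 0; rewrite subr0. Qed.

Local Lemma mod1_sym : symmetric mod1'.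
Proof.
move=> x y; apply/asboolP/asboolP => -[n ->]; exists (- n);
  by rewrite mulrNz opprK subrK.
Qed.

Local Lemma mod1_trans : transitive mod1'.
Proof.
move=> y x z /asboolP[n ->] /asboolP[m ->]; apply/asboolP; exists (n + m).
by rewrite intrD opprD addrA.
Qed.

Definition mod1 := EquivRel _ mod1_refl mod1_sym mod1_trans.

Definition circle := {eq_quot mod1}.

HB.instance Definition _ := Topological.copy circle (quotient_topology circle).
HB.instance Definition _ := Quotient.on circle.

End circle.

Section suspension.
Context {R : realType} {Omega : pmetricType R} (T : homeomorphism Omega).

Let susp_rel' (p q : Omega * R) :=
  `[< exists n : int, q = (iterz T n p.1, p.2 - n%:~R) >].

Local Lemma susp_rel_refl : reflexive susp_rel'.
Proof. by case=> w t; apply/asboolP; exists 0; rewrite subr0. Qed.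

Local Lemma susp_rel_sym : symmetric susp_rel'.
Proof.
move=> [w t] [w' t']; apply/asboolP/asboolP => -[n [-> ->]]; exists (- n) => /=;
  by rewrite -iterzD addNr mulrNz opprK subrK.
Qed.

Local Lemma susp_rel_trans : transitive susp_rel'.
Proof.
move=> [w2 t2] [w1 t1] [w3 t3] /asboolP[n [-> ->]] /asboolP[m [-> ->]].
apply/asboolP; exists (m + n) => /=.
by rewrite iterzD intrD opprD addrA addrAC.
Qed.

Definition susp_rel := EquivRel _ susp_rel_refl susp_rel_sym susp_rel_trans.

Definition suspension := {eq_quot susp_rel}.

HB.instance Definition _ :=
  Topological.copy suspension (quotient_topology suspension).
HB.instance Definition _ := Quotient.on suspension.
HB.instance Definition _ := isPointed.Build suspension (\pi_suspension (point, 0)).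

Definition susp_class (w : Omega) (t : R) : suspension :=
  \pi_suspension (w, t).

(* By [susp_flowE] the representative of x does not matter. *)
Definition susp_flow (t : R) (x : suspension) : suspension :=
  susp_class (repr x).1 ((repr x).2 + t).

Lemma susp_flowE t w s : susp_flow t (susp_class w s) = susp_class w (s + t).
Proof.
rewrite /susp_flow /susp_class.
have /eqmodP/asboolP[n ->] :
    (w, s) = repr (\pi_suspension (w, s)) %[mod suspension] by rewrite reprK.
apply/esym/eqmodP/asboolP; exists n => /=.
by rewrite addrAC.
Qed.

End suspension.

Section schwartzman.
Context {R : realType} {Omega : pmetricType R}.
Variables (T : homeomorphism Omega) (mu : probability (borel Omega) R).

Local Notation X := (suspension T).
Implicit Types phi psi : X -> circle R.

(* The measure against which g integrates to the integral over s in [0, 1] of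
   the mu-integral of w |-> g [w, s]; here g is the indicator of A. *)
Definition susp_measure (A : set (borel X)) : \bar R :=
  (\int[lebesgue_measure]_(s in `[0%R, 1%R])
     \int[mu]_w (\1_A (susp_class T w s))%:E)%E.

Definition homotopic phi psi :=
  exists H : X * R -> circle R,
    [/\ {within [set: X] `*` `[0, 1], continuous H},
        forall x, H (x, 0) = phi x & forall x, H (x, 1) = psi x].

Definition homotopy_class phi : set (X -> circle R) :=
  [set psi | continuous psi /\ homotopic phi psi].

Definition C_sharp : set (set (X -> circle R)) :=
  [set homotopy_class phi | phi in [set phi | continuous phi]].

Definition orbit_lift phi (x : X) (g : R -> R) :=
  continuous g /\ forall t, \pi_(circle R) (g t) = phi (susp_flow t x).

Definition asymptotic_winding phi (a : R) :=
  {ae susp_measure, forall x : X, exists2 g, orbit_lift phi x g &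
     g t / t @[t --> +oo] --> a}.

(* [schwartzman c a] is the graph of the Schwartzman homomorphism; the value
   a does not depend on the representative phi of c. *)
Definition schwartzman (c : set (X -> circle R)) (a : R) :=
  exists2 phi, c phi & asymptotic_winding phi a.

Definition schwartzman_group : set R :=
  [set a | exists2 c, C_sharp c & schwartzman c a].

End schwartzman.

(* Main.v *)
Require Import Defs.
From mathcomp Require Import all_boot all_order all_algebra.
From mathcomp Require Import complex.
From mathcomp Require Import all_classical all_reals all_analysis measurable_realfun.
From mathcomp Require Import zify ring lra.

(**
  Let E be an energy outside the spectrum. Then H_w - E is bounded below uniformly in w, so
  the solutions of H_w u = E u that are square summable at +oo form a line, and this line
  depends continuously on w. It is invariant under the transfer matrices, and in a suitable
  coordinate on the projective line it yields a continuous map from the suspension to the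
  circle whose winding number is -N(E), where N(E) is the frequency of the sign changes of
  the decaying solution. So N(E) lies in the Schwartzman group and in [0, 1].

  If an energy of the spectrum separates E < E', then N(E') < N(E). Indeed the angle of a
  solution is monotone in the energy, and it gains a full half-turn on every window close to
  one that carries an approximate eigenvector with energy in ]E, E'[: otherwise the
  Wronskian w of solutions u, u' for E and E' would keep its sign there, and the
  factorization (H - E)(H - E') = D^* D through the Casoratian with u and u' would make this
  product nonnegative on the approximate eigenvector. Such windows have positive frequency
  by ergodicity.

  If the group is (1/n)Z, then N takes at most the values 0, 1/n, ..., 1 off the spectrum,
  which leaves room for n components only.
*)

Set Implicit Arguments.
Unset Strict Implicit.
Unset Printing Implicit Defensive.

Import Order.TTheory GRing.Theory Num.Theory.
Import numFieldNormedType.Exports.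

Local Open Scope classical_set_scope.
Local Open Scope ring_scope.
Local Open Scope quotient_scope.

(** * Jacobi operators on the integers *)

Section window_sums.
Context {R : realType}.
Implicit Types (F G psi phi v : int -> R) (a b : int) (n m : nat).

(** A gap is encoded as a lower bound for [H - E] on finitely supported real vectors, with one
    constant for all points. Such a bound survives small changes of the energy, spreads from one
    dense orbit to the whole space, and yields both a bounded inverse and quantitative control of
    half-line solutions. Square summability takes the place of exponential decay: the Wronskian of
    two solutions with bounded square sums is small on average, which gives uniqueness of the
    decaying direction, and its continuity when two potentials nearly agree on a long window. The
    decaying line need not have a continuous nonvanishing section, so whatever is derived from it is
    invariant under scaling and checked on local sections. Neither its angle [theta], lifted to the
    reals, nor the indicator of a sign change is continuous. Their jumps cancel in the increment
    [theta (T w) - theta w - flip], and linear interpolation along the flow turns these increments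
    into a continuous circle-valued map. *)

Definition wsum a n F : R := \sum_(i < n) F (a + i%:Z).

Lemma wsum_cat a n m F : wsum a (n + m) F = wsum a n F + wsum (a + n%:Z) m F.
Proof.
rewrite /wsum big_split_ord /=; congr (_ + _).
by apply: eq_bigr => i _; rewrite PoszD addrA.
Qed.

Lemma eq_wsum a n F G :
  (forall i, a <= i < a + n%:Z -> F i = G i) -> wsum a n F = wsum a n G.
Proof. by move=> FG; apply: eq_bigr => i _; apply: FG; have := ltn_ord i; lia. Qed.

Lemma le_wsum a n F G :
  (forall i, a <= i < a + n%:Z -> F i <= G i) -> wsum a n F <= wsum a n G.
Proof. by move=> FG; apply: ler_sum => i _; apply: FG; have := ltn_ord i; lia. Qed.

Lemma wsum_ge0 a n F : (forall i, 0 <= F i) -> 0 <= wsum a n F.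
Proof. by move=> F0; apply: sumr_ge0. Qed.

Lemma wsum0 a n F :
  (forall i, a <= i < a + n%:Z -> F i = 0) -> wsum a n F = 0.
Proof. by move=> F0; apply: big1 => i _; apply: F0; have := ltn_ord i; lia. Qed.

Lemma wsumD a n F G : wsum a n (fun i => F i + G i) = wsum a n F + wsum a n G.
Proof. exact: big_split. Qed.

Lemma wsumZ a n k F : wsum a n (fun i => k * F i) = k * wsum a n F.
Proof. by rewrite /wsum mulr_sumr. Qed.

Lemma wsum_split a n b m F : b <= a -> a + n%:Z <= b + m%:Z ->
  exists k l : nat, [/\ a = b + k%:Z, m = (k + n + l)%N &
    wsum b m F = wsum b k F + wsum a n F + wsum (a + n%:Z) l F].
Proof.
move=> ba am; exists (absz (a - b)%R), (absz (b + m%:Z - (a + n%:Z))%R).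
have ak : a = b + (absz (a - b)%R)%:Z by lia.
have mk : m = ((absz (a - b)%R) + n + (absz (b + m%:Z - (a + n%:Z))%R))%N by lia.
split=> //; by rewrite {1}mk !wsum_cat PoszD addrA -ak.
Qed.

Lemma wsum_sub a n b m F : (forall i, 0 <= F i) -> b <= a ->
  a + n%:Z <= b + m%:Z -> wsum a n F <= wsum b m F.
Proof.
move=> F0 /(wsum_split F) H /H[k [l [_ _ ->]]].
by rewrite -addrA addrCA lerDl addr_ge0// wsum_ge0.
Qed.

Definition supp_in a n psi := forall i, (i < a) || (a + n%:Z <= i) -> psi i = 0.

Lemma wsum_ext a n b m F : supp_in a n F -> b <= a ->
  a + n%:Z <= b + m%:Z -> wsum b m F = wsum a n F.
Proof.
move=> F0 /(wsum_split F) H /H[k [l [ak mk ->]]].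
rewrite [X in X + _ + _]wsum0 ?[X in _ + _ + X]wsum0 ?add0r ?addr0// => i ?;
  apply: F0; lia.
Qed.

Lemma wsum_telescope a n G :
  wsum a n (fun i => G (i + 1) - G i) = G (a + n%:Z) - G a.
Proof.
elim: n => [|n IH]; first by rewrite /wsum big_ord0 addr0 subrr.
rewrite -addn1 wsum_cat IH /wsum big_ord1 /= addr0.
by have -> : a + (n + 1)%N%:Z = a + n%:Z + 1; [lia|ring].
Qed.

Lemma cvg_sum_ord (I : Type) (fl : set_system I) {ffl : Filter fl} n
    (F_ : I -> nat -> R) (F : nat -> R) : (forall i, F_ k i @[k --> fl] --> F i) ->
  \sum_(i < n) F_ k i @[k --> fl] --> \sum_(i < n) F i.
Proof.
move=> FF; elim: n => [|n IH].
  by rewrite big_ord0; under eq_fun do rewrite big_ord0; exact: cvg_cst.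
rewrite big_ord_recr/=; under eq_fun do rewrite big_ord_recr/=.
by apply: cvgD; [exact: IH|exact: FF].
Qed.

Lemma cvg_wsum (I : Type) (fl : set_system I) {ffl : Filter fl} a n (F_ : I -> int -> R) F :
  (forall i, F_ k i @[k --> fl] --> (F i : R)) ->
  wsum a n (F_ k) @[k --> fl] --> wsum a n F.
Proof.
move=> FF; apply: (@cvg_sum_ord _ _ _ n (fun k i => F_ k (a + i%:Z))
  (fun i => F (a + i%:Z))) => i; exact: FF.
Qed.

Definition jac v psi : int -> R := fun i => psi (i - 1) + psi (i + 1) + v i * psi i.

Lemma supp_in_jac a n v psi : supp_in a n psi -> supp_in (a - 1) (n + 2) (jac v psi).
Proof. by move=> p i ib; rewrite /jac !p ?mulr0 ?addr0//; lia. Qed.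

(** Summation by parts: the difference of the two sides telescopes through the Wronskian of [psi]
    and [phi], which vanishes beyond the support of [psi]; [phi] is arbitrary. *)
Lemma jac_sym a n v psi phi b m : supp_in a n psi -> b <= a - 1 ->
  a + n%:Z + 1 <= b + m%:Z ->
  wsum b m (fun i => psi i * jac v phi i) = wsum b m (fun i => jac v psi i * phi i).
Proof.
move=> p ba am; apply/eqP; rewrite -subr_eq0 -mulN1r -wsumZ -wsumD.
pose G i := psi (i - 1) * phi i - phi (i - 1) * psi i.
rewrite (@eq_wsum _ _ _ (fun i => G (i + 1) - G i)); last first.
  by move=> i _; rewrite /jac /G addrK; ring.
by rewrite wsum_telescope /G !p ?mulr0 ?mul0r ?subrr//; lia.
Qed.

Lemma sqrD3_le (x y z : R) : (x + y + z) ^+ 2 <= 3 * (x ^+ 2 + y ^+ 2 + z ^+ 2).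
Proof.
rewrite -subr_ge0.
have -> : 3 * (x ^+ 2 + y ^+ 2 + z ^+ 2) - (x + y + z) ^+ 2 =
  (x - y) ^+ 2 + (y - z) ^+ 2 + (x - z) ^+ 2 by ring.
by rewrite !addr_ge0 ?sqr_ge0.
Qed.

Lemma wsum_shift a n b F : wsum a n (fun i => F (i + b)) = wsum (a + b) n F.
Proof. by apply: eq_bigr => i _; rewrite addrAC. Qed.

(** The 3 comes from squaring a sum of three terms, [2 + C] from the two shifts and the
    potential. *)
Lemma jac_bound a n v psi C : (forall i, v i ^+ 2 <= C) ->
  wsum a n (fun i => jac v psi i ^+ 2) <=
  (3 * (2 + C)) * wsum (a - 1) (n + 2) (fun i => psi i ^+ 2).
Proof.
move=> vC; set F := fun i => psi i ^+ 2.
have F0 i : 0 <= F i by exact: sqr_ge0.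
have -> : (3 * (2 + C)) * wsum (a - 1) (n + 2) F =
  3 * (wsum (a - 1) (n + 2) F + wsum (a - 1) (n + 2) F + C * wsum (a - 1) (n + 2) F)
  by ring.
have C0 : 0 <= C by exact: le_trans (sqr_ge0 _) (vC 0).
apply: (@le_trans _ _ (3 * (wsum (a - 1) n F + wsum (a + 1) n F + C * wsum a n F))).
  rewrite -!wsum_shift -wsumZ -!wsumD -wsumZ; apply: le_wsum => i _.
  apply: (le_trans (sqrD3_le _ _ _)).
  by rewrite ler_wpM2l// lerD2l exprMn /F ler_wpM2r// sqr_ge0.
rewrite ler_wpM2l// !lerD// ?ler_wpM2l//; apply: wsum_sub => //; lia.
Qed.

(** A bound on the squared l2 norm, stated through finite windows: it passes to pointwise limits, so
    that no completeness argument is called for. *)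
Definition bdd (x : int -> R) (B : R) :=
  forall a n, wsum a n (fun i => x i ^+ 2) <= B.

Lemma bdd_ge0 x B : bdd x B -> 0 <= B.
Proof. by move=> /(_ 0 0%N); rewrite /wsum big_ord0. Qed.

Lemma bdd_le x B B' : B <= B' -> bdd x B -> bdd x B'.
Proof. by move=> BB' xB a n; apply: le_trans BB'. Qed.

Lemma bdd_pt x B i : bdd x B -> x i ^+ 2 <= B.
Proof. by move=> /(_ i 1%N); rewrite /wsum big_ord1 addr0. Qed.

(** A small [e] keeps the second constant close to [B']; [kop_solve] needs [(1 + e) * q < 1]. *)
Lemma bddD x y B B' (e : R) : 0 < e -> bdd x B -> bdd y B' ->
  bdd (fun i => x i + y i) ((1 + e^-1) * B + (1 + e) * B').
Proof.
move=> e0 xB yB a n.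
apply: (@le_trans _ _ ((1 + e^-1) * wsum a n (fun i => x i ^+ 2) +
  (1 + e) * wsum a n (fun i => y i ^+ 2))).
  rewrite -!wsumZ -wsumD; apply: le_wsum => i _.
  rewrite -subr_ge0.
  have -> : (1 + e^-1) * x i ^+ 2 + (1 + e) * y i ^+ 2 - (x i + y i) ^+ 2
    = e^-1 * (x i - e * y i) ^+ 2 by field; rewrite gt_eqF.
  by rewrite mulr_ge0 ?sqr_ge0// invr_ge0 ltW.
by apply: lerD; rewrite ler_wpM2l ?addr_ge0 ?invr_ge0// ltW.
Qed.

Lemma bddZ x B k : bdd x B -> bdd (fun i => k * x i) (k ^+ 2 * B).
Proof.
move=> xB a n; rewrite (@eq_wsum _ _ _ (fun i => k ^+ 2 * x i ^+ 2)).
  by rewrite wsumZ ler_wpM2l ?sqr_ge0.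
by move=> i _; rewrite exprMn.
Qed.

Lemma bdd_jac v x B C : (forall i, v i ^+ 2 <= C) -> bdd x B ->
  bdd (jac v x) (3 * (2 + C) * B).
Proof.
move=> vC xB a n; apply: le_trans (jac_bound _ _ _ vC) _.
by rewrite ler_wpM2l// mulr_ge0// addr_ge0// (le_trans (sqr_ge0 _) (vC 0)).
Qed.

End window_sums.

(** * Inversion by a Neumann series *)

Section inverse.
Context {R : realType}.
Variables (v : int -> R) (y C kappa : R).
Hypothesis vC : forall i, v i ^+ 2 <= C.
Hypothesis kappa0 : 0 < kappa.

(** With [v] already shifted by the real part of [z], the right-hand side is the squared norm of
    [(H - z) psi] for real [psi]. *)
Definition low_bound := forall a n psi, supp_in a n psi ->
  kappa * wsum a n (fun i => psi i ^+ 2) <=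
  wsum (a - 1) (n + 2) (fun i => jac v psi i ^+ 2) +
    y ^+ 2 * wsum a n (fun i => psi i ^+ 2).

(* [(H - z)(H - conj z)] for [z = x + i y] and [H = jac (v + x)]; unlike [H - z], it is a
   real operator. *)
Definition kop psi : int -> R := fun i => jac v (jac v psi) i + y ^+ 2 * psi i.

(** The 2 comes from squaring the two terms of [kop], and [3 * (2 + C)] is the bound of [jac_bound].
    The summand [kappa] gives [kappa <= M], hence [0 <= q]. *)
Let M := 2 * (3 * (2 + C) + y ^+ 2) + kappa.

Let C0 : 0 <= C. Proof. exact: le_trans (sqr_ge0 _) (vC 0). Qed.

Let M0 : 0 < M.
Proof. by rewrite /M ltr_wpDl// mulr_ge0// addr_ge0 ?sqr_ge0// mulr_ge0// addr_ge0. Qed.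

Definition qop psi : int -> R := fun i => psi i - M^-1 * kop psi i.

Let q := 1 - kappa / M.

Let q1 : 0 <= q < 1.
Proof.
rewrite /q subr_ge0 ltrBlDr ltrDl divr_gt0// andbT ler_pdivrMr// mul1r /M lerDr.
by rewrite mulr_ge0// addr_ge0 ?sqr_ge0// mulr_ge0// addr_ge0.
Qed.

(* [K = kop] is positive and bounded, so that [|K psi|^2 <= M <K psi, psi>]; hence
   [|psi - K psi / M|^2 <= |psi|^2 - <K psi, psi> / M]. *)
Lemma qop_contract_supp a n psi : low_bound -> supp_in a n psi ->
  wsum (a - 2) (n + 4) (fun i => qop psi i ^+ 2) <=
  q * wsum a n (fun i => psi i ^+ 2).
Proof.
move=> lb p; set b := a - 3; set m := (n + 6)%N.
have pj : supp_in (a - 1) (n + 2) (jac v psi) by exact: supp_in_jac.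
have pjj : supp_in (a - 2) (n + 4) (jac v (jac v psi)).
  by move=> i ib; rewrite (supp_in_jac v pj)//; lia.
have pk : supp_in (a - 2) (n + 4) (kop psi).
  by move=> i ib; rewrite /kop pjj// p ?mulr0 ?addr0//; lia.
have pq : supp_in (a - 2) (n + 4) (qop psi).
  by move=> i ib; rewrite /qop pk// p ?mulr0 ?subr0//; lia.
have sq G c k : supp_in c k G -> supp_in c k (fun i => G i ^+ 2 : R).
  by move=> G0 i /G0 ->; rewrite expr0n.
rewrite -(@wsum_ext _ _ _ b m _ (sq _ _ _ pq)); [|lia..].
rewrite -(@wsum_ext _ _ _ b m _ (sq _ _ _ p)); [|lia..].
have := lb _ _ _ p.
rewrite -(@wsum_ext _ _ _ b m _ (sq _ _ _ p)); [|lia..].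
rewrite -(@wsum_ext _ _ _ b m _ (sq _ _ _ pj)); [|lia..].
set P := wsum b m (fun i => psi i ^+ 2).
set J := wsum b m (fun i => jac v psi i ^+ 2) => lbP.
have PK : wsum b m (fun i => psi i * kop psi i) = J + y ^+ 2 * P.
  rewrite (@eq_wsum _ _ _ _ (fun i => psi i * jac v (jac v psi) i + y ^+ 2 * psi i ^+ 2)).
    by rewrite wsumD wsumZ (jac_sym _ _ p); [|lia..]; congr (_ + _); apply: eq_wsum.
  by move=> i _; rewrite /kop; ring.
have KK : wsum b m (fun i => kop psi i ^+ 2) <= M * (J + y ^+ 2 * P).
  apply: (@le_trans _ _ (2 * wsum b m (fun i => jac v (jac v psi) i ^+ 2) +
      2 * y ^+ 4 * P)).
    rewrite -!wsumZ -wsumD; apply: le_wsum => i _; rewrite -subr_ge0.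
    have -> : 2 * jac v (jac v psi) i ^+ 2 + 2 * y ^+ 4 * psi i ^+ 2 - kop psi i ^+ 2
      = (jac v (jac v psi) i - y ^+ 2 * psi i) ^+ 2 by rewrite /kop; ring.
    exact: sqr_ge0.
  have : wsum b m (fun i => jac v (jac v psi) i ^+ 2) <= 3 * (2 + C) * J.
    apply: le_trans (jac_bound _ _ _ vC) _.
    rewrite (@wsum_ext _ (a - 1) (n + 2)); [|exact: sq|lia..].
    rewrite -(@wsum_ext _ _ _ b m _ (sq _ _ _ pj)) ?lexx//; lia.
  have J0 : 0 <= J by apply: wsum_ge0 => i; apply: sqr_ge0.
  have P0 : 0 <= P by apply: wsum_ge0 => i; apply: sqr_ge0.
  have yP0 : 0 <= y ^+ 2 * P by rewrite mulr_ge0 ?sqr_ge0.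
  have y40 : 0 <= y ^+ 2 * J by rewrite mulr_ge0 ?sqr_ge0.
  have CP : 0 <= C * (y ^+ 2 * P) by rewrite mulr_ge0.
  have kP : 0 <= kappa * (y ^+ 2 * P) by rewrite mulr_ge0// ltW.
  have kJ : 0 <= kappa * J by rewrite mulr_ge0// ltW.
  have -> : y ^+ 4 = y ^+ 2 * y ^+ 2 by ring.
  rewrite /M; move: (y ^+ 2) yP0 y40 CP kP => Y *; nra.
have -> : wsum b m (fun i => qop psi i ^+ 2) =
   P - 2 * M^-1 * (J + y ^+ 2 * P) + M^-1 ^+ 2 * wsum b m (fun i => kop psi i ^+ 2).
  rewrite -PK -mulNr -!wsumZ -!wsumD; apply: eq_wsum => i _; rewrite /qop; ring.
have KK' : M^-1 ^+ 2 * wsum b m (fun i => kop psi i ^+ 2) <= M^-1 * (J + y ^+ 2 * P).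
  apply: le_trans (ler_wpM2l (sqr_ge0 _) KK) _.
  by rewrite expr2 -mulrA mulKf ?lexx// gt_eqF.
have : kappa / M * P <= M^-1 * (J + y ^+ 2 * P).
  by rewrite mulrAC mulrC ler_wpM2l// invr_ge0 ltW.
rewrite /q; lra.
Qed.

Definition trunc a n (x : int -> R) : int -> R :=
  fun i => if (a <= i < a + n%:Z) then x i else 0.

Lemma supp_trunc a n x : supp_in a n (trunc a n x).
Proof. by move=> i ib; rewrite /trunc ifF//; lia. Qed.

Lemma qop_contract x B : low_bound -> bdd x B -> bdd (qop x) (q * B).
Proof.
(* [qop] reaches two sites to each side, so cutting [x] off outside this larger window does not
   affect [qop x] on the original one. *)
move=> lb xB a n; pose p := trunc (a - 2) (n + 4) x.
apply: (@le_trans _ _ (q * wsum (a - 2) (n + 4) (fun i => p i ^+ 2))).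
  apply: le_trans (qop_contract_supp lb (@supp_trunc _ _ _)).
  apply: (@le_trans _ _ (wsum a n (fun i => qop p i ^+ 2))).
    rewrite (@eq_wsum _ _ _ _ (fun i => qop p i ^+ 2)) ?lexx// => i ib.
    by rewrite /qop /kop /jac /p /trunc !ifT//; lia.
  by apply: wsum_sub; [move=> i; exact: sqr_ge0|lia..].
rewrite ler_wpM2l//; first by case/andP: q1.
rewrite (@eq_wsum _ _ _ _ (fun i => x i ^+ 2)) ?xB// => i ib.
by rewrite /p /trunc ib.
Qed.

Lemma qopN_bdd x B k : low_bound -> bdd x B -> bdd (iter k qop x) (q ^+ k * B).
Proof.
move=> lb xB; elim: k => [|k IH]; first by rewrite expr0 mul1r.
by rewrite iterS exprS -mulrA; exact: qop_contract.
Qed.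

(** A bounded element of the kernel is fixed by the contraction [qop], so [q ^+ k * B] bounds it for
    every [k]. *)
Lemma kop_inj x B : low_bound -> bdd x B -> (forall i, kop x i = 0) ->
  forall i, x i = 0.
Proof.
move=> lb xB kx.
have qx : qop x = x by apply/funext => i; rewrite /qop kx mulr0 subr0.
have bk k : bdd x (q ^+ k * B).
  by have := qopN_bdd k lb xB; rewrite (_ : iter k qop x = x)//; elim: k => //= k ->.
move=> i; apply/eqP; rewrite -sqrf_eq0 eq_le sqr_ge0 andbT.
case/andP: q1 => q0 ql1.
have cv : (fun k => q ^+ k * B) @ \oo --> 0.
  rewrite -[X in _ --> X](mul0r B); apply: cvgMl.
  by apply: cvg_expr; rewrite ger0_norm.
by apply: (@ler_cvg_to _ _ _ _ _ _ _ _ (cvg_cst _) cv); apply: nearW => k; exact: bdd_pt.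
Qed.

Lemma kop_solve : low_bound -> exists2 Bc : R, 0 <= Bc &
  forall g B, bdd g B -> exists2 x, bdd x (Bc * B) & forall i, kop x i = g i.
Proof.
move=> lb; case/andP: q1 => q0 ql1.
have [e e0 qe] : exists2 e : R, 0 < e & (1 + e) * q < 1.
  exists ((1 - q) / 2); first by rewrite divr_gt0// subr_gt0.
  nra.
(* The partial sums of the Neumann series satisfy [x_ k.+1 = g + qop (x_ k)]; [c] is the fixed point
   of the resulting recursion [c = (1 + e^-1) + (1 + e) * q * c], so [c * B] bounds all of them. *)
pose c := (1 + e^-1) / (1 - (1 + e) * q).
have c0 : 0 <= c by rewrite divr_ge0 ?subr_ge0 ?ltW// addr_gt0 ?invr_gt0.
exists (M^-1 ^+ 2 * c); first by rewrite mulr_ge0 ?sqr_ge0.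
move=> g0 B0 gB0; pose g i := M^-1 * g0 i; pose B := M^-1 ^+ 2 * B0.
have gB : bdd g B by exact: bddZ.
have Bge0 : 0 <= B := bdd_ge0 gB.
pose x_ k i := \sum_(j < k) iter j qop g i.
have qop_lin z w i : qop (fun i => z i + w i) i = qop z i + qop w i.
  by rewrite /qop /kop /jac; ring.
have qop0 i : qop (fun=> 0) i = 0 by rewrite /qop /kop /jac; ring.
have x_S k : x_ k.+1 = fun i => g i + qop (x_ k) i.
  apply/funext => i; rewrite /x_ big_ord_recl /=; congr (_ + _).
  elim: k i => [|k IH] i; first by rewrite big_ord0 (_ : (fun=> _) = fun=> 0) ?qop0//;
    apply/funext => ?; rewrite big_ord0.
  rewrite big_ord_recr /= IH.
  rewrite (_ : (fun i0 => \sum_(j < k.+1) _) =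
    (fun i => (fun i => \sum_(j < k) iter j qop g i) i + iter k qop g i)) ?qop_lin//.
  by apply/funext => j; rewrite big_ord_recr.
have x_bdd k : bdd (x_ k) (c * B).
  elim: k => [|k IH].
    apply: (@bdd_le _ _ 0); first by rewrite mulr_ge0.
    by move=> a n; rewrite wsum0// => i _; rewrite /x_ big_ord0 expr0n.
  rewrite x_S; apply: (bdd_le _ (bddD e0 gB (qop_contract lb IH))).
  rewrite /c le_eqVlt; apply/orP; left; apply/eqP; field.
  by rewrite ?gt_eqF// subr_gt0.
have x_cvg i : cvgn (fun k => x_ k i).
  pose s := Num.sqrt q; pose b := Num.sqrt B.
  have s1 : `|s| < 1 by rewrite ger0_norm ?sqrtr_ge0// -sqrtr1 ltr_sqrt.
  have cg : cvgn (series (geometric b s)) by exact: is_cvg_geometric_series.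
  rewrite (_ : (fun k => x_ k i) = series (fun j => iter j qop g i)); last first.
    by apply/funext => k; rewrite /x_ /series /= big_mkord.
  apply: normed_cvg; apply: series_le_cvg cg => k //=.
    by rewrite mulr_ge0 ?exprn_ge0 ?sqrtr_ge0.
  rewrite -(@ler_pXn2r _ 2) ?nnegrE ?mulr_ge0 ?exprn_ge0 ?sqrtr_ge0//.
  rewrite real_normK ?num_real// exprMn sqr_sqrtr// -exprM mulnC exprM sqr_sqrtr//.
  by rewrite mulrC; apply: bdd_pt; exact: qopN_bdd.
pose x i := limn (fun k => x_ k i).
have xl i : (fun k => x_ k i) @ \oo --> x i := x_cvg i.
have jl w (w_ : nat -> int -> R) : (forall i, (fun k => w_ k i) @ \oo --> (w i : R)) ->
    forall i, (fun k => jac v (w_ k) i) @ \oo --> jac v w i.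
  by move=> wl i; apply: cvgD; [apply: cvgD|apply: cvgMr]; exact: wl.
have ql i : (fun k => g i + qop (x_ k) i) @ \oo --> g i + qop x i.
  apply: cvgD; first exact: cvg_cst.
  apply: cvgB; first exact: xl.
  apply: cvgMr; apply: cvgD; last by apply: cvgMr; exact: xl.
  by apply: (jl) => ?; apply: (jl).
have fixx i : x i = g i + qop x i.
  apply: (@cvg_unique _ _ _ _ _ _ _ (ql i)); first exact: Rhausdorff.
  rewrite (_ : (fun k => _) = (fun k => x_ k.+1 i)); last by apply/funext => k; rewrite x_S.
  by have := xl i; rewrite -cvg_shiftS.
exists x.
  move=> a n; rewrite -mulrA [c * _]mulrC mulrA -/B mulrC.
  have cv : (fun k => wsum a n (fun i => x_ k i ^+ 2)) @ \oo -->
     wsum a n (fun i => x i ^+ 2).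
    apply: (@cvg_wsum _ _ _ _ _ _ (fun k i => x_ k i ^+ 2)) => i.
    by under eq_fun do rewrite expr2; rewrite expr2; apply: cvgM; exact: xl.
  by apply: (@ler_cvg_to _ _ _ _ _ _ _ _ cv (cvg_cst _)); apply: nearW => k; exact: x_bdd.
move=> i; apply: (@mulfI _ M^-1); first by rewrite invr_eq0 gt_eqF.
by have := fixx i; rewrite /qop /g; lra.
Qed.

End inverse.

(** * Lower bounds and the resolvent set on complex l2 *)

Section complex_l2.
Context {R : realType}.
Implicit Types (psi phi : int -> R[i]) (v : int -> R).

Definition bddc psi B := forall a n,
  wsum a n (fun i => complex.Re (psi i) ^+ 2 + complex.Im (psi i) ^+ 2) <= B.

Lemma normc2E (z : R[i]) : Normc.normc z ^+ 2 = complex.Re z ^+ 2 + complex.Im z ^+ 2.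
Proof. by case: z => x y /=; rewrite sqr_sqrtr// addr_ge0 ?sqr_ge0. Qed.

(** The norm is a supremum over all finite sets of integers; each of them lies in a symmetric
    window. *)
Lemma l2norm2_le psi B : (l2norm2 psi <= B%:E)%E <-> bddc psi B.
Proof.
pose F (i : int) : \bar R := (Normc.normc (psi i) ^+ 2)%:E.
have F0 i : (0 <= F i)%E by rewrite lee_fin sqr_ge0.
pose win (a : int) n : set int := [set (a + k%:Z)%R | k in `I_n].
have WE (a : int) n : (\sum_(i \in win a n) F i =
    (wsum a n (fun i => complex.Re (psi i) ^+ 2 + complex.Im (psi i) ^+ 2))%:E)%E.
  rewrite /win fsbig_image; last by move=> x y _ _ /= e; lia.
  rewrite -(fsbig_ord _ _ (fun k => F (a + k%:Z))) -sumEFin.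
  by apply: eq_bigr => i _; rewrite /F normc2E.
split=> [le a n|bd].
  rewrite -lee_fin -WE; apply: (le_trans _ le); apply: ereal_sup_ubound.
  by exists (win a n) => //; split=> //; apply: finite_image.
apply: ge_ereal_sup => _ [A [finA _] <-].
have [N AN] : exists N : nat, A `<=` win (- N%:Z)%R (N + N).+1.
  have /finite_seqP[s ->] := finA.
  exists (\sum_(i <- s) absz i)%N => i /= si.
  have iN : (absz i <= \sum_(i <- s) absz i)%N.
    by rewrite (big_rem i)//= leq_addr.
  move: (\sum_(i <- s) absz i)%N iN => N iN.
  by exists (absz (i + N%:Z)%R) => /=; lia.
suff : (\sum_(i \in A) F i <= \sum_(i \in win (- N%:Z)%R (N + N).+1) F i)%E.
  by move=> /le_trans; apply; rewrite WE lee_fin.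
apply: lee_fsum_nneg_subset => //; first exact: finite_image.
by move=> i; rewrite !inE; exact: AN.
Qed.

Lemma l2norm2_ge0 psi : (0 <= l2norm2 psi)%E.
Proof. by apply: esum_ge0 => i _; rewrite lee_fin sqr_ge0. Qed.

Lemma l2P psi : l2 psi <-> exists B, bddc psi B.
Proof.
split=> [|[B /l2norm2_le]].
  rewrite /l2 /= => lt; exists (fine (l2norm2 psi)); apply/l2norm2_le.
  by rewrite fineK// ge0_fin_numE// l2norm2_ge0.
by move=> /le_lt_trans; apply; rewrite ltry.
Qed.

Lemma bddc_re psi B : bddc psi B -> bdd (fun i => complex.Re (psi i)) B.
Proof.
by move=> pB a n; apply: le_trans (pB a n); apply: le_wsum => i _; rewrite lerDl sqr_ge0.
Qed.

Lemma bddc_im psi B : bddc psi B -> bdd (fun i => complex.Im (psi i)) B.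
Proof.
by move=> pB a n; apply: le_trans (pB a n); apply: le_wsum => i _; rewrite lerDr sqr_ge0.
Qed.

Lemma bddcI psi B B' : bdd (fun i => complex.Re (psi i)) B ->
  bdd (fun i => complex.Im (psi i)) B' -> bddc psi (B + B').
Proof. by move=> pB pB' a n; rewrite wsumD lerD. Qed.

Definition hop v psi : int -> R[i] :=
  fun n => psi (n - 1) + psi (n + 1) + (v n)%:C%C * psi n.

Lemma hop_re v psi n : complex.Re (hop v psi n) = jac v (fun i => complex.Re (psi i)) n.
Proof.
by rewrite /hop /jac; case: (psi _) (psi _) (psi _) => a b [c d] [e f] /=; ring.
Qed.

Lemma hop_im v psi n : complex.Im (hop v psi n) = jac v (fun i => complex.Im (psi i)) n.
Proof.
by rewrite /hop /jac; case: (psi _) (psi _) (psi _) => a b [c d] [e f] /=; ring.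
Qed.

Lemma jac_subc v x (p : int -> R) n :
  jac (fun i => v i - x) p n = jac v p n - x * p n.
Proof. by rewrite /jac; ring. Qed.

Lemma complex_eq (z w : R[i]) :
  complex.Re z = complex.Re w -> complex.Im z = complex.Im w -> z = w.
Proof. by case: z w => ? ? [? ?] /= -> ->. Qed.

Lemma hopz_re v (z : R[i]) psi n : complex.Re ((hop v psi - z *: psi) n) =
  jac (fun i => v i - complex.Re z) (fun i => complex.Re (psi i)) n +
  complex.Im z * complex.Im (psi n).
Proof.
rewrite jac_subc -hop_re.
have -> : (hop v psi - z *: psi) n = hop v psi n - z * psi n by [].
by case: (hop v psi n) => p q; case: (psi n) => a b; case: z => x y /=; ring.
Qed.

Lemma hopz_im v (z : R[i]) psi n : complex.Im ((hop v psi - z *: psi) n) =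
  jac (fun i => v i - complex.Re z) (fun i => complex.Im (psi i)) n -
  complex.Im z * complex.Re (psi n).
Proof.
rewrite jac_subc -hop_im.
have -> : (hop v psi - z *: psi) n = hop v psi n - z * psi n by [].
by case: (hop v psi n) => p q; case: (psi n) => a b; case: z => x y /=; ring.
Qed.

Lemma hopz_linear v z a psi1 psi2 :
  hop v (a *: psi1 + psi2) - z *: (a *: psi1 + psi2) =
  a *: (hop v psi1 - z *: psi1) + (hop v psi2 - z *: psi2).
Proof.
apply/funext => n.
have L p q : (a *: p + q) n = a * p n + q n :> R[i] by [].
have E p : (hop v p - z *: p) n = hop v p n - z * p n by [].
rewrite L !E /hop.
have {}E i : (a *: psi1 + psi2) i = a * psi1 i + psi2 i by [].
by rewrite !E; ring.
Qed.

Lemma l2_lin a psi1 psi2 : l2 psi1 -> l2 psi2 -> l2 (a *: psi1 + psi2).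
Proof.
move=> /l2P[B1 b1] /l2P[B2 b2]; apply/l2P.
have r1 := bddc_re b1; have i1 := bddc_im b1.
have r2 := bddc_re b2; have i2 := bddc_im b2.
have E i : (a *: psi1 + psi2) i = a * psi1 i + psi2 i by [].
pose x := complex.Re a; pose y := complex.Im a.
have re := bddD ltr01 (bddD ltr01 (bddZ x r1) (bddZ (- y) i1)) r2.
have im := bddD ltr01 (bddD ltr01 (bddZ x i1) (bddZ y r1)) i2.
eexists; apply: bddcI.
- rewrite (_ : (fun i => _) = (fun i =>
    x * complex.Re (psi1 i) + - y * complex.Im (psi1 i) + complex.Re (psi2 i))).
    exact: re.
  apply/funext => i; rewrite E /x /y; case: (psi1 i) (psi2 i) (a) => ? ? [? ?] [? ?] /=; ring.
- rewrite (_ : (fun i => _) = (fun i =>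
    x * complex.Im (psi1 i) + y * complex.Re (psi1 i) + complex.Im (psi2 i))).
    exact: im.
  apply/funext => i; rewrite E /x /y; case: (psi1 i) (psi2 i) (a) => ? ? [? ?] [? ?] /=; ring.
Qed.

Section resolvent.
Variables (v : int -> R) (z : R[i]) (C kappa : R).
Hypothesis vC : forall i, (v i - complex.Re z) ^+ 2 <= C.
Hypothesis kappa0 : 0 < kappa.
Hypothesis lb : low_bound (fun i => v i - complex.Re z) (complex.Im z) kappa.

Let x := complex.Re z.
Let y := complex.Im z.
Let L := jac (fun i => v i - x).

Lemma l2_hopz psi : l2 psi -> l2 (hop v psi - z *: psi).
Proof.
move=> /l2P[B b]; apply/l2P; have r := bddc_re b; have i := bddc_im b.
have re := bddD ltr01 (bdd_jac vC r) (bddZ y i).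
have im := bddD ltr01 (bdd_jac vC i) (bddZ (- y) r).
eexists; apply: bddcI.
- by under eq_fun do rewrite hopz_re; exact: re.
- by under eq_fun do rewrite hopz_im -mulNr; exact: im.
Qed.

(** The real and imaginary parts of an element of the kernel are coupled by [L]; eliminating either
    of them shows that [kop] annihilates the other. *)
Lemma resolvent_uniq phi : l2 phi -> hop v phi - z *: phi = 0 -> phi = 0.
Proof.
move=> /l2P[B b] e.
have e1 n : L (fun i => complex.Re (phi i)) n = - y * complex.Im (phi n).
  by have := hopz_re v z phi n; rewrite e /= -/x -/y -/L; lra.
have e2 n : L (fun i => complex.Im (phi i)) n = y * complex.Re (phi n).
  by have := hopz_im v z phi n; rewrite e /= -/x -/y -/L; lra.
have LZ k p n : L (fun i => k * p i) n = k * L p n by rewrite /L /jac; ring.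
have k1 n : kop (fun i => v i - x) y (fun i => complex.Re (phi i)) n = 0.
  by rewrite /kop -/L (_ : L (fun _ => complex.Re _) = (fun n => - y * complex.Im (phi n)))
    ?LZ ?e2 /=; [ring|exact/funext].
have k2 n : kop (fun i => v i - x) y (fun i => complex.Im (phi i)) n = 0.
  by rewrite /kop -/L (_ : L (fun _ => complex.Im _) = (fun n => y * complex.Re (phi n)))
    ?LZ ?e1 /=; [ring|exact/funext].
apply/funext => i; apply: complex_eq.
  exact: (kop_inj vC kappa0 lb (bddc_re b) k1).
exact: (kop_inj vC kappa0 lb (bddc_im b) k2).
Qed.

Lemma resolvent_exists : exists M : R, forall psi, l2 psi ->
  exists phi, [/\ l2 phi, hop v phi - z *: phi = psi &
    (l2norm2 phi <= M%:E * l2norm2 psi)%E].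
Proof.
have [Bc Bc0 solve] := kop_solve vC kappa0 lb.
pose D := 3 * (2 + C).
exists (4 * (D * Bc + y ^+ 2 * Bc)) => psi /l2P[B b].
pose B0 := fine (l2norm2 psi).
have fn : l2norm2 psi \is a fin_num.
  by rewrite ge0_fin_numE ?l2norm2_ge0//; apply/l2P; exists B.
have {B b}b : bddc psi B0 by apply/l2norm2_le; rewrite fineK.
have [x1 b1 s1] := solve _ _ (bddc_re b).
have [x2 b2 s2] := solve _ _ (bddc_im b).
(* [phi] is [(H - conj z) (x1 + i x2)], and [kop], which is [(H - z) (H - conj z)], sends
   [x1 + i x2] to [psi]. *)
pose phi i := Complex (L x1 i + - y * x2 i) (L x2 i + y * x1 i).
have bp : bddc phi (4 * (D * Bc + y ^+ 2 * Bc) * B0).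
  have H := bddcI (psi := phi) (bddD ltr01 (bdd_jac vC b1) (bddZ (- y) b2))
    (bddD ltr01 (bdd_jac vC b2) (bddZ y b1)).
  by apply: (eq_rect _ (bddc phi) H); rewrite /D invr1 sqrrN; ring.
exists phi; split; first by apply/l2P; eexists; exact: bp.
- have LD k p r n : L (fun i => p i + k * r i) n = L p n + k * L r n.
    by rewrite /L /jac; ring.
  apply/funext => n; apply: complex_eq.
    rewrite hopz_re -s1 /kop -/x -/y -/L.
    have -> : L (fun i => complex.Re (phi i)) n = L (L x1) n + - y * L x2 n by exact: LD.
    by rewrite /=; ring.
  rewrite hopz_im -s2 /kop -/x -/y -/L.
  have -> : L (fun i => complex.Im (phi i)) n = L (L x2) n + y * L x1 n by exact: LD.
  by rewrite /=; ring.
- by rewrite -(fineK fn) -EFinM; apply/l2norm2_le.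
Qed.

Lemma low_bound_resolvent : l2_resolvent_set (hop v) z.
Proof.
have [M HM] := resolvent_exists.
pose P psi phi := [/\ l2 phi, hop v phi - z *: phi = psi &
    (l2norm2 phi <= M%:E * l2norm2 psi)%E].
(* The inverse is picked by choice, with value 0 where there is no solution; uniqueness makes it
   linear on l2. *)
pose B psi := xget 0 [set phi | P psi phi].
have BP psi : l2 psi -> P psi (B psi).
  by move=> /HM[phi Pphi]; apply: (xgetPex 0); exists phi.
have uniq phi phi' : l2 phi -> l2 phi' ->
    hop v phi - z *: phi = hop v phi' - z *: phi' -> phi = phi'.
  move=> l l' e; apply/eqP; rewrite -subr_eq0; apply/eqP.
  rewrite -scaleN1r addrC; apply: resolvent_uniq; first exact: l2_lin.
  rewrite hopz_linear e.
  by rewrite scaleN1r addNr.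
exists B; split; first split.
- move=> a psi1 psi2 l1 l2'.
  have [b1 e1 _] := BP _ l1; have [b2 e2 _] := BP _ l2'.
  have [b3 e3 _] := BP _ (l2_lin a l1 l2').
  apply: uniq => //; first exact: l2_lin.
  by rewrite e3 hopz_linear e1 e2.
- by exists M => psi /BP[].
- move=> psi l; have [b1 e1 _] := BP _ l; split=> //.
  have [b2 e2 _] := BP _ (l2_hopz l).
  exact: uniq.
Qed.

End resolvent.

(** For finitely supported [psi], apply the inverse to [(H - E) psi]: the reciprocal of its operator
    bound is a lower bound. [M1] is a positive majorant of [M]. *)
Lemma resolvent_low_bound v (E : R) : l2_resolvent_set (hop v) (E%:C)%C ->
  exists2 kappa, 0 < kappa & low_bound (fun i => v i - E) 0 kappa.
Proof.
move=> [B [[_ [M BM]] BK]].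
pose M1 := `|M| + 1; have M10 : 0 < M1 by rewrite ltr_wpDl.
exists M1^-1; first by rewrite invr_gt0.
move=> a n psi p; rewrite expr0n mul0r addr0.
pose P i := (psi i)%:C%C.
have bsupp (c : int) k (Q : int -> R[i]) :
    supp_in c k (fun i => complex.Re (Q i) ^+ 2 + complex.Im (Q i) ^+ 2) ->
    bddc Q (wsum c k (fun i => complex.Re (Q i) ^+ 2 + complex.Im (Q i) ^+ 2)).
  move=> s b m.
  pose b' := Order.min b c; pose m' := absz (Order.max (b + m%:Z) (c + k%:Z) - b')%R.
  rewrite -(wsum_ext (b := b') (m := m') s); [|lia..].
  by apply: wsum_sub; [move=> i; rewrite addr_ge0 ?sqr_ge0|lia..].
have reP i : complex.Re ((hop v P - (E%:C)%C *: P) i) = jac (fun i => v i - E) psi i.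
  by rewrite hopz_re /= mul0r addr0.
have imP i : complex.Im ((hop v P - (E%:C)%C *: P) i) = 0.
  by rewrite hopz_im /= mul0r subr0 /jac /=; ring.
have sq1 : supp_in a n (fun i => complex.Re (P i) ^+ 2 + complex.Im (P i) ^+ 2).
  by move=> i /p e; rewrite /= e expr0n addr0.
have l : l2 P by apply/l2P; eexists; exact: bsupp sq1.
have bL : bddc (hop v P - (E%:C)%C *: P)
    (wsum (a - 1) (n + 2) (fun i => jac (fun i => v i - E) psi i ^+ 2)).
  rewrite (@eq_wsum _ _ _ _ (fun i => complex.Re ((hop v P - (E%:C)%C *: P) i) ^+ 2 +
    complex.Im ((hop v P - (E%:C)%C *: P) i) ^+ 2)).
    apply: bsupp => i ib; rewrite reP imP (supp_in_jac _ p ib).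
    by rewrite expr0n addr0.
  by move=> i _; rewrite reP imP expr0n addr0.
have lL : l2 (hop v P - (E%:C)%C *: P) by apply/l2P; eexists; exact: bL.
have := BM _ lL; have [_ ->] := BK _ l => le.
rewrite mulrC ler_pdivrMr// mulrC.
have : (l2norm2 P <= (M1 * wsum (a - 1) (n + 2)
    (fun i => jac (fun i => v i - E) psi i ^+ 2))%:E)%E.
  apply: (le_trans le); rewrite EFinM.
  have MM1 : (M%:E <= M1%:E)%E by rewrite lee_fin (le_trans (ler_norm _))// lerDl.
  apply: (le_trans (lee_wpmul2r (l2norm2_ge0 _) MM1)).
  by rewrite lee_wpmul2l ?lee_fin ?(ltW M10)//; apply/l2norm2_le.
by move=> /l2norm2_le/bddc_re; apply.
Qed.

End complex_l2.

(** * The almost sure spectrum *)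

Section dynamics.
Context {R : realType} {Omega : pmetricType R}.
Variables (T : homeomorphism Omega).

Lemma iterz_continuous n : continuous (iterz T n).
Proof.
have H (h : Omega -> Omega) k : continuous h -> continuous (iter k h).
  move=> hc; elim: k => [|k IH] w /=; first exact: cvg_id.
  by apply: continuous_comp; [exact: IH|exact: hc].
by case: n => k; apply: H; [exact: homeo_continuous|exact: homeo_inv_continuous].
Qed.

Lemma iterzD1 n w : iterz T (n + 1) w = iterz T n (T w).
Proof. by rewrite iterzD. Qed.

Lemma open_borel (X : ptopologicalType) (U : set X) :
  open U -> measurable (U : set (borel X)).
Proof. exact: sub_sigma_algebra. Qed.

Lemma borel_preimage (X Y : ptopologicalType) (h : X -> Y) (A : set Y) :
  continuous h -> measurable (A : set (borel Y)) ->
  measurable (h @^-1` A : set (borel X)).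
Proof.
move=> hc mA; rewrite -[X in measurable X]setTI.
apply: (@measurability _ _ (borel X) (borel Y) setT h open) => //.
by move=> _ [U oU <-]; rewrite setTI; apply: open_borel; exact: open_comp.
Qed.

Lemma ae_exists (mu : probability (borel Omega) R) (P : set Omega) :
  {ae mu, forall w, P w} -> exists w, P w.
Proof.
move=> [N [mN N0 PN]]; apply: contrapT => /forallNP nP.
have NT : N = setT by apply/seteqP; split=> // w _; apply: PN => /=; exact: nP.
have := @probability_setT _ _ _ mu; rewrite -NT N0 => /eqP.
by rewrite eqe eq_sym oner_eq0.
Qed.

Lemma ae_sub (mu : probability (borel Omega) R) (P Q : set Omega) : P `<=` Q ->
  {ae mu, forall w, P w} -> {ae mu, forall w, Q w}.
Proof. by move=> PQ; apply: negligibleS => w; apply: contra_not; exact: PQ. Qed.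

Lemma ae_and (mu : probability (borel Omega) R) (P Q : set Omega) :
  {ae mu, forall w, P w} -> {ae mu, forall w, Q w} ->
  {ae mu, forall w, P w /\ Q w}.
Proof.
move=> aP aQ; apply: negligibleS (negligibleU aP aQ) => w /= /not_andP.
by case=> ?; [left|right].
Qed.

Section ae.
Variables (mu : probability (borel Omega) R).
Hypotheses (Omega_compact : compact [set: Omega]) (mu_ergodic : ergodic T mu)
  (mu_supp : supp mu = [set: Omega]).

Lemma supp_gt0 (U : set Omega) : open U -> U !=set0 -> (0 < mu U)%E.
Proof. by move=> oU [w Uw]; have /(_ U oU Uw) : supp mu w by rewrite mu_supp. Qed.

Definition dense_orbit w := forall U, open U -> U !=set0 -> exists n, U (iterz T n w).

(** The points whose two-sided orbit meets [U] form an open invariant set, of positive measure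
    because [mu] has full support. *)
Lemma ae_visit (U : set Omega) : open U -> U !=set0 ->
  {ae mu, forall w, exists n, U (iterz T n w)}.
Proof.
move=> oU U0; pose V := [set w | exists n, U (iterz T n w)].
have VE : V = \bigcup_n (iterz T n @^-1` U).
  by apply/seteqP; split=> w; [move=> [n Un]; exists n|move=> [n _ Un]; exists n].
have oV : open V.
  rewrite VE; apply: bigcup_open => n _; apply: open_comp => // w _.
  exact: iterz_continuous.
have TV : T @^-1` V = V.
  apply/seteqP; split=> w [n Un]; first by exists (n + 1); rewrite iterzD1.
  by exists (n - 1); rewrite -iterzD1 subrK.
have mV : measurable (V : set (borel Omega)) by exact: open_borel.
have muV : (0 < mu V)%E.
  apply: (lt_le_trans (supp_gt0 oU U0)); apply: le_measure; rewrite ?inE//.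
    exact: open_borel.
  by move=> w Uw; exists 0.
exists (~` V); split => //; first exact: measurableC.
rewrite probability_setC//.
by case: mu_ergodic => _ /(_ _ mV TV)[e|->]; [rewrite e ltxx in muV|rewrite subee].
Qed.

(** It suffices to visit the members of a countable base, which a compact metric space has. *)
Lemma ae_dense_orbit : {ae mu, forall w, dense_orbit w}.
Proof.
have [B cB [Bo Bb]] := compact_second_countable Omega_compact.
have aeB U : B U -> U !=set0 -> mu.-negligible [set w | ~ exists n, U (iterz T n w)].
  by move=> /Bo oU U0; exact: ae_visit.
have red w : (forall U, B U -> U !=set0 -> exists n, U (iterz T n w)) -> dense_orbit w.
  move=> H U oU [x Ux]; have [V [BV Vx] VU] := Bb x U (open_nbhs_nbhs (conj oU Ux)).
  by have [|n Vn] := H V BV; [exists x|exists n; exact: VU].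
have /pfcard_geP[B0|[F]] := cB.
  have [U [BU _] _] := Bb point setT filterT.
  by rewrite B0 in BU.
suff H : mu.-negligible (~` [set w | dense_orbit w]) by [].
apply: (@negligibleS _ _ _ mu (\bigcup_k [set w | F k !=set0 /\ ~ exists n, F k (iterz T n w)])).
  move=> w /= nd; apply: contrapT => nF; apply: nd; apply: red => U BU U0.
  have [k _ kU] := @surj _ _ _ _ F _ BU.
  apply: contrapT => nn; apply: nF; exists k => //=; by rewrite kU.
apply: negligible_bigcup => k.
have BF : B (F k) by apply: (@funS _ _ _ _ F).
have [F0|F0] := pselect (F k !=set0).
  by apply: negligibleS (aeB _ BF F0) => w [].
by apply: negligibleS (negligible_set0 mu) => w [].
Qed.

End ae.

Section gap.
Variables (f : Omega -> R).
Hypotheses (Omega_compact : compact [set: Omega]) (f_cont : continuous f).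

Definition pot E w : int -> R := fun i => f (iterz T i w) - E.

Definition gap E := exists2 kappa, 0 < kappa & forall w, low_bound (pot E w) 0 kappa.

Lemma pot_shift E w m i : pot E (iterz T m w) i = pot E w (i + m).
Proof. by rewrite /pot iterzD. Qed.

Lemma f_bounded : exists2 Cf, 0 <= Cf & forall w, `|f w| <= Cf.
Proof.
have := compact_bounded (continuous_compact (continuous_subspaceT f_cont) Omega_compact).
move=> [M [_ HM]]; exists (`|M| + 1) => [|w]; first exact: addr_ge0.
by apply: HM; [rewrite (le_lt_trans (ler_norm _))// ltrDl|exists w].
Qed.

Lemma pot_bounded E : exists C, forall w i, pot E w i ^+ 2 <= C.
Proof.
have [Cf Cf0 fC] := f_bounded; exists ((Cf + `|E|) ^+ 2) => w i.
rewrite -[X in X <= _]real_normK ?num_real// ler_pXn2r ?nnegrE ?addr_ge0//.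
by rewrite (le_trans (ler_normB _ _))// lerD2r.
Qed.

Lemma jac_pot_continuous E a n psi :
  continuous (fun w => wsum a n (fun i => jac (pot E w) psi i ^+ 2)).
Proof.
move=> w; apply: cvg_wsum => i; under eq_fun do rewrite expr2; rewrite expr2.
have H : jac (pot E x) psi i @[x --> w] --> jac (pot E w) psi i.
  apply: cvgD; first exact: cvg_cst.
  apply: cvgMl; apply: cvgB; last exact: cvg_cst.
  by apply: continuous_comp; [exact: iterz_continuous|exact: f_cont].
by apply: cvgM.
Qed.

(** For a fixed [psi], violating the bound is an open condition on the point. The dense orbit enters
    that open set, and translating [psi] moves the violation to [w] itself. *)
Lemma low_bound_dense_orbit E w kappa : 0 < kappa -> dense_orbit w ->
  low_bound (pot E w) 0 kappa -> gap E.
Proof.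
move=> k0 dw lb; exists kappa => // w' a n psi p.
rewrite expr0n mul0r addr0 leNgt; apply/negP => lt.
set S := wsum a n _ in lt.
pose U := [set x | wsum (a - 1) (n + 2) (fun i => jac (pot E x) psi i ^+ 2) < kappa * S].
have oU : open U.
  apply: (@open_comp _ _ (fun x => wsum (a - 1) (n + 2)
    (fun i => jac (pot E x) psi i ^+ 2)) [set r | r < kappa * S]); last exact: open_lt.
  by move=> x _; exact: jac_pot_continuous.
have [m Um] : exists m, U (iterz T m w) by apply: dw => //; exists w'.
have p' : supp_in (a + m) n (fun i => psi (i - m)) by move=> i ib; apply: p; lia.
have := lb _ _ _ p'; rewrite expr0n mul0r addr0.
rewrite -wsum_shift addrAC -wsum_shift.
rewrite (@eq_wsum _ a n _ (fun i => psi i ^+ 2)) => [|i _]; last by rewrite addrK.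
rewrite (@eq_wsum _ (a - 1) _ _ (fun i => jac (pot E (iterz T m w)) psi i ^+ 2)).
  by rewrite leNgt => /negP; apply.
move=> i _; rewrite /jac pot_shift addrK.
by have [-> ->] : i + m - 1 - m = i - 1 /\ i + m + 1 - m = i + 1 by lia.
Qed.

End gap.
End dynamics.

(** * The spectrum as the complement of the gaps *)

Section spectrum.
Context {R : realType} {Omega : pmetricType R}.
Variables (T : homeomorphism Omega) (f : Omega -> R).
Hypotheses (Omega_compact : compact [set: Omega]) (f_cont : continuous f).

Let sq_supp a n (psi : int -> R) : supp_in a n psi -> supp_in a n (fun i => psi i ^+ 2).
Proof. by move=> p i /p ->; rewrite expr0n. Qed.

Lemma gap_near E : gap T f E -> exists2 d, 0 < d &
  forall E', `|E' - E| < d -> gap T f E'.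
Proof.
move=> [k k0 lb]; pose d := Num.min 1 (k / 4); exists d.
  by rewrite lt_min ltr01 divr_gt0.
move=> E' dE; set e := E' - E in dE.
have e2 : e ^+ 2 < k / 2.
  apply: (@le_lt_trans _ _ (k / 4)); last lra.
  rewrite -[e ^+ 2]real_normK ?num_real//.
  move: dE; rewrite lt_min => /andP[e1 ek]; rewrite expr2.
  by rewrite (le_trans (ler_piMl _ (ltW e1)))// ltW.
exists (k / 2 - e ^+ 2); first by rewrite subr_gt0.
move=> w a n psi p; have := lb w a n psi p.
rewrite expr0n mul0r !addr0; set S := wsum a n _.
have SE : S = wsum (a - 1) (n + 2) (fun i => psi i ^+ 2).
  by rewrite (wsum_ext (sq_supp p))//; lia.
have : wsum (a - 1) (n + 2) (fun i => jac (pot T f E w) psi i ^+ 2) <=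
  2 * wsum (a - 1) (n + 2) (fun i => jac (pot T f E' w) psi i ^+ 2) + 2 * e ^+ 2 * S.
  rewrite SE -!wsumZ -wsumD; apply: le_wsum => i _; rewrite -subr_ge0.
  have -> : jac (pot T f E w) psi i = jac (pot T f E' w) psi i + e * psi i.
    by rewrite /jac /pot /e; ring.
  move: (jac _ _ _) => j.
  have -> : 2 * j ^+ 2 + 2 * e ^+ 2 * psi i ^+ 2 - (j + e * psi i) ^+ 2 =
    (j - e * psi i) ^+ 2 by ring.
  exact: sqr_ge0.
lra.
Qed.

Lemma gap_large : exists2 B, 0 < B & forall E, B <= `|E| -> gap T f E.
Proof.
have [C hC] := pot_bounded T Omega_compact f_cont 0.
have C0 : 0 <= C by apply: le_trans (hC point 0); exact: sqr_ge0.
(* [E^2 |psi|^2 <= 2 |(H - E) psi|^2 + 2 |H psi|^2] and [|H psi|^2 <= 3 (2 + C) |psi|^2]; this [B]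
   leaves the lower bound 1. *)
pose B := 6 * (2 + C) + 2; exists B; first by rewrite /B; lra.
move=> E BE; exists 1 => // w a n psi p.
rewrite expr0n !mul0r !addr0 mul1r; set S := wsum a n _.
have SE : S = wsum (a - 1) (n + 2) (fun i => psi i ^+ 2).
  by rewrite (wsum_ext (sq_supp p))//; lia.
have S0 : 0 <= S by apply: wsum_ge0 => i; exact: sqr_ge0.
have E2 : B <= E ^+ 2.
  rewrite -[E ^+ 2]real_normK ?num_real// expr2 (le_trans BE)//.
  by rewrite ler_peMl// (le_trans _ BE)// /B; lra.
have j0 : wsum (a - 1) (n + 2) (fun i => jac (pot T f 0 w) psi i ^+ 2) <=
    3 * (2 + C) * S.
  apply: (le_trans (jac_bound _ _ _ (hC w))).
  by rewrite (@wsum_ext _ a n) ?lexx//; [exact: sq_supp|lia..].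
have : E ^+ 2 * S <=
  2 * wsum (a - 1) (n + 2) (fun i => jac (pot T f E w) psi i ^+ 2) +
  2 * wsum (a - 1) (n + 2) (fun i => jac (pot T f 0 w) psi i ^+ 2).
  rewrite SE -!wsumZ -wsumD; apply: le_wsum => i _; rewrite -subr_ge0.
  have -> : jac (pot T f 0 w) psi i = jac (pot T f E w) psi i + E * psi i.
    by rewrite /jac /pot; ring.
  move: (jac _ _ _) => j.
  have -> : 2 * j ^+ 2 + 2 * (j + E * psi i) ^+ 2 - E ^+ 2 * psi i ^+ 2 =
    (2 * j + E * psi i) ^+ 2 by ring.
  exact: sqr_ge0.
have : B * S <= E ^+ 2 * S by rewrite ler_wpM2r.
rewrite /B; lra.
Qed.

Definition spec : set R := [set E | ~ gap T f E].

Lemma compact_spec : compact spec.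
Proof.
have [B B0 HB] := gap_large.
apply: (subclosed_compact _ (@segment_compact _ (- B) B)).
  rewrite -[spec]setCK; apply: open_closedC; rewrite openE => E /= /contrapT gE.
  have [d d0 Hd] := gap_near gE.
  exists d => //= E' EE'; rewrite /spec /= => H; apply: H; apply: Hd.
  by rewrite distrC.
move=> E /= nE; rewrite in_itv /= -ler_norml leNgt; by apply/negP => /ltW/HB/nE.
Qed.

Lemma schroedinger_spectrum w : dense_orbit T w ->
  l2_spectrum (schroedinger T f w) = [set (E%:C)%C | E in spec].
Proof.
move=> dw; have hopE : schroedinger T f w = hop (fun n => f (iterz T n w)) by [].
rewrite /l2_spectrum hopE; apply/seteqP; split=> [z nz|_ [E nE <-] rE]; last first.
  have [k k0 lb] := resolvent_low_bound rE.
  by apply: nE; exact: (low_bound_dense_orbit f_cont k0 dw lb).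
have [C hC] := pot_bounded T Omega_compact f_cont (complex.Re z).
have vC i : (f (iterz T i w) - complex.Re z) ^+ 2 <= C by exact: hC.
have [im0|im0] := eqVneq (complex.Im z) 0; last first.
  (* Off the real axis the square of the imaginary part is itself a lower bound. *)
  exfalso; apply: nz; apply: (low_bound_resolvent (kappa := complex.Im z ^+ 2) vC).
    by rewrite exprn_even_gt0.
  move=> a n psi _; rewrite lerDr; apply: wsum_ge0 => i; exact: sqr_ge0.
exists (complex.Re z); last by move: im0; case: (z) => x y /= ->.
move=> [k k0 lb]; apply: nz; apply: (low_bound_resolvent vC k0).
by rewrite im0; exact: lb.
Qed.

End spectrum.

Lemma almost_sure_spectrum_spec {R : realType} {Omega : pmetricType R}
    (T : homeomorphism Omega) (f : Omega -> R) (mu : probability (borel Omega) R) :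
  compact [set: Omega] -> continuous f -> ergodic T mu -> supp mu = [set: Omega] ->
  almost_sure_spectrum T mu f (spec T f).
Proof.
move=> Oc fc me ms; split; first exact: compact_spec.
apply: ae_sub (ae_dense_orbit Oc me ms) => w; exact: schroedinger_spectrum.
Qed.

(** * The decaying solution in a spectral gap *)

Section solutions.
Context {R : realType}.
Implicit Types (c : nat -> R) (p : R * R).

Definition step (k : R) p : R * R := (p.2, k * p.2 - p.1).

Fixpoint vec c p n := if n is n'.+1 then step (c n') (vec c p n') else p.

(* The entry with index [n] is the value of the solution at site [n - 1], and [c n] is the
   energy minus the potential at site [n]. *)
Definition usol c p n := (vec c p n).1.

Definition det2 p q : R := p.1 * q.2 - p.2 * q.1.
Definition nrm2 p : R := p.1 ^+ 2 + p.2 ^+ 2.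

Lemma usolS c p n : usol c p n.+1 = (vec c p n).2. Proof. by []. Qed.

Lemma usolSS c p n : usol c p n.+2 = c n * usol c p n.+1 - usol c p n.
Proof. by []. Qed.

Lemma vecE c p n : vec c p n = (usol c p n, usol c p n.+1).
Proof. by rewrite usolS /usol; case: vec. Qed.

Lemma vec_shift c p n m : vec c p (n + m) = vec (fun k => c (n + k)%N) (vec c p n) m.
Proof. by elim: m => [|m IH]; rewrite ?addn0// addnS /= IH. Qed.

Lemma usol_shift c p n m :
  usol (fun k => c (n + k)%N) (vec c p n) m = usol c p (n + m).
Proof. by rewrite /usol vec_shift. Qed.

Lemma det_step k k' p q :
  det2 (step k p) (step k' q) = det2 p q + (k' - k) * p.2 * q.2.
Proof. by rewrite /det2 /step /=; ring. Qed.

Definition l2sol c p := exists B, forall N, \sum_(n < N) usol c p n ^+ 2 <= B.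

Lemma small_term (a : nat -> R) B e N0 : (forall n, 0 <= a n) ->
  (forall N, \sum_(n < N) a n <= B) -> 0 < e -> exists2 N, (N0 <= N)%N & a N < e.
Proof.
move=> a0 aB e0; apply: contrapT => no.
have ge n : (N0 <= n)%N -> e <= a n.
  by move=> n0; rewrite leNgt; apply/negP => lt; apply: no; exists n.
have sums M : e * M%:R <= \sum_(n < N0 + M) a n.
  rewrite big_split_ord /=; apply: (@le_trans _ _ (\sum_(i < M) e)).
    by rewrite sumr_const card_ord mulr_natr.
  rewrite ler_wpDl ?sumr_ge0//; apply: ler_sum => i _; apply: ge; exact: leq_addr.
have B0 : 0 <= B by have := aB 0%N; rewrite big_ord0.
have [M BM] : exists M : nat, B / e < M%:R.
  by exists (Num.bound (B / e)); apply: archi_boundP; rewrite divr_ge0// ltW.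
have := le_trans (sums M) (aB _); rewrite leNgt => /negP; apply.
by rewrite mulrC -ltr_pdivrMr.
Qed.

Lemma mul_le_half (x y : R) : `|x * y| <= (x ^+ 2 + y ^+ 2) / 2.
Proof.
rewrite ler_pdivlMr//; have : 0 <= (`|x| - `|y|) ^+ 2 by exact: sqr_ge0.
rewrite normrM -[x ^+ 2]real_normK ?num_real// -[y ^+ 2]real_normK ?num_real//.
by rewrite sqrrB; lra.
Qed.

Lemma det_vec c c' p q n : det2 (vec c p n) (vec c' q n) =
  det2 p q + \sum_(k < n) (c' k - c k) * (usol c p k.+1 * usol c' q k.+1).
Proof.
elim: n => [|n IH]; first by rewrite big_ord0 addr0.
by rewrite big_ord_recr /= det_step IH -!usolS; ring.
Qed.

Lemma sum_usolS c p K N : (forall N, \sum_(n < N) usol c p n ^+ 2 <= K) ->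
  \sum_(n < N) usol c p n.+1 ^+ 2 <= K.
Proof.
by move=> H; apply: le_trans (H N.+1); rewrite big_ord_recl lerDr sqr_ge0.
Qed.

(** On the first [N] sites the Wronskian stays within [d * K] of its initial value, while the sum of
    its absolute values is at most [2 * K]. Averaging over these sites bounds the initial value;
    this serves both for uniqueness ([d = 0]) and for continuity of the decaying direction. *)
Lemma det_bound c c' p q K d N :
  (forall N, \sum_(n < N) usol c p n ^+ 2 <= K) ->
  (forall N, \sum_(n < N) usol c' q n ^+ 2 <= K) ->
  0 <= d -> (forall n, (n < N)%N -> `|c' n - c n| <= d) ->
  N%:R * `|det2 p q| <= 2 * K + N%:R * (d * K).
Proof.
move=> uK vK d0 cd.
have uS := sum_usolS _ uK; have vS := sum_usolS _ vK.
have step1 n : (n < N)%N -> `|det2 p q| <= `|det2 (vec c p n) (vec c' q n)| + d * K.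
  move=> nN; have -> : det2 p q = det2 (vec c p n) (vec c' q n) -
     \sum_(k < n) (c' k - c k) * (usol c p k.+1 * usol c' q k.+1).
    by rewrite det_vec; ring.
  apply: (le_trans (ler_normB _ _)); rewrite lerD2l.
  apply: (le_trans (ler_norm_sum _ _ _)).
  apply: (@le_trans _ _ (\sum_(k < n) d * ((usol c p k.+1 ^+ 2 + usol c' q k.+1 ^+ 2) / 2))).
    apply: ler_sum => k _; rewrite normrM; apply: ler_pM => //.
      by apply: cd; exact: ltn_trans nN.
    exact: mul_le_half.
  rewrite -mulr_sumr ler_wpM2l// -mulr_suml big_split /=.
  by have := uS n; have := vS n; lra.
have : \sum_(n < N) `|det2 p q| <=
    \sum_(n < N) (`|det2 (vec c p n) (vec c' q n)| + d * K).
  by apply: ler_sum => n _; exact: step1.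
rewrite big_split /= !sumr_const card_ord !mulr_natl => le; apply: (le_trans le).
rewrite lerD2r; apply: (@le_trans _ _ (\sum_(n < N)
  ((usol c p n ^+ 2 + usol c' q n.+1 ^+ 2 + (usol c p n.+1 ^+ 2 + usol c' q n ^+ 2)) / 2))).
  apply: ler_sum => n _; rewrite !vecE /det2 /=.
  apply: (le_trans (ler_normB _ _)); rewrite mulrDl lerD//; exact: mul_le_half.
rewrite -mulr_suml !big_split /=.
by have := uS N; have := vS N; have := uK N; have := vK N; lra.
Qed.

Lemma l2sol_det c p q : l2sol c p -> l2sol c q -> det2 p q = 0.
Proof.
move=> [B pB] [B' qB]; pose K := Num.max B B'.
have pK N : \sum_(n < N) usol c p n ^+ 2 <= K by rewrite (le_trans (pB N))// le_max lexx.
have qK N : \sum_(n < N) usol c q n ^+ 2 <= K.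
  by rewrite (le_trans (qB N))// le_max lexx orbT.
have K0 : 0 <= K by have := pK 0%N; rewrite big_ord0.
apply/eqP; rewrite -normr_eq0; apply: contraT => d0.
have {}d0 : 0 < `|det2 p q| by rewrite lt0r d0 normr_ge0.
have [N] : exists N : nat, 2 * K / `|det2 p q| < N%:R.
  by eexists; apply: archi_boundP; rewrite divr_ge0// mulr_ge0.
rewrite ltr_pdivrMr// => lt.
have := @det_bound c c p q K 0 N pK qK (lexx _).
rewrite mul0r mulr0 addr0 => /(_ _); rewrite leNgt lt; apply.
by move=> n _; rewrite subrr normr0.
Qed.

Lemma vecZ c k p n : vec c (k * p.1, k * p.2) n = (k * (vec c p n).1, k * (vec c p n).2).
Proof. by elim: n => [|n IH] //=; rewrite IH /step /=; congr (_, _); ring. Qed.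

Lemma l2solZ c k p : l2sol c p -> l2sol c (k * p.1, k * p.2).
Proof.
move=> [B pB]; exists (k ^+ 2 * B) => N.
under eq_bigr => n _ do rewrite /usol vecZ /= exprMn.
by rewrite -mulr_sumr ler_wpM2l ?sqr_ge0.
Qed.

Lemma l2sol_step c p : l2sol c p -> l2sol (fun n => c n.+1) (step (c 0) p).
Proof.
move=> [B pB]; exists B => N; have := sum_usolS N pB; congr (_ <= _).
apply: eq_bigr => n _; congr (_ ^+ 2).
by rewrite -[in LHS]add1n -usol_shift.
Qed.

(* The lower bound applied to the solution cut off at site [N] leaves only boundary
   terms. *)
Lemma cutoff_bound (v : int -> R) c p kappa N : low_bound v 0 kappa ->
  (forall n : nat, v n%:Z = - c n) ->
  kappa * \sum_(n < N.+2) usol c p n.+1 ^+ 2 <=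
    nrm2 p + usol c p N.+2 ^+ 2 + usol c p N.+3 ^+ 2.
Proof.
move=> lb vc; pose u := usol c p.
pose psi (i : int) : R := if (0 <= i < N.+2%:Z) then u (absz i).+1 else 0.
have ps : supp_in 0 N.+2 psi by move=> i ib; rewrite /psi ifF//; lia.
have := lb _ _ _ ps; rewrite expr0n mul0r addr0.
have -> : wsum 0 N.+2 (fun i => psi i ^+ 2) = \sum_(n < N.+2) u n.+1 ^+ 2.
  apply: eq_bigr => i _; rewrite add0r /psi ifT//; have := ltn_ord i; lia.
move=> le; apply: (le_trans le).
have wsum1 a F : wsum a 1 F = F a :> R by rewrite /wsum big_ord1 addr0.
have uE n : u n.+2 = c n * u n.+1 - u n by exact: usolSS.
have psiE (n : nat) : (n < N.+2)%N -> psi n%:Z = u n.+1 by move=> nN; rewrite /psi ifT//; lia.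
have psi0 i : (i < 0) || (N.+2%:Z <= i) -> psi i = 0 by move=> ib; apply: ps; lia.
have -> : (N.+2 + 2 = 1 + (1 + (N + (1 + 1))))%N by lia.
rewrite !wsum_cat !wsum1.
have -> : jac v psi (0 - 1) = p.2.
  by rewrite /jac subrK (psiE 0%N)// !psi0// mulr0 addr0 add0r.
have -> : jac v psi (0 - 1 + 1%N%:Z) = - p.1.
  rewrite /jac subrK [psi (0 - 1)]psi0// (psiE 1%N)// (psiE 0%N)// vc uE.
  by rewrite add0r /u /usol /=; ring.
rewrite (@wsum0 _ _ N) => [|i ib]; last first.
  have [n iE] : exists n : nat, i = n.+1%:Z by exists (absz (i - 1)%R); lia.
  move: ib; rewrite iE => ib.
  rewrite /jac (_ : n.+1%:Z - 1 = n%:Z); last lia.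
  rewrite (_ : n.+1%:Z + 1 = n.+2%:Z); last lia.
  by rewrite !psiE ?vc ?uE; [rewrite (_ : _ + _ = 0) ?expr0n//; ring|lia..].
rewrite (_ : jac v psi (0 - 1 + 1%N%:Z + 1%N%:Z + N%:Z) = - u N.+3); last first.
  rewrite (_ : 0 - 1 + 1%N%:Z + 1%N%:Z + N%:Z = N.+1%:Z); last lia.
  rewrite /jac (_ : N.+1%:Z - 1 = N%:Z); last lia.
  by rewrite (psi0 (_ + 1)) ?(psiE N) ?(psiE N.+1) ?vc ?(uE N.+1)//; [ring|lia].
rewrite (_ : jac v psi (0 - 1 + 1%N%:Z + 1%N%:Z + N%:Z + 1%N%:Z) = u N.+2); last first.
  rewrite (_ : 0 - 1 + 1%N%:Z + 1%N%:Z + N%:Z + 1%N%:Z = N.+2%:Z); last lia.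
  rewrite /jac (_ : N.+2%:Z - 1 = N.+1%:Z); last lia.
  rewrite (psi0 (_ + 1)) ?(psi0 N.+2%:Z) ?(psiE N.+1) ?mulr0 ?addr0//; lia.
by rewrite /nrm2 !sqrrN -/u le_eqVlt; apply/orP; left; apply/eqP; ring.
Qed.

End solutions.

(** * Existence and uniform size of decaying solutions *)

Section stable_direction.
Context {R : realType}.
Implicit Types (c : nat -> R) (p : R * R).

Lemma nrm2_ge0 p : 0 <= nrm2 p. Proof. by rewrite addr_ge0 ?sqr_ge0. Qed.

Lemma nrm2_eq0 p : nrm2 p = 0 -> p = (0, 0).
Proof.
move/eqP; rewrite paddr_eq0 ?sqr_ge0// !sqrf_eq0 => /andP[/eqP p1 /eqP p2].
by case: p p1 p2 => a b /= -> ->.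
Qed.

(** The boundary terms of [cutoff_bound] are small at arbitrarily late sites, since the solution is
    square summable. This replaces the unspecified bound of [l2sol] by one that depends only on
    [kappa] and the initial vector. *)
Lemma l2sol_uniform (v : int -> R) c p kappa : 0 < kappa -> low_bound v 0 kappa ->
  (forall n : nat, v n%:Z = - c n) -> l2sol c p ->
  forall N, \sum_(n < N) usol c p n ^+ 2 <= (1 + kappa^-1) * nrm2 p.
Proof.
move=> k0 lb vc [B pB] N; pose u n := usol c p n.
have uS : kappa * \sum_(n < N) u n.+1 ^+ 2 <= nrm2 p.
  apply/ler_addgt0Pr => e e0.
  have aB M : \sum_(n < M) (u n.+2 ^+ 2 + u n.+3 ^+ 2) <= B + B.
    rewrite big_split /=; apply: lerD.
      apply: le_trans (pB M.+2); rewrite !big_ord_recl /= addrA lerDr.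
      by rewrite addr_ge0 ?sqr_ge0.
    apply: le_trans (pB M.+3); rewrite !big_ord_recl /= !addrA lerDr.
    by rewrite !addr_ge0 ?sqr_ge0.
  have a0 n : 0 <= u n.+2 ^+ 2 + u n.+3 ^+ 2 by rewrite addr_ge0 ?sqr_ge0.
  have [M NM le] := small_term N a0 aB e0.
  apply: (le_trans _ (le_trans (cutoff_bound (c := c) p M lb vc) _)); last first.
    by rewrite -addrA lerD2l ltW.
  rewrite (ler_wpM2l (ltW k0))//.
  have -> : M.+2 = (N + (M.+2 - N))%N by lia.
  by rewrite big_split_ord /= lerDl sumr_ge0// => i _; exact: sqr_ge0.
apply: (@le_trans _ _ (\sum_(n < N.+1) u n ^+ 2)).
  by rewrite big_ord_recr /= lerDl sqr_ge0.
rewrite big_ord_recl mulrDl mul1r lerD//.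
  by rewrite /u /usol /= lerDl sqr_ge0.
by rewrite ler_pdivlMl.
Qed.

(** For [y = 0], [kop] is the square of the operator: if it maps [x] to the unit mass at [k], then
    [jac v x] is the Green's function. *)
Lemma exists_green (v : int -> R) C kappa k :
  (forall i, v i ^+ 2 <= C) -> 0 < kappa -> low_bound v 0 kappa ->
  exists G B, bdd G B /\ forall i, jac v G i = (i == k)%:R.
Proof.
move=> vC k0 lb; have [Bc _ solve] := kop_solve vC k0 lb.
have gB : bdd (fun i => (i == k)%:R : R) 1.
  move=> a n; have [ka|ka] := boolP (a <= k < a + n%:Z).
    rewrite (@wsum_ext _ k 1); [|move=> i ik|lia..]; last first.
      by rewrite (_ : (i == k) = false) ?expr0n//; lia.
    by rewrite /wsum big_ord1 addr0 eqxx expr1n.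
  by rewrite wsum0// => i ia; rewrite (_ : (i == k) = false) ?expr0n//; lia.
have [x xB kx] := solve _ _ gB.
exists (jac v x), (3 * (2 + C) * (Bc * 1)); split; first exact: bdd_jac.
by move=> i; have := kx i; rewrite /kop expr0n mul0r addr0.
Qed.

(* If the Green's functions with poles at sites -1 and -2 both vanished at sites -1
   and 0, their restrictions to the left half-line would be two square summable
   solutions with constant Wronskian 1. *)
Lemma exists_l2sol (v : int -> R) c C kappa :
  (forall i, v i ^+ 2 <= C) -> 0 < kappa -> low_bound v 0 kappa ->
  (forall n : nat, v n%:Z = - c n) -> exists2 p, p <> (0, 0) & l2sol c p.
Proof.
move=> vC k0 lb vc.
(* To the right of its pole the Green's function solves the homogeneous equation, so its values at
   sites -1 and 0 start a square summable solution. *)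
have l2G k G B : k < 0 -> bdd G B -> (forall i, jac v G i = (i == k)%:R) ->
    l2sol c (G (-1), G 0).
  move=> kn GB Gk; exists B => N.
  have uG n : vec c (G (-1), G 0) n = (G (n%:Z - 1), G n%:Z).
    elim: n => [|n IH]; first by rewrite sub0r.
    rewrite /= IH /step /=; congr (_, _); first by congr G; lia.
    have := Gk n%:Z; rewrite (_ : (n%:Z == k) = false); last lia.
    by rewrite /jac vc (_ : n%:Z + 1 = n.+1%:Z) /=; [move=> e; lra|lia].
  apply: le_trans (GB (-1) N); rewrite /wsum le_eqVlt; apply/orP; left; apply/eqP.
  by apply: eq_bigr => n _; rewrite /usol uG /= addrC.
have [G1 [B1 [b1 g1]]] := exists_green (-1) vC k0 lb.
have [G2 [B2 [b2 g2]]] := exists_green (-2) vC k0 lb.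
have [z1|nz] := pselect ((G1 (-1), G1 0) = (0, 0)); last first.
  by exists (G1 (-1), G1 0) => //; exact: l2G b1 g1.
have [z2|nz] := pselect ((G2 (-1), G2 0) = (0, 0)); last first.
  by exists (G2 (-1), G2 0) => //; exact: l2G b2 g2.
exfalso; case: z1 z2 => z11 z10 [z21 z20].
pose W i := G1 i * G2 (i - 1) - G1 (i - 1) * G2 i.
have W2 : W (-2) = 1.
  have := g1 (-1); have := g2 (-1); have := g2 (-2).
  rewrite !eqxx (_ : (-1 == -2 :> int) = false)// /jac !addNr.
  rewrite (_ : -1 - 1 = -2 :> int)// (_ : -2 + 1 = -1 :> int)// z11 z10 z21 z20 /W.
  rewrite !mulr0 !addr0 => e2 e1 e0; move: e2.
  by rewrite e0 e1 ?mulr0 ?addr0 => ->; rewrite ?mulr0 ?subr0 ?mulr1.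
have WS i : i <= -3 -> W i = W (i + 1).
  move=> i3; have := g1 i; have := g2 i.
  rewrite (_ : (i == -1) = false); last lia.
  rewrite (_ : (i == -2) = false); last lia.
  rewrite /jac /W addrK /= => e2 e1.
  have -> : G1 (i + 1) = - G1 (i - 1) - v i * G1 i by lra.
  have -> : G2 (i + 1) = - G2 (i - 1) - v i * G2 i by lra.
  ring.
have W1 (n : nat) : W (-2 - n%:Z) = 1.
  elim: n => [|n IH]; first by rewrite subr0.
  by rewrite WS; [rewrite -IH; congr W; lia|lia].
(* Summing the Wronskian 1 over [n] sites gives [n], whereas the l2 bounds keep the sum below
   [B1 + B2]. *)
have le (n : nat) : n%:R <= B1 + B2.
  have -> : n%:R = wsum (-1 - n%:Z) n W.
    rewrite /wsum (eq_bigr (fun=> 1)) ?sumr_const ?card_ord// => i _.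
    have -> : -1 - n%:Z + i%:Z = -2 - (n - i.+1)%N%:Z by have := ltn_ord i; lia.
    exact: W1.
  apply: (@le_trans _ _ (wsum (-1 - n%:Z) n (fun i => 2^-1 * (G1 i ^+ 2 +
      G2 (i - 1) ^+ 2 + (G1 (i - 1) ^+ 2 + G2 i ^+ 2))))).
    apply: le_wsum => i _; rewrite /W; apply: (le_trans (ler_norm _)).
    apply: (le_trans (ler_normB _ _)); rewrite mulrDr lerD// [leRHS]mulrC; exact: mul_le_half.
  rewrite wsumZ !wsumD.
  have := b1 (-1 - n%:Z) n; have := b2 (-1 - n%:Z) n.
  have := b1 (-1 - n%:Z - 1) n; have := b2 (-1 - n%:Z - 1) n.
  rewrite -(wsum_shift _ _ _ (fun i => G1 i ^+ 2)) -(wsum_shift _ _ _ (fun i => G2 i ^+ 2)).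
  lra.
have B0 : 0 <= B1 + B2 by have := le 0%N.
by have := le (Num.bound (B1 + B2)); rewrite leNgt archi_boundP.
Qed.

End stable_direction.

(** * Continuity of the decaying direction *)

Section stable_section.
Context {R : realType} {Omega : pmetricType R}.
Variables (T : homeomorphism Omega) (f : Omega -> R) (E : R).
Hypotheses (Omega_compact : compact [set: Omega]) (f_cont : continuous f).
Hypothesis gapE : gap T f E.

Definition fpot w n : R := E - f (iter n T w).

Definition stable w p := p <> (0, 0) /\ l2sol (fpot w) p.

Lemma fpot_shift w n m : fpot (iter n T w) m = fpot w (n + m).
Proof. by rewrite /fpot addnC iterD. Qed.

Lemma exists_stable w : exists2 p, nrm2 p = 1 & l2sol (fpot w) p.
Proof.
have [k k0 lb] := gapE; have [C vC] := pot_bounded T Omega_compact f_cont E.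
have vc (n : nat) : pot T f E w n%:Z = - fpot w n by rewrite /pot /fpot opprB.
have [p p0 lp] := exists_l2sol (vC w) k0 (lb w) vc.
have n0 : 0 < nrm2 p.
  by rewrite lt0r nrm2_ge0 andbT; apply/eqP => /nrm2_eq0.
pose s := (Num.sqrt (nrm2 p))^-1; exists (s * p.1, s * p.2); last exact: l2solZ.
rewrite /nrm2 /= !exprMn -mulrDr /s exprVn sqr_sqrtr ?nrm2_ge0//.
by rewrite mulVf// gt_eqF.
Qed.

Lemma stable_step w p : stable w p -> stable (T w) (step (E - f w) p).
Proof.
move=> [p0 lp]; split.
  case: p p0 {lp} => a b p0; rewrite /step /= => -[b0]; rewrite b0 mulr0 sub0r.
  by move=> /eqP; rewrite oppr_eq0 => /eqP a0; apply: p0; rewrite a0 b0.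
have := l2sol_step lp; rewrite /fpot /=.
by rewrite (_ : (fun n => E - f (T (iter n T w))) = (fun n => E - f (iter n T (T w))))//;
  apply/funext => n; rewrite -iterSr.
Qed.

Lemma stable_det w p q : stable w p -> stable w q -> det2 p q = 0.
Proof. by move=> [_ lp] [_ lq]; exact: l2sol_det lp lq. Qed.

Lemma stable_uniform : exists2 K, 0 <= K & forall w p, nrm2 p = 1 ->
  l2sol (fpot w) p -> forall N, \sum_(n < N) usol (fpot w) p n ^+ 2 <= K.
Proof.
have [k k0 lb] := gapE; exists (1 + k^-1); first by rewrite addr_ge0// invr_ge0 ltW.
move=> w p p1 lp N.
have vc (n : nat) : pot T f E w n%:Z = - fpot w n by rewrite /pot /fpot opprB.
by have := l2sol_uniform k0 (lb w) vc lp N; rewrite p1 mulr1.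
Qed.

Lemma iter_continuous n : continuous (fun w => f (iter n T w)).
Proof.
move=> w; apply: continuous_comp; last exact: f_cont.
exact: (@iterz_continuous _ _ T n%:Z).
Qed.

(** In [det_bound], first take [N] with [2 * K / N < e / 2], then points so close to [w0] that the
    potentials differ by less than [d] on the first [N] sites, where [d * K <= e / 2]. *)
Lemma stable_det_small w0 e : 0 < e -> \forall w \near w0, forall p q,
  nrm2 p = 1 -> nrm2 q = 1 -> l2sol (fpot w0) p -> l2sol (fpot w) q -> `|det2 p q| < e.
Proof.
move=> e0; have [K K0 hK] := stable_uniform.
have [N] : exists N : nat, 4 * K / e < N%:R.
  by eexists; apply: archi_boundP; rewrite divr_ge0 ?mulr_ge0// ltW.
rewrite ltr_pdivrMr// => hN.
have N0 : 0 < N%:R :> R.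
  rewrite -(@pmulr_lgt0 _ e)//; apply: le_lt_trans hN; exact: mulr_ge0.
pose d := e / (2 * (K + 1)).
have d0 : 0 < d by rewrite divr_gt0// mulr_gt0// ltr_wpDl.
have : \forall w \near w0, forall n : 'I_N, `|f (iter n T w) - f (iter n T w0)| < d.
  apply: filter_forall => n.
  have /cvgrPdist_lt/(_ _ d0) := @iter_continuous n w0.
  by apply: filterS => w; rewrite distrC.
apply: filterS => w hw p q p1 q1 lp lq.
have := @det_bound _ (fpot w0) (fpot w) p q K d N (hK _ _ p1 lp) (hK _ _ q1 lq) (ltW d0).
have hc n : (n < N)%N -> `|fpot w n - fpot w0 n| <= d.
  move=> nN; have := hw (Ordinal nN); rewrite /fpot /= => /ltW.
  by rewrite (_ : E - _ - _ = - (f (iter n T w) - f (iter n T w0))) ?normrN//; ring.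
move=> /(_ hc); rewrite -(ltr_pM2l N0).
have : d * K <= e / 2.
  rewrite /d mulrAC ler_pdivrMr ?mulr_gt0 ?ltr_wpDl//.
  have -> : e / 2 * (2 * (K + 1)) = e * K + e by field.
  by rewrite lerDl ltW.
move=> dK le; apply: (le_lt_trans le).
have : N%:R * (d * K) <= N%:R * (e / 2) by rewrite ler_pM2l.
lra.
Qed.

(** Unit decaying vectors are unique up to sign. Taking the sign with nonnegative scalar product
    with the vector at [w0] gives continuity at [w0], and is only claimed to give it there. *)
Lemma local_section w0 : exists2 V : Omega -> R * R,
  (forall w, stable w (V w)) & {for w0, continuous (fun w => (V w).1)} /\
    {for w0, continuous (fun w => (V w).2)}.
Proof.
have /choice[V0 HV0] : forall w, exists p, nrm2 p = 1 /\ l2sol (fpot w) p.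
  by move=> w; have [p ? ?] := exists_stable w; exists p.
pose dot p q : R := p.1 * q.1 + p.2 * q.2.
pose p := V0 w0; pose s w : R := if 0 <= dot p (V0 w) then 1 else -1.
pose V w := (s w * (V0 w).1, s w * (V0 w).2).
have [p1 lp] : nrm2 p = 1 /\ l2sol (fpot w0) p by exact: HV0.
have s2 w : s w ^+ 2 = 1 by rewrite /s; case: ifP => _; rewrite ?sqrrN expr1n.
have V1 w : nrm2 (V w) = 1.
  by rewrite /nrm2 /V /= !exprMn s2 !mul1r; case: (HV0 w).
have lV w : l2sol (fpot w) (V w) by apply: l2solZ; case: (HV0 w).
have dotV w : 0 <= dot p (V w).
  have -> : dot p (V w) = s w * dot p (V0 w) by rewrite /dot /V /=; ring.
  rewrite /s; case: ifP => [|/negbT]; first by rewrite mul1r.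
  by rewrite -ltNge mulN1r oppr_ge0 => /ltW.
have Vw0 : V w0 = p.
  have d1 : dot p (V0 w0) = 1 by rewrite /dot -!expr2.
  by rewrite /V /s d1 ler01 !mul1r /p -surjective_pairing.
(* For unit vectors [det^2 + dot^2 = 1] and [|p - V|^2 = 2 - 2 dot]; with [0 <= dot <= 1] the latter
   is at most [2 (1 - dot^2)]. *)
have close w : (p.1 - (V w).1) ^+ 2 + (p.2 - (V w).2) ^+ 2 <= 2 * det2 p (V w) ^+ 2.
  have e1 : det2 p (V w) ^+ 2 = 1 - dot p (V w) ^+ 2.
    have -> : 1 = nrm2 p * nrm2 (V w) by rewrite p1 V1 mulr1.
    by rewrite /det2 /dot /nrm2; ring.
  have -> : (p.1 - (V w).1) ^+ 2 + (p.2 - (V w).2) ^+ 2 = 2 - 2 * dot p (V w).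
    have : nrm2 p + nrm2 (V w) = 2 by rewrite p1 V1.
    by rewrite /dot /nrm2; lra.
  have d1 : dot p (V w) <= 1.
    rewrite -(@ler_pXn2r _ 2) ?nnegrE// expr1n.
    by have := sqr_ge0 (det2 p (V w)); rewrite e1; lra.
  have : dot p (V w) ^+ 2 <= dot p (V w) by rewrite expr2 ler_piMr.
  by rewrite e1; lra.
have near_small e : 0 < e -> \forall w \near w0,
    `|p.1 - (V w).1| < e /\ `|p.2 - (V w).2| < e.
  move=> e0; have e20 : 0 < e / 2 by rewrite divr_gt0.
  apply: filterS (stable_det_small w0 e20) => w /(_ p (V w) p1 (V1 w) lp (lV w)) d.
  have d2 : 2 * det2 p (V w) ^+ 2 < e ^+ 2.
    have : det2 p (V w) ^+ 2 < (e / 2) ^+ 2.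
      by rewrite -[X in X < _]real_normK ?num_real// ltr_pXn2r ?nnegrE// ltW.
    by rewrite expr_div_n; have := sqr_ge0 (det2 p (V w)); have := sqr_ge0 e; lra.
  have := close w; have := sqr_ge0 (p.1 - (V w).1); have := sqr_ge0 (p.2 - (V w).2).
  by move=> *; split; rewrite -(@ltr_pXn2r _ 2) ?nnegrE ?(ltW e0)// real_normK ?num_real//; lra.
exists V.
  move=> w; split => // V0'; have := V1 w.
  by rewrite V0' /nrm2 /= expr0n addr0 => /eqP; rewrite eq_sym oner_eq0.
split; apply/cvgrPdist_lt => e /near_small; rewrite -Vw0; apply: filterS => w [] //.
Qed.

End stable_section.

(** * Relative rotation of solutions at two energies *)

Section relative_rotation.
Context {R : realType}.
Implicit Types (c : nat -> R) (p q : R * R) (j D : int) (b : bool).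

(** A zero of the solution is charged to the step at which it is the first entry, so that each sign
    change is counted once. *)
Definition flip p := (p.1 * p.2 < 0) || (p.1 == 0).

(** The sign that moves a nonzero [p] to the half-plane [x > 0] completed by the ray [x = 0],
    [y < 0]. With this convention on the ray it changes under [step] exactly at flips. *)
Definition sg p : R := if (0 < p.1) || ((p.1 == 0) && (p.2 < 0)) then 1 else -1.

Definition sig p q : R := sg p * sg q * det2 p q.

Lemma sg_sqr p : sg p * sg p = 1.
Proof. by rewrite /sg; case: ifP => _; rewrite ?mulrNN mulr1. Qed.

Lemma sg_norm p : p <> (0, 0) -> 0 < sg p * p.1 \/ (p.1 = 0 /\ sg p * p.2 < 0).
Proof.
case: p => x y p0; rewrite /sg /=; case: (ltgtP x 0) => [x0|x0|x0] /=.
- by left; lra.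
- by left; lra.
- right; split=> //; case: (ltgtP y 0) => [y0|y0|y0]; [lra|lra|].
  by exfalso; apply: p0; rewrite x0 y0.
Qed.

Lemma flipE p : p <> (0, 0) -> flip p = (sg p * p.2 < 0).
Proof.
case: p => x y p0; rewrite /flip /sg /=.
case: (ltgtP x 0) => [x0|x0|x0] /=; rewrite ?orbF ?orbT ?mul1r ?mulN1r ?oppr_lt0.
- by rewrite nmulr_rlt0.
- by rewrite pmulr_rlt0.
- case: (ltgtP y 0) => [y0|y0|y0]; rewrite ?mul1r ?mulN1r ?oppr_lt0 ?y0//.
  by exfalso; apply: p0; rewrite x0 y0.
Qed.

Lemma sg_step k p : p <> (0, 0) -> sg (step k p) = (if flip p then -1 else 1) * sg p.
Proof.
case: p => x y p0; rewrite /flip /sg /step /=.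
case: (ltgtP x 0) => [x0|x0|x0] /=; case: (ltgtP y 0) => [y0|y0|y0] /=;
  rewrite ?orbT ?orbF ?mulrNN ?mul1r ?mulr1 //=.
- by rewrite nmulr_rlt0// ltNge ltW//= mul1r.
- by rewrite nmulr_rlt0// y0 mulN1r opprK.
- by rewrite y0 !mulr0 sub0r oppr_lt0 ltNge ltW//= ltxx mul1r.
- by rewrite pmulr_rlt0// y0 ?mulr1 ?mul1r.
- by rewrite pmulr_rlt0// ltNge ltW//= ?mul1r.
- by rewrite y0 !mulr0 sub0r oppr_lt0 x0 ltxx ?mul1r.
- by exfalso; apply: p0; rewrite x0 y0.
Qed.

Lemma step_neq0 k p : p <> (0, 0) -> step k p <> (0, 0).
Proof.
case: p => x y p0; rewrite /step /= => -[y0]; rewrite y0 mulr0 sub0r => /eqP.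
by rewrite oppr_eq0 => /eqP x0; apply: p0; rewrite x0 y0.
Qed.

Lemma vec_neq0 c p n : p <> (0, 0) -> vec c p n <> (0, 0).
Proof. by move=> p0; elim: n => //= n IH; exact: step_neq0. Qed.

Let s b : R := if b then -1 else 1.

Lemma sig_step k k' p q : p <> (0, 0) -> q <> (0, 0) ->
  sig (step k p) (step k' q) = s (flip p) * s (flip q) *
    (sig p q + (k' - k) * ((sg p * p.2) * (sg q * q.2))).
Proof.
move=> p0 q0; rewrite /sig (sg_step k p0) (sg_step k' q0) det_step -/(s _) -/(s _).
by ring.
Qed.

Lemma sigE p q : sig p q = (sg p * p.1) * (sg q * q.2) - (sg p * p.2) * (sg q * q.1).
Proof. by rewrite /sig /det2; ring. Qed.

Lemma int_up j D : j <= D -> j < D + true%:Z - false%:Z.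
Proof. lia. Qed.

Lemma int_down j D : j < D -> j < D + false%:Z - true%:Z \/ D + false%:Z - true%:Z = j.
Proof. lia. Qed.

(* Lexicographic comparison of the lifted projective angles of two solutions; [D] is the
   number of extra sign changes of the first one and [x] the normalised Wronskian. *)
Definition lex j D (x : R) := j < D \/ (D = j /\ 0 <= x).
Definition slex j D (x : R) := j < D \/ (D = j /\ 0 < x).

(** The delicate case is a flip of [q] alone, which lowers [D]. It is impossible for [D = j],
    because then both terms of [sigE] push the normalised Wronskian below zero; and if [D] drops to
    [j], the flip reverses that sign and [k <= k'] does not spoil it. *)
Lemma lex_step k k' p q j D : k <= k' -> p <> (0, 0) -> q <> (0, 0) ->
  lex j D (sig p q) ->
  lex j (D + (flip p)%:Z - (flip q)%:Z) (sig (step k p) (step k' q)).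
Proof.
move=> kk p0 q0; rewrite sig_step// !flipE// sigE.
have : 0 <= sg p * p.1 /\ (0 < sg p * p.1 \/ sg p * p.2 < 0).
  by case: (sg_norm p0) => [h|[-> h]]; rewrite ?mulr0; split; auto; rewrite ?ltW.
have : 0 <= sg q * q.1 /\ (0 < sg q * q.1 \/ sg q * q.2 < 0).
  by case: (sg_norm q0) => [h|[-> h]]; rewrite ?mulr0; split; auto; rewrite ?ltW.
move: (sg p * p.1) (sg p * p.2) (sg q * q.1) (sg q * q.2) => x y x' y'.
move=> [x'0 h'] [x0 h].
have kyy : 0 <= y * y' -> 0 <= (k' - k) * (y * y').
  by move=> ?; rewrite mulr_ge0// subr_ge0.
rewrite /lex /s; case: (ltP y 0) => y0; case: (ltP y' 0) => y'0 /=.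
- have {}kyy := kyy (ltac:(nra)).
  by rewrite addrK; case=> [?|[-> ?]]; [left|right; split=> //; nra].
- by case=> [/ltW|[-> _]]; left; exact: int_up.
- have {}h : 0 < x by case: h; lra.
  move=> [jD|[_ ?]]; last by exfalso; nra.
  have [?|->] := int_down jD; first by left.
  have kyyN : (k' - k) * (y * y') <= 0.
    by rewrite mulr_ge0_le0 ?subr_ge0// mulr_ge0_le0// ltW.
  by right; split=> //; nra.
- have {}kyy := kyy (mulr_ge0 y0 y'0).
  by rewrite addrK; case=> [?|[-> ?]]; [left|right; split=> //; nra].
Qed.

Lemma slex_step k k' p q j D : k <= k' -> p <> (0, 0) -> q <> (0, 0) ->
  slex j D (sig p q) ->
  slex j (D + (flip p)%:Z - (flip q)%:Z) (sig (step k p) (step k' q)).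
Proof.
move=> kk p0 q0; rewrite sig_step// !flipE// sigE.
have : 0 <= sg p * p.1 /\ (0 < sg p * p.1 \/ sg p * p.2 < 0).
  by case: (sg_norm p0) => [h|[-> h]]; rewrite ?mulr0; split; auto; rewrite ?ltW.
have : 0 <= sg q * q.1 /\ (0 < sg q * q.1 \/ sg q * q.2 < 0).
  by case: (sg_norm q0) => [h|[-> h]]; rewrite ?mulr0; split; auto; rewrite ?ltW.
move: (sg p * p.1) (sg p * p.2) (sg q * q.1) (sg q * q.2) => x y x' y'.
move=> [x'0 h'] [x0 h].
have kyy : 0 <= y * y' -> 0 <= (k' - k) * (y * y').
  by move=> ?; rewrite mulr_ge0// subr_ge0.
rewrite /slex /s; case: (ltP y 0) => y0; case: (ltP y' 0) => y'0 /=.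
- have {}kyy := kyy (ltac:(nra)).
  by rewrite addrK; case=> [?|[-> ?]]; [left|right; split=> //; nra].
- by case=> [/ltW|[-> _]]; left; exact: int_up.
- have {}h : 0 < x by case: h; lra.
  move=> [jD|[_ ?]]; last by exfalso; nra.
  have [?|->] := int_down jD; first by left.
  have kyyN : (k' - k) * (y * y') <= 0.
    by rewrite mulr_ge0_le0 ?subr_ge0// mulr_ge0_le0// ltW.
  by right; split=> //; nra.
- have {}kyy := kyy (mulr_ge0 y0 y'0).
  by rewrite addrK; case=> [?|[-> ?]]; [left|right; split=> //; nra].
Qed.

(* One step makes the comparison strict unless both second entries vanish, and then the
   next step does. *)
Lemma lex_slex_step k k' p q j D : k < k' -> p <> (0, 0) -> q <> (0, 0) ->
  p.2 != 0 -> lex j D (sig p q) ->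
  slex j (D + (flip p)%:Z - (flip q)%:Z) (sig (step k p) (step k' q)).
Proof.
move=> kk p0 q0 p2; rewrite sig_step// !flipE// sigE.
have {p2} : sg p * p.2 != 0.
  by rewrite mulf_neq0//; apply/eqP => s0; have := sg_sqr p; rewrite s0 mulr0; lra.
have : 0 <= sg p * p.1 /\ (0 < sg p * p.1 \/ sg p * p.2 < 0).
  by case: (sg_norm p0) => [h|[-> h]]; rewrite ?mulr0; split; auto; rewrite ?ltW.
have : 0 <= sg q * q.1 /\ (0 < sg q * q.1 \/ sg q * q.2 < 0).
  by case: (sg_norm q0) => [h|[-> h]]; rewrite ?mulr0; split; auto; rewrite ?ltW.
move: (sg p * p.1) (sg p * p.2) (sg q * q.1) (sg q * q.2) => x y x' y'.
move=> [x'0 h'] [x0 h] yn0; rewrite /lex /slex /s.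
have kyy : 0 < y * y' -> 0 < (k' - k) * (y * y').
  by move=> ?; rewrite mulr_gt0// subr_gt0.
case: (ltP y 0) => y0; case: (ltP y' 0) => y'0 /=.
- have {}kyy := kyy (ltac:(nra)).
  by rewrite addrK; case=> [?|[-> ?]]; [left|right; split=> //; nra].
- by case=> [/ltW|[-> _]]; left; exact: int_up.
- have {}h : 0 < x by case: h; lra.
  move=> [jD|[_ ?]]; last by exfalso; nra.
  have [?|->] := int_down jD; first by left.
  have kyyN : (k' - k) * (y * y') <= 0.
    by rewrite mulr_ge0_le0 ?subr_ge0 ?(ltW kk)// mulr_ge0_le0// ltW.
  by right; split=> //; nra.
- have {}y0 : 0 < y by rewrite lt0r yn0.
  have {}h : 0 < x by case: h; lra.
  have {}h' : 0 < x' by case: h'; lra.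
  rewrite addrK; case=> [?|[-> H]]; [by left|right; split=> //].
  have y'p : 0 < y'.
    by rewrite -(pmulr_rgt0 _ h); apply: lt_le_trans (_ : y * x' <= _); [exact: mulr_gt0|lra].
  have {}kyy := kyy (mulr_gt0 y0 y'p); lra.
Qed.

End relative_rotation.

(** * Sign changes over a window and the gain of a half-turn *)

Section window.
Context {R : realType}.
Implicit Types (c : nat -> R) (p q : R * R) (j D : int).

Definition flips c p n : nat := \sum_(k < n) flip (vec c p k).

Definition extra_flips c c' p q n : int := (flips c p n)%:Z - (flips c' q n)%:Z.

Lemma extra_flipsS c c' p q n : extra_flips c c' p q n.+1 =
  extra_flips c c' p q n + (flip (vec c p n))%:Z - (flip (vec c' q n))%:Z.
Proof. by rewrite /extra_flips /flips !big_ord_recr /=; lia. Qed.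

(* Double Darboux transformation: (H - E)(H - E') = D^* D, where (D psi)(n) is the
   Casoratian of u, u' and psi divided by the square root of w_(n-1) w_n. *)
Lemma darboux_identity (u0 u1 v0 v1 k k' f0 f1 f2 : R) :
  let u2 := k * u1 - u0 in let v2 := k' * v1 - v0 in
  let w0 := u0 * v1 - u1 * v0 in let w1 := u1 * v2 - u2 * v1 in
  let t0 := (k' - k) / w0 * (u1 * f0 - u0 * f1) * (v1 * f0 - v0 * f1) in
  let t1 := (k' - k) / w1 * (u2 * f1 - u1 * f2) * (v2 * f1 - v1 * f2) in
  w0 != 0 -> w1 != 0 ->
  (f2 + f0 - k * f1) * (f2 + f0 - k' * f1) =
  (w0 * f2 + w1 * f0 - (u0 * v2 - u2 * v0) * f1) ^+ 2 / (w0 * w1) + (t1 - t0).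
Proof.
move=> u2 v2 w0 w1 t0 t1 w0n w1n; rewrite /t0 /t1.
(* Names for the two Wronskians in the denominators reduce the claim to the polynomial identity
   [main]. *)
suff : forall x y : R, x = w0 -> y = w1 ->
  (f2 + f0 - k * f1) * (f2 + f0 - k' * f1) =
  (x * f2 + y * f0 - (u0 * v2 - u2 * v0) * f1) ^+ 2 / (x * y) +
  ((k' - k) / y * (u2 * f1 - u1 * f2) * (v2 * f1 - v1 * f2) -
   (k' - k) / x * (u1 * f0 - u0 * f1) * (v1 * f0 - v0 * f1)) by apply.
move=> x y xE yE; have xn : x != 0 by rewrite xE. have yn : y != 0 by rewrite yE.
have main : (f2 + f0 - k * f1) * (f2 + f0 - k' * f1) * (w0 * w1) =
  (w0 * f2 + w1 * f0 - (u0 * v2 - u2 * v0) * f1) ^+ 2 +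
  ((k' - k) * w0 * (u2 * f1 - u1 * f2) * (v2 * f1 - v1 * f2) -
   (k' - k) * w1 * (u1 * f0 - u0 * f1) * (v1 * f0 - v0 * f1)).
  by rewrite /w0 /w1 /u2 /v2; ring.
apply: (@mulIf _ (x * y)); first exact: mulf_neq0.
move: main; rewrite -xE -yE => ->; field.
by rewrite xn yn.
Qed.

Section two_energies.
Variables (c c' : nat -> R) (p q : R * R) (j : int).
Hypotheses (cc : forall n, c n < c' n) (p0 : p <> (0, 0)) (q0 : q <> (0, 0)).

Let D := extra_flips c c' p q.
Let x n := sig (vec c p n) (vec c' q n).

Lemma lex_mono n m i : (n <= m)%N -> lex i (D n) (x n) -> lex i (D m) (x m).
Proof.
move=> nm; rewrite -(subnKC nm); elim: (m - n)%N => [|k IH]; first by rewrite addn0.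
move=> /IH; rewrite addnS /D extra_flipsS => H.
by apply: lex_step H; [exact: ltW|exact: vec_neq0..].
Qed.

Lemma lex_slex n : lex j (D 0) (x 0) -> (2 <= n)%N -> slex j (D n) (x n).
Proof.
move=> l0; have S i k : slex i (D k) (x k) -> slex i (D k.+1) (x k.+1).
  rewrite /D extra_flipsS => H.
  by apply: slex_step H; [exact: ltW|exact: vec_neq0..].
have S1 k : (vec c p k).2 != 0 -> lex j (D k) (x k) -> slex j (D k.+1) (x k.+1).
  rewrite /D extra_flipsS => k2 H.
  by apply: lex_slex_step H => //; exact: vec_neq0.
have l2 : slex j (D 2) (x 2).
  have [p2|p2] := eqVneq p.2 0; last by apply: S; exact: S1.
  apply: S1; last exact: (@lex_mono 0 1).
  rewrite /= p2 mulr0 sub0r oppr_eq0; apply/eqP => p1.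
  by apply: p0; move: p1 p2; case: (p) => ? ? /= -> ->.
move=> n2; rewrite -(subnKC n2); elim: (n - 2)%N => [//|k IH].
by rewrite addnS; exact: S.
Qed.

(** Strictly between the levels [j] and [j + 1], either [D = j] and the normalised Wronskian is
    positive, or [D = j + 1] and it is negative. The signs [sg] follow the parity of [D], so the
    true Wronskian keeps its sign. *)
Lemma wronskian_pos n : slex j (D n) (x n) -> slex j (D n.+1) (x n.+1) ->
  ~ lex (j + 1) (D n) (x n) -> ~ lex (j + 1) (D n.+1) (x n.+1) ->
  0 < det2 (vec c p n) (vec c' q n) * det2 (vec c p n.+1) (vec c' q n.+1).
Proof.
rewrite /D extra_flipsS -/D /x.
have sE a b : det2 a b = sg a * sg b * sig a b :> R.
  rewrite /sig; have := sg_sqr a; have := sg_sqr b.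
  by move: (sg a) (sg b) (det2 a b) => r s d s1 r1; rewrite mulrA mulrACA r1 s1 !mul1r.
have btw i y : slex j i y -> ~ lex (j + 1) i y -> (i = j /\ 0 < y) \/ (i = j + 1 /\ y < 0).
  case=> [ji|[-> y0]] nl; last by left.
  have [?|ij] : j + 1 < i \/ i = j + 1 by lia.
    by exfalso; apply: nl; left.
  right; split=> //; rewrite ltNge; apply/negP => y0; by apply: nl; right.
move=> /btw b1 /btw b2 /b1 {}b1 /b2 {}b2; move: b1 b2.
rewrite sE (sE (vec c p n.+1)).
rewrite [sg (vec c p n.+1)](sg_step _ (vec_neq0 (c := c) (n := n) p0)).
rewrite [sg (vec c' q n.+1)](sg_step _ (vec_neq0 (c := c') (n := n) q0)).
have := sg_sqr (vec c p n); have := sg_sqr (vec c' q n).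
move: (sg (vec c p n)) (sg (vec c' q n)) (sig _ _) (sig _ _) => r s z y s1 r1.
case: (flip _); case: (flip _) => /=.
- have -> : r * s * y * (-1 * r * (-1 * s) * z) = (r * r) * (s * s) * (y * z) by ring.
  by rewrite r1 s1 !mul1r; case=> [[? ?]|[? ?]]; case=> [[? ?]|[? ?]]; try lia; nra.
- have -> : r * s * y * (-1 * r * (1 * s) * z) = - ((r * r) * (s * s) * (y * z)) by ring.
  by rewrite r1 s1 !mul1r; case=> [[? ?]|[? ?]]; case=> [[? ?]|[? ?]]; try lia; nra.
- have -> : r * s * y * (1 * r * (-1 * s) * z) = - ((r * r) * (s * s) * (y * z)) by ring.
  by rewrite r1 s1 !mul1r; case=> [[? ?]|[? ?]]; case=> [[? ?]|[? ?]]; try lia; nra.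
- have -> : r * s * y * (1 * r * (1 * s) * z) = (r * r) * (s * s) * (y * z) by ring.
  by rewrite r1 s1 !mul1r; case=> [[? ?]|[? ?]]; case=> [[? ?]|[? ?]]; try lia; nra.
Qed.

Lemma telescope_sum_ge (F t : nat -> R) n m : (n <= m)%N ->
  (forall i, (n <= i < m)%N -> t i.+1 - t i <= F i) ->
  t m - t n <= \sum_(n <= i < m) F i.
Proof.
move=> nm le; rewrite -(@telescope_sumr _ n m t nm).
by apply: ler_sum_nat => i ib; exact: le.
Qed.

(* Otherwise the Wronskian does not change sign on the window, the Darboux identity gives
   <(H - E)psi, (H - E')psi> >= 0, and psi cannot be an approximate eigenvector for an
   energy strictly between E and E'. *)
Lemma window_gain (a b : R) (psi : nat -> R) L : 0 < a -> 0 < b ->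
  (forall n, c' n = c n + a + b) ->
  (forall n, (n < 4)%N || (L <= n)%N -> psi n = 0) -> (4 <= L)%N ->
  (1 + (a - b) ^+ 2 / (2 * (a * b))) *
    \sum_(n < L) (psi n.+2 + psi n - (c n + a) * psi n.+1) ^+ 2 <
    a * b / 2 * \sum_(n < L) psi n.+1 ^+ 2 ->
  lex j (D 0) (x 0) -> lex (j + 1) (D L) (x L).
Proof.
move=> a0 b0 c'E ps L4 small l0; apply: contrapT => nl.
have nn n : (n <= L)%N -> ~ lex (j + 1) (D n) (x n).
  by move=> nL /(lex_mono nL).
pose w n := det2 (vec c p n) (vec c' q n).
have wp n : (2 <= n < L)%N -> 0 < w n * w n.+1.
  move=> /andP[n2 nL]; apply: wronskian_pos; [apply: lex_slex => //..|apply: nn|apply: nn] => //.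
  - exact: ltnW.
  - exact: ltnW.
pose u := usol c p; pose u' := usol c' q.
pose t n := (a + b) / w n * (u n.+1 * psi n - u n * psi n.+1) *
  (u' n.+1 * psi n - u' n * psi n.+1).
pose F n := (psi n.+2 + psi n - c n * psi n.+1) * (psi n.+2 + psi n - c' n * psi n.+1).
have tF : t L - t 2 <= \sum_(2 <= n < L) F n.
  apply: telescope_sum_ge => [|n nb]; first exact: leq_trans L4.
  have := wp n nb; rewrite /w !vecE => ww.
  have w0 : w n != 0 by apply/eqP => w0; move: ww; rewrite -!vecE -/(w n) w0 mul0r ltxx.
  have w1 : w n.+1 != 0.
    by apply/eqP => w1; move: ww; rewrite -!vecE -/(w n.+1) w1 mulr0 ltxx.
  move: ww; rewrite -!vecE -/(w n) -/(w n.+1) => ww.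
  have := @darboux_identity (u n) (u n.+1) (u' n) (u' n.+1) (c n) (c' n)
    (psi n) (psi n.+1) (psi n.+2).
  rewrite -!usolSS -/u -/u'.
  have wE m : u m * u' m.+1 - u m.+1 * u' m = w m by rewrite /w !vecE.
  rewrite !wE => /(_ w0 w1); rewrite (_ : c' n - c n = a + b); last first.
    by rewrite c'E; ring.
  rewrite /F /t => ->; rewrite lerDr divr_ge0 ?sqr_ge0//; exact: ltW.
(* The sum starts at 2 because the comparison is strict only from there on; four leading zeros of
   [psi] make [t 2] and the two skipped terms vanish. *)
have t2 : t 2 = 0 by rewrite /t !ps// !mulr0 subrr !mulr0.
have tL : t L = 0 by rewrite /t !ps ?mulr0 ?subrr ?mulr0 ?leqnn ?leqnSn ?orbT.
have {}tF : 0 <= \sum_(n < L) F n.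
  move: tF; rewrite t2 tL subrr => /le_trans; apply.
  rewrite -(big_mkord xpredT F) (@big_cat_nat _ _ _ 2 0 L)//=; last exact: leq_trans L4.
  rewrite lerDr big_nat big1// => n n2.
  by rewrite /F !ps ?mulr0 ?addr0 ?subr0 ?mulr0//; lia.
move: small; rewrite ltNge => /negP; apply.
rewrite -subr_ge0; apply: (le_trans tF); rewrite !mulr_sumr -sumrB; apply: ler_sum => n _.
rewrite /F c'E.
have -> : psi n.+2 + psi n - c n * psi n.+1 =
  (psi n.+2 + psi n - (c n + a) * psi n.+1) + a * psi n.+1 by ring.
have -> : psi n.+2 + psi n - (c n + a + b) * psi n.+1 =
  (psi n.+2 + psi n - (c n + a) * psi n.+1) - b * psi n.+1 by ring.
move: (psi n.+2 + psi n - (c n + a) * psi n.+1) => y.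
move: (psi n.+1) => z; rewrite -subr_ge0.
(* Completing the square in the mixed term [(a - b) y z] uses up half of [a b z^2]; this is the
   origin of the constants in the hypothesis. *)
have -> : (1 + (a - b) ^+ 2 / (2 * (a * b))) * y ^+ 2 - a * b / 2 * z ^+ 2 -
   (y + a * z) * (y - b * z) = ((a - b) * y - a * b * z) ^+ 2 / (2 * (a * b)).
  by field; rewrite !gt_eqF.
by rewrite divr_ge0 ?sqr_ge0// mulr_ge0// ltW// mulr_gt0.
Qed.

End two_energies.

End window.

(** * The ergodic theorem for indicator functions *)

Section birkhoff.
Context {R : realType} {Omega : pmetricType R}.
Variables (T : homeomorphism Omega) (mu : probability (borel Omega) R).
Implicit Types (A B : set (borel Omega)) (w : borel Omega) (r : R).

Definition hits A n w : R := \sum_(k < n) \1_A (iter k T w).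

Let indic01 A w : 0 <= (\1_A w : R) <= 1.
Proof. by rewrite indicE; case: (_ \in _); rewrite ?ler01 ?lexx. Qed.

Lemma hits_ge0 A n w : 0 <= hits A n w.
Proof. by apply: sumr_ge0 => k _; case/andP: (indic01 A (iter k T w)). Qed.

Lemma hitsD A n m w : hits A (n + m) w = hits A n w + hits A m (iter n T w).
Proof.
rewrite /hits big_split_ord /=; congr (_ + _).
by apply: eq_bigr => k _; rewrite addnC iterD.
Qed.

Lemma hitsS A n w : hits A n.+1 w = \1_A w + hits A n (T w).
Proof. by rewrite -add1n hitsD /hits big_ord1. Qed.

Lemma hits_le A n w : hits A n w <= n%:R.
Proof.
apply: (@le_trans _ _ (\sum_(k < n) 1)); last by rewrite sumr_const card_ord.
by apply: ler_sum => k _; case/andP: (indic01 A (iter k T w)).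
Qed.

Lemma hits_sub A B n w : A `<=` B -> hits A n w <= hits B n w.
Proof.
move=> AB; apply: ler_sum => k _; rewrite !indicE ler_nat.
by have [/set_mem/AB/mem_set ->|] := boolP (_ \in A).
Qed.

Lemma hitsC A n w : hits (~` A) n w = n%:R - hits A n w.
Proof.
apply/eqP; rewrite eq_sym subr_eq /hits -big_split /=.
rewrite (eq_bigr (fun=> 1)) ?sumr_const ?card_ord// => k _.
by rewrite !indicE in_setC; case: (_ \in A); rewrite ?add0r ?addr0.
Qed.

Lemma iter_measurable k A : measurable A -> measurable (iter k T @^-1` A : set (borel Omega)).
Proof. by apply: borel_preimage; exact: (@iterz_continuous _ _ T k%:Z). Qed.

Lemma indic_iter k A w : \1_A (iter k T w) = \1_(iter k T @^-1` A) w :> R.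
Proof. by rewrite !indicE; congr (nat_of_bool _)%:R; apply/idP/idP; rewrite !inE. Qed.

Lemma hits_measurable A n : measurable A -> measurable_fun setT (hits A n).
Proof.
move=> mA; apply: measurable_sum => k.
under eq_fun do rewrite indic_iter.
by apply: measurable_indic; exact: iter_measurable.
Qed.

Lemma hits_gt_measurable A n r : measurable A ->
  measurable ([set w | r < hits A n w] : set (borel Omega)).
Proof.
move=> mA; rewrite -[X in measurable X]setTI.
rewrite (_ : [set w | r < hits A n w] = hits A n @^-1` `]r, +oo[).
  exact: hits_measurable.
by apply/seteqP; split=> w /=; rewrite in_itv/= andbT.
Qed.

Hypothesis mu_ergodic : ergodic T mu.

Lemma mu_iter k A : measurable A -> mu (iter k T @^-1` A) = mu A.
Proof.
move=> mA; elim: k => [//|k IH]; case: mu_ergodic => inv _.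
by rewrite -[RHS]IH -(inv _ (iter_measurable k mA)); congr (mu _);
  apply/seteqP; split=> w /=; rewrite -iterSr.
Qed.

Lemma integral_hits A n : measurable A ->
  (\int[mu]_w (hits A n w)%:E = n%:R%:E * mu A)%E.
Proof.
move=> mA.
have mf k : measurable_fun setT (fun w => (\1_A (iter k T w))%:E : \bar R).
  apply/measurable_EFinP; under eq_fun do rewrite indic_iter.
  by apply: measurable_indic; exact: iter_measurable.
have f0 k (w : borel Omega) : setT w -> (0 <= (\1_A (iter k T w))%:E :> \bar R)%E.
  by move=> _; rewrite lee_fin; case/andP: (indic01 A (iter k T w)).
transitivity (\int[mu]_w (\sum_(k <- index_iota 0 n) (\1_A (iter k T w))%:E))%E.
  by apply: eq_integral => w _; rewrite /hits -sumEFin big_mkord.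
rewrite (ge0_integral_sum _ _ mf f0)// big_mkord.
rewrite (eq_bigr (fun=> mu A)) => [|k _].
  rewrite -(@fineK _ (mu A)) ?fin_num_measure// sumEFin sumr_const card_ord.
  by rewrite -EFinM mulr_natl.
under eq_integral do rewrite indic_iter.
rewrite integral_indic//; last exact: iter_measurable.
by rewrite setIT; exact: mu_iter.
Qed.

(* Every orbit is a concatenation of blocks of length at most [N] on each of which the
   average is at least [r]. *)
Lemma hits_lower_bound A r N : measurable A -> 0 <= r ->
  (forall w, exists n, [/\ (0 < n)%N, (n <= N)%N & r * n%:R <= hits A n w]) ->
  (r%:E <= mu A)%E.
Proof.
move=> mA r0 HN.
have lowb M w : r * (M%:R - N%:R) <= hits A M w.
  have [m] := ubnP M; elim: m M w => // m IH M w Mm.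
  have [MN|NM] := leqP M N.
    by apply: le_trans (hits_ge0 _ _ _); rewrite mulr_ge0_le0// subr_le0 ler_nat.
  have [n [n0 nN hn]] := HN w.
  have ME : M = (n + (M - n))%N by lia.
  have := IH (M - n)%N (iter n T w) (ltac:(lia)).
  have -> : M%:R = n%:R + (M - n)%:R :> R by rewrite {1}ME natrD.
  by rewrite [X in _ -> _ <= hits A X w]ME hitsD; lra.
pose x := fine (mu A).
have xE : mu A = x%:E by rewrite /x fineK ?fin_num_measure.
rewrite xE lee_fin leNgt; apply/negP => xr.
have le M : r * (M%:R - N%:R) <= M%:R * x.
  have [MN|NM] := leqP M N.
    rewrite (@le_trans _ _ 0)//; first by rewrite mulr_ge0_le0// subr_le0 ler_nat.
    by rewrite mulr_ge0// /x fine_ge0.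
  rewrite -lee_fin [in leRHS]EFinM -xE -integral_hits//.
  have -> : (r * (M%:R - N%:R))%:E = (\int[mu]_w (cst (r * (M%:R - N%:R))%:E) w)%E.
    by rewrite integral_cst// [X in _ = (_ * X)%E](probability_setT mu) mule1.
  apply: ge0_le_integral => //.
  - by move=> w _; rewrite lee_fin mulr_ge0// subr_ge0 ler_nat ltnW.
  - by apply/measurable_EFinP; exact: hits_measurable.
  - by move=> w _; rewrite lee_fin.
have d0 : 0 < r - x by rewrite subr_gt0.
have [M] : exists M : nat, r * N%:R / (r - x) < M%:R.
  by eexists; apply: archi_boundP; rewrite divr_ge0 ?mulr_ge0// ltW.
by rewrite ltr_pdivrMr//; have := le M; lra.
Qed.

(** The excess over [r * n] must beat every [K]. A shift of the orbit changes it by a bounded amount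
    only, so the set is exactly invariant. *)
Definition hits_unbounded A r := [set w | forall K : nat, exists n, r * n%:R + K%:R < hits A n w].

Lemma hits_unbounded_measurable A r : measurable A ->
  measurable (hits_unbounded A r : set (borel Omega)).
Proof.
move=> mA; rewrite (_ : hits_unbounded A r =
  \bigcap_(K : nat) \bigcup_n [set w | r * n%:R + K%:R < hits A n w]).
  apply: bigcap_measurableType => K _; apply: bigcupT_measurable => n.
  exact: hits_gt_measurable.
apply/seteqP; split=> [w H K _|w H K]; first by have [n] := H K; exists n.
by have [n _] := H K I; exists n.
Qed.

Lemma hits_unbounded_invariant A r : 0 <= r <= 1 ->
  T @^-1` (hits_unbounded A r) = hits_unbounded A r.
Proof.
move=> /andP[r0 r1]; apply/seteqP; split=> w H K.
  have [n] := H K.+1; exists n.+1; rewrite hitsS; move: p; rewrite -!natr1.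
  by case/andP: (indic01 A w); lra.
have [[|n]] := H K.+1; first by rewrite mulr0 add0r /hits big_ord0 ltNge ler0n.
by exists n; move: p; rewrite hitsS -!natr1; case/andP: (indic01 A w); lra.
Qed.

(* If the set were conull, adding to [A] the small set [C N] of the points without a block
   of length at most [N] as in [hits_lower_bound] would give measure at least [r]. *)
Lemma hits_unbounded_null A r : measurable A -> 0 <= r <= 1 -> (mu A < r%:E)%E ->
  mu (hits_unbounded A r) = 0%E.
Proof.
move=> mA r01 Ar; case: mu_ergodic => _ erg.
have mB := hits_unbounded_measurable r mA.
have [//|B1] := erg _ mB (hits_unbounded_invariant A r01).
exfalso; have /andP[r0 r1] := r01.
pose C N : set (borel Omega) :=
  [set w | forall n, (0 < n)%N -> (n <= N)%N -> hits A n w < r * n%:R].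
have mC N : measurable (C N).
  rewrite (_ : C N = \bigcap_(n in [set n | (0 < n)%N && (n <= N)%N])
     ~` [set w | r * n%:R <= hits A n w]).
    apply: bigcap_measurableType => n _; apply: measurableC.
    rewrite -[X in measurable X]setTI.
    rewrite (_ : [set w | r * n%:R <= hits A n w] = hits A n @^-1` `[r * n%:R, +oo[).
      exact: hits_measurable.
    by apply/seteqP; split=> w /=; rewrite in_itv/= andbT.
  apply/seteqP; split=> [w H n /= /andP[n0 nN]|w H n n0 nN].
    by apply/negP; rewrite -ltNge; exact: H.
  by rewrite ltNge; apply/negP; apply: H; rewrite /= n0 nN.
have C0 : mu (\bigcap_N C N) = 0%E.
  apply/eqP; rewrite -measure_le0 -(subee (x := 1%E))// -{2}B1 -probability_setC//.
  apply: le_measure; rewrite ?inE//; [exact: bigcap_measurableType|exact: measurableC|].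
  move=> w H /(_ 0%N)[n]; rewrite addr0 => lt.
  have n0 : (0 < n)%N by case: n lt => //; rewrite mulr0 /hits big_ord0 ltxx.
  by have := H n I n n0 (leqnn n); rewrite ltNge ltW.
have Ccvg : mu \o C @ \oo --> 0%E.
  rewrite -C0; apply: nonincreasing_cvg_mu => //.
  - by rewrite (le_lt_trans (probability_le1 _ (mC 0%N)))// ltry.
  - exact: bigcap_measurableType.
  - move=> n m nm; apply/subsetPset => w H k k0 kn; apply: H => //.
    exact: leq_trans nm.
pose x := fine (mu A).
have xE : mu A = x%:E by rewrite /x fineK ?fin_num_measure.
have xr : x < r by rewrite -lte_fin -xE.
have [N CN] : exists N, (mu (C N) < (r - x)%:E)%E.
  have : \forall N \near \oo, (mu (C N) < (r - x)%:E)%E.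
    apply: (Ccvg [set y | (y < (r - x)%:E)%E]); apply: open_nbhs_nbhs; split.
      exact: open_ereal_lt_ereal.
    by rewrite /= lte_fin subr_gt0.
  by case=> N _ H; exists N; apply: H => /=.
have mAC : measurable (A `|` C N) by exact: measurableU.
have : (r%:E <= mu (A `|` C N))%E.
  (* A point of [C N] is a block of length 1, for which [N.+1] leaves room even when [N = 0]. *)
  apply: (@hits_lower_bound _ _ N.+1) => // w.
  have [wC|wC] := pselect (C N w).
    exists 1%N; split=> //; rewrite mulr1 /hits big_ord1 /= indicE.
    by rewrite (_ : w \in _) // inE; right.
  move/existsNP: wC => [n /not_implyP[n0 /not_implyP[nN /negP]]].
  rewrite -leNgt => h; exists n; split => //; first exact: leqW.
  by apply: (le_trans h); apply: hits_sub; left.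
have muAC : (mu (A `|` C N) <= mu A + mu (C N))%E by exact: measureU2.
apply/negP; rewrite -ltNge; apply: (le_lt_trans muAC).
rewrite xE -[in X in (_ < X)%E](subrKC x r) [X in (_ < X)%E]EFinD.
by rewrite lteD2lE.
Qed.

Lemma birkhoff_upper A e : measurable A -> 0 < e ->
  {ae mu, forall w, exists K : nat, forall n, hits A n w <= (fine (mu A) + e) * n%:R + K%:R}.
Proof.
move=> mA e0; pose r := fine (mu A) + e.
have xE : mu A = (fine (mu A))%:E by rewrite fineK ?fin_num_measure.
have x0 : 0 <= fine (mu A) by rewrite fine_ge0.
have [r1|r1] := leP r 1; last first.
  apply: (@ae_sub _ _ _ setT).
    move=> w _; exists 0%N => n; rewrite addr0; apply: (le_trans (hits_le _ _ _)).
    by rewrite ler_peMl// ltW.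
  by exists set0; split=> // w /=; apply.
exists (hits_unbounded A r); split.
- exact: hits_unbounded_measurable.
- apply: hits_unbounded_null => //; first by rewrite r1 andbT addr_ge0// ltW.
  by rewrite {1}xE lte_fin ltrDl.
- move=> w /= /forallNP H K; have /existsNP[n /negP] := H K.
  by rewrite -ltNge => ?; exists n.
Qed.

(** Convergence of the hit frequencies to [m], in an additive form that avoids dividing by [n]. *)
Definition hits_density A (m : R) w := forall e, 0 < e ->
  exists K : R, forall n, `|hits A n w - m * n%:R| <= e * n%:R + K.

(** The upper bound for the complement of [A] is the lower bound for [A], and countably many [e]
    suffice. *)
Theorem birkhoff A : measurable A -> {ae mu, forall w, hits_density A (fine (mu A)) w}.
Proof.
move=> mA; have mAC : measurable (~` A) by exact: measurableC.
have muC : fine (mu (~` A)) = 1 - fine (mu A).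
  have xE : mu A = (fine (mu A))%:E by rewrite fineK ?fin_num_measure.
  by rewrite probability_setC// xE -EFinB.
have e0 k : 0 < (k.+1%:R : R)^-1 by rewrite invr_gt0.
pose P B k := [set w : borel Omega | exists K : nat, forall n,
  hits B n w <= (fine (mu B) + k.+1%:R^-1) * n%:R + K%:R].
suff H B : measurable B -> {ae mu, forall w, forall k, P B k w}.
  apply: ae_sub (ae_and (H _ mA) (H _ mAC)) => w [H1 H2] e ep.
  have [k ke] : exists k : nat, k.+1%:R^-1 < e.
    exists (Num.bound e^-1); rewrite invf_plt ?posrE//.
    apply: (lt_trans (archi_boundP _)); first by rewrite invr_ge0 ltW.
    by rewrite ltr_nat.
  have [K1 h1] := H1 k; have [K2 h2] := H2 k; exists (K1%:R + K2%:R) => n.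
  have := h1 n; have := h2 n; rewrite hitsC muC.
  have : k.+1%:R^-1 * n%:R <= e * n%:R by rewrite ler_wpM2r// ltW.
  have := ler0n R K1; have := ler0n R K2; move: (k.+1%:R^-1) => kap.
  move: (hits A n w) (fine (mu A)) (n%:R : R) (K1%:R : R) (K2%:R : R) => h m x k1 k2.
  by rewrite ler_norml => *; apply/andP; split; lra.
move=> mB; have : mu.-negligible (\bigcup_k ~` (P B k)).
  by apply: negligible_bigcup => k; exact: birkhoff_upper.
by apply: negligibleS => w /= /existsNP[k nk]; exists k.
Qed.

End birkhoff.

(** * Winding numbers on the suspension *)

Section suspension_null_sets.
Context {R : realType} {Omega : pmetricType R}.
Variables (T : homeomorphism Omega) (mu : probability (borel Omega) R).

Local Notation X := (suspension T).
Local Notation cls := (susp_class T).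

Lemma susp_classP w s w' s' : cls w s = cls w' s' <->
  exists n : int, w' = iterz T n w /\ s' = s - n%:~R.
Proof.
split=> [/eqmodP/asboolP[n [-> ->]]|[n [-> ->]]]; first by exists n.
by apply/eqmodP/asboolP; exists n.
Qed.

Lemma susp_class_surj (x : X) : exists w s, x = cls w s.
Proof. by exists (repr x).1, (repr x).2; rewrite /susp_class -surjective_pairing reprK. Qed.

Lemma susp_class_shift n w s : cls (iterz T n w) (s - n%:~R) = cls w s.
Proof. by apply/esym/susp_classP; exists n. Qed.

Definition chart (a b : R) (A : set Omega) : set X :=
  [set x | exists w s, [/\ A w, a < s < b & x = cls w s]].

Lemma open_susp (U : set X) : open ((fun p : Omega * R => cls p.1 p.2) @^-1` U) -> open U.
Proof.
rewrite (_ : (fun p : Omega * R => cls p.1 p.2) = \pi_X)//.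
by apply/funext => -[w s].
Qed.

Lemma chart_open a b U : open U -> open (chart a b U).
Proof.
move=> oU; apply: open_susp.
rewrite (_ : _ @^-1` _ = \bigcup_(n : int)
    [set p : Omega * R | (U (iterz T n p.1)) /\ a < p.2 - n%:~R < b]).
  apply: bigcup_open => n _.
  rewrite (_ : [set p | _] = (iterz T n \o fst) @^-1` U `&`
    ((fun p => p.2 - n%:~R) @^-1` ([set r | a < r] `&` [set r | r < b]))).
    apply: openI; apply: open_comp => //.
    - move=> p _; apply: continuous_comp; [exact: cvg_fst|exact: iterz_continuous].
    - by move=> p _; apply: cvgB; [exact: cvg_snd|exact: cvg_cst].
    - by apply: openI; [exact: open_gt|exact: open_lt].
  by apply/seteqP; split=> [p /= [? /andP]|p /= [? /andP]].
apply/seteqP; split=> [[w s] /= [w' [s' [Uw' s'ab e]]]|[w s] [n _ /= [Un ab]]].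
  by have /susp_classP[n [wE sE]] := e; exists n => //=; rewrite -wE -sE.
by exists (iterz T n w), (s - n%:~R); rewrite susp_class_shift.
Qed.

Lemma chart_inj a b w s w' s' : b - a <= 1 -> a < s < b -> a < s' < b ->
  cls w s = cls w' s' -> w = w' /\ s = s'.
Proof.
move=> ab sab s'ab /susp_classP[n [-> s'E]].
have n0 : n = 0.
  have : (-1)%:~R < n%:~R :> R by rewrite mulrNz; lra.
  have : n%:~R < 1%:~R :> R by lra.
  by rewrite !ltr_int; lia.
by rewrite s'E n0 subr0.
Qed.

(** Flow boxes of length at most 1 have unique coordinates, so forming the box commutes with
    differences. The sets with a Borel box are therefore a sigma-algebra that contains the open
    sets. *)
Lemma chart_borel a b A : b - a <= 1 -> measurable (A : set (borel Omega)) ->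
  measurable (chart a b A : set (borel X)).
Proof.
move=> ab mA.
have mT : measurable (chart a b setT : set (borel X)).
  by apply: open_borel; apply: chart_open; exact: openT.
apply: (mA [set A : set Omega | measurable (chart a b A : set (borel X))]).
split; last by move=> U oU; apply: open_borel; exact: chart_open.
split.
- rewrite /= (_ : chart a b set0 = set0)//; apply/seteqP; split=> // x [w [s []]] //.
- move=> B /= mB; rewrite (_ : chart a b (_ `\` B) = chart a b setT `\` chart a b B).
    exact: measurableD.
  apply/seteqP; split=> [x [w [s [[_ nB] sab ->]]]|x [[w [s [_ sab xE]]] nB]].
    split; first by exists w, s.
    move=> [w' [s' [Bw' s'ab e]]]; apply: nB.
    by have [-> _] := chart_inj ab sab s'ab e.
  exists w, s; split=> //; split=> // Bw; apply: nB; by exists w, s.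
- move=> B /= mB; rewrite (_ : chart a b _ = \bigcup_k chart a b (B k)).
    exact: bigcupT_measurable.
  apply/seteqP; split=> [x [w [s [[k _ Bk] sab ->]]]|x [k _ [w [s [Bk sab ->]]]]].
    by exists k => //; exists w, s.
  by exists w, s; split=> //; exists k.
Qed.

Hypothesis mu_ergodic : ergodic T mu.

Lemma mu_iterz n (A : set (borel Omega)) : measurable A -> mu (iterz T n @^-1` A) = mu A.
Proof.
have mz m B : measurable (B : set (borel Omega)) ->
    measurable (iterz T m @^-1` B : set (borel Omega)).
  by apply: borel_preimage; exact: iterz_continuous.
case: n => k mA; first exact: mu_iter.
rewrite -(mu_iter mu_ergodic k.+1 (mz (Negz k) A mA)); congr (mu _).
have K w : iterz T (Negz k) (iter k.+1 T w) = w.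
  by rewrite -[iter k.+1 T w]/(iterz T k.+1%:Z w) -iterzD NegzE addNr.
by apply/seteqP; split=> w; rewrite /preimage /mkset K.
Qed.

(** The saturation of [N0] under the orbits is still null. The classes over it have null time slices
    and are covered by two flow boxes; the one around time 0 catches the integer times. *)
Lemma susp_null_set (N0 : set (borel Omega)) : measurable N0 -> mu N0 = 0%E ->
  exists N : set (borel X), [/\ measurable N, susp_measure mu N = 0%E &
    forall w s, N0 w -> N (cls w s)].
Proof.
move=> mN0 N00.
pose N1 : set (borel Omega) := \bigcup_(n : int) (iterz T n @^-1` N0).
have mz m : measurable (iterz T m @^-1` N0 : set (borel Omega)).
  by apply: borel_preimage => //; exact: iterz_continuous.
have mN1 : measurable N1 by apply: countable_bigcupT_measurable.
have N10 : mu N1 = 0%E.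
  apply: (measure_negligible mN1).
  have [F FE] : exists F : nat -> int, forall n, exists k, F k = n.
    exists (fun k => odflt 0 (unpickle k)) => n; exists (pickle n).
    by rewrite pickleK.
  apply: (@negligibleS _ _ _ mu (\bigcup_k (iterz T (F k) @^-1` N0))).
    by move=> w [n _ h]; have [k kn] := FE n; exists k => //; rewrite kn.
  by apply: negligible_bigcup => k; apply/negligibleP; [exact: mz|rewrite -N00; exact: mu_iterz].
have N1z n w : N1 (iterz T n w) <-> N1 w.
  split=> -[m _ /= h].
    by exists (m + n) => //=; rewrite iterzD.
  by exists (m - n) => //=; rewrite -iterzD subrK.
pose N : set (borel X) := [set x | exists w s, N1 w /\ x = cls w s].
have NE w s : N (cls w s) <-> N1 w.
  split=> [[w' [s' [h /susp_classP[n [wE _]]]]]|h]; last by exists w, s.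
  by move: h; rewrite wE N1z.
exists N; split.
- rewrite (_ : N = chart 0 1 N1 `|` chart (- 2^-1) 2^-1 N1).
    by apply: measurableU; apply: chart_borel => //; lra.
  apply/seteqP; split=> x; last by case=> -[w [s [h _ ->]]]; exists w, s.
  move=> [w [s [h ->]]].
  rewrite -(susp_class_shift (Num.floor s)).
  set r := s - _.
  have r01 : 0 <= r < 1.
    have fl := floor_le s; have : s < (Num.floor s + 1)%:~R by rewrite -floor_lt_int ltrDl.
    by rewrite /r intrD; lra.
  have [r0|r0] := eqVneq r 0.
    right; exists (iterz T (Num.floor s) w), r; split=> //; first exact/N1z.
    by rewrite r0; lra.
  left; exists (iterz T (Num.floor s) w), r; split=> //; first exact/N1z.
  by case/andP: r01 => r00 ->; rewrite lt0r r0 r00.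
- rewrite /susp_measure (eq_integral (fun=> 0%E)); first by rewrite integral0.
  move=> s _; rewrite (eq_integral (fun w => (\1_N1 w)%:E)).
    by rewrite integral_indic// setIT.
  move=> w _; rewrite !indicE; congr ((nat_of_bool _)%:R%:E).
  by apply/idP/idP; rewrite !inE => /NE.
- by move=> w s h; apply/NE; exists 0.
Qed.

End suspension_null_sets.

(** * Piecewise linear interpolation over the integers *)

Section interpolation.
Context {R : realType}.
Implicit Types (a : int -> R) (n m : int) (s : R).

(** The two-sided antidifference of [d] that vanishes at 0. *)
Definition cum (d : int -> int) n : int :=
  match n with
  | Posz k => \sum_(i < k) d i%:Z
  | Negz k => - \sum_(i < k.+1) d (Negz i)
  end.

Lemma cumS d n : cum d (n + 1) = cum d n + d n.
Proof.
case: n => k; first by rewrite -PoszD addn1 /= big_ord_recr.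
have -> : Negz k + 1 = - k%:Z by lia.
case: k => [|k]; first by rewrite oppr0 /= big_ord0 big_ord1 addNr.
rewrite (_ : - k.+1%:Z = Negz k) //= [in RHS]big_ord_recr /= opprD addrNK//.
Qed.

Lemma int_fun_const (V : Type) (F : int -> V) : (forall n, F (n + 1) = F n) ->
  forall n m, F n = F m.
Proof.
move=> FS; suff H n : F n = F 0 by move=> n m; rewrite (H n) (H m).
have Fp (k : nat) : F k%:Z = F 0.
  by elim: k => [//|k IH]; rewrite -addn1 PoszD FS.
have Fn (k : nat) : F (- k%:Z) = F 0.
  elim: k => [//|k IH]; rewrite -IH -(FS (- k.+1%:Z)); congr F; lia.
by case: n => k; rewrite ?NegzE.
Qed.

Definition pl a s : R :=
  a (Num.floor s) + (s - (Num.floor s)%:~R) * (a (Num.floor s + 1) - a (Num.floor s)).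

Lemma floorP n s : n%:~R <= s -> s < (n + 1)%:~R -> Num.floor s = n.
Proof.
move=> ns sn; apply/eqP; rewrite eq_le -ltzD1 floor_lt_int sn /= leNgt floor_lt_int.
by rewrite -leNgt.
Qed.

(** A single formula on both sides of the node [n], from which continuity at integers can be read
    off. *)
Lemma pl_local a n s : n%:~R - 1 < s < n%:~R + 1 ->
  pl a s = a n + Num.max (s - n%:~R) 0 * (a (n + 1) - a n) +
    Num.min (s - n%:~R) 0 * (a n - a (n - 1)).
Proof.
move=> /andP[ns sn]; case: (leP 0 (s - n%:~R)) => s0.
  have fE : Num.floor s = n by apply: floorP; [lra|rewrite intrD].
  by rewrite /pl fE; lra.
have fE : Num.floor s = n - 1 by apply: floorP; [rewrite intrB|rewrite subrK]; lra.
by rewrite /pl fE subrK intrB; lra.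
Qed.

Lemma pl_shift a m s : pl (fun i => a (i + m)) s = pl a (s + m%:~R).
Proof.
have fE : Num.floor (s + m%:~R) = Num.floor s + m.
  apply: floorP; first by rewrite intrD lerD2r floor_le.
  by rewrite addrAC intrD ltrD2r -floor_lt_int ltrDl.
rewrite /pl fE intrD (addrAC (Num.floor s) m 1); congr (_ + _ * _); lra.
Qed.

Lemma pl_addc a b (r : R) s : (forall n, b n = a n + r) -> pl b s = pl a s + r.
Proof. by move=> ab; rewrite /pl !ab; ring. Qed.

Lemma pl_near_floor a C s : 0 <= C -> (forall n, `|a (n + 1) - a n| <= C) ->
  `|pl a s - a (Num.floor s)| <= C.
Proof.
move=> C0 aC; rewrite /pl [X in `|X|](_ : _ = (s - (Num.floor s)%:~R) *
  (a (Num.floor s + 1) - a (Num.floor s))); last by ring.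
have fl := floor_le s.
have : s < (Num.floor s + 1)%:~R by rewrite -floor_lt_int ltrDl.
rewrite intrD => fl1; rewrite normrM -[X in _ <= X]mul1r ler_pM//.
by rewrite ger0_norm; lra.
Qed.

Lemma near_int_itv n s : n%:~R - 1 < s < n%:~R + 1 ->
  \forall r \near s, n%:~R - 1 < r < n%:~R + 1.
Proof.
move=> /andP[s1 s2].
have H1 : \forall r \near s, n%:~R - 1 < r by exact: lt_nbhsr.
have H2 : \forall r \near s, r < n%:~R + 1 by exact: lt_nbhsl.
by apply: filterS2 H1 H2 => r -> ->.
Qed.

Lemma floor_near_itv s : (Num.floor s)%:~R - 1 < s < (Num.floor s)%:~R + 1.
Proof.
have fl := floor_le s.
have : s < (Num.floor s + 1)%:~R by rewrite -floor_lt_int ltrDl.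
by rewrite intrD => fl1; apply/andP; split; lra.
Qed.

Lemma cvg_max_min (I : Type) (F : set_system I) {FF : Filter F} (x : I -> R) (y : R) :
  x i @[i --> F] --> y -> (Num.max (x i) 0 @[i --> F] --> Num.max y 0) /\
    (Num.min (x i) 0 @[i --> F] --> Num.min y 0).
Proof.
move=> xy.
have mx z : Num.max z 0 = (z + `|z|) / 2 :> R.
  by case: (leP 0 z) => z0; [rewrite ger0_norm|rewrite ltr0_norm]; lra.
have mn z : Num.min z 0 = (z - `|z|) / 2 :> R.
  by case: (leP 0 z) => z0; [rewrite ger0_norm|rewrite ltr0_norm]; lra.
split; [rewrite mx; under eq_fun do rewrite mx|rewrite mn; under eq_fun do rewrite mn];
  apply: cvgMl; [apply: cvgD|apply: cvgB] => //; exact: cvg_norm.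
Qed.

Lemma pl_continuous a : continuous (pl a).
Proof.
move=> s; set n := Num.floor s.
have nr := near_int_itv (floor_near_itv s).
have [mx mn] : (Num.max (r - n%:~R) 0 @[r --> s] --> Num.max (s - n%:~R) 0) /\
    (Num.min (r - n%:~R) 0 @[r --> s] --> Num.min (s - n%:~R) 0).
  by apply: cvg_max_min; apply: cvgB; [exact: cvg_id|exact: cvg_cst].
have L : a n + Num.max (r - n%:~R) 0 * (a (n + 1) - a n) +
    Num.min (r - n%:~R) 0 * (a n - a (n - 1)) @[r --> s] --> pl a s.
  rewrite (pl_local a (floor_near_itv s)); apply: cvgD; last exact: cvgMl.
  by apply: cvgD; [exact: cvg_cst|exact: cvgMl].
apply: cvg_trans L; apply: near_eq_cvg; apply: filterS nr => r /(pl_local a) ->.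
by [].
Qed.

End interpolation.

(** * The circle-valued map of an angle and its winding *)

Section winding_number.
Context {R : realType} {Omega : pmetricType R}.
Variables (T : homeomorphism Omega) (mu : probability (borel Omega) R).
Hypothesis mu_ergodic : ergodic T mu.
Variables (theta : Omega -> R) (fl : Omega -> bool).

(** The real increment of the angle over one step: [theta] is continuous only mod 1, and [fl] makes
    up for its integer jumps. *)
Let h w : R := theta (T w) - theta w - (fl w)%:R.

Hypothesis theta_lift : forall w1, exists2 l : Omega -> R,
  l w @[w --> w1] --> l w1 &
  \forall w \near w1, exists m : int, l w = theta w + m%:~R.
Hypothesis h_continuous : continuous h.
Hypothesis theta_bound : forall w, `|theta w| <= 1.

Local Notation X := (suspension T).
Local Notation cls := (susp_class T).
Local Notation pi := \pi_(circle R).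

Lemma circle_addz (x : R) (m : int) : pi (x + m%:~R) = pi x.
Proof. by apply/esym/eqmodP/asboolP; exists (- m); rewrite mulrNz opprK. Qed.

Let d w (i : int) : int := - (fl (iterz T i w))%:Z.

Definition angle_lift w (n : int) : R := theta (iterz T n w) + (cum (d w) n)%:~R.

Lemma angle_liftS w n : angle_lift w (n + 1) = angle_lift w n + h (iterz T n w).
Proof.
rewrite /angle_lift cumS iterzS /h intrD /d mulrNz.
by rewrite -[(_%:Z)%:~R]/((fl (iterz T n w))%:R); ring.
Qed.

(** Counting from another point of the orbit alters the lift by an integer, so mod 1 the
    interpolated angle descends to the suspension. *)
Lemma angle_lift_shift w m : exists c : int, forall n,
  angle_lift (iterz T m w) n = angle_lift w (n + m) + c%:~R.
Proof.
pose F n := cum (d (iterz T m w)) n - cum (d w) (n + m).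
exists (F 0) => n; rewrite /angle_lift -iterzD -addrA -intrD; congr (_ + _%:~R).
rewrite -(@int_fun_const _ F _ n 0) /F; first by rewrite subrKC.
move=> k; rewrite addrAC !cumS /d -iterzD; ring.
Qed.

Definition suspension_angle w s : circle R := pi (pl (angle_lift w) s).

Lemma suspension_angle_shift w s m :
  suspension_angle (iterz T m w) (s - m%:~R) = suspension_angle w s.
Proof.
rewrite /suspension_angle; have [c cE] := angle_lift_shift w m.
rewrite (pl_addc _ cE) circle_addz pl_shift; congr (pi (pl _ _)); ring.
Qed.

Definition winding_map (x : X) : circle R := suspension_angle (repr x).1 (repr x).2.

Lemma winding_mapE w s : winding_map (cls w s) = suspension_angle w s.
Proof.
rewrite /winding_map; have : cls w s = cls (repr (cls w s)).1 (repr (cls w s)).2.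
  by rewrite /susp_class -surjective_pairing reprK.
by move=> /susp_classP[n [-> ->]]; exact: suspension_angle_shift.
Qed.

(** Near [(w0, s0)] the angle has the real lift [L]: the local lift of [theta] at the node [n], plus
    the continuous increments [h] on either side of that node. *)
Lemma suspension_angle_continuous :
  continuous (fun p : Omega * R => suspension_angle p.1 p.2).
Proof.
move=> [w0 s0]; set n := Num.floor s0; set w1 := iterz T n w0.
have [l lc ln] := theta_lift w1.
pose L (p : Omega * R) : R := l (iterz T n p.1) +
  Num.max (p.2 - n%:~R) 0 * h (iterz T n p.1) +
  Num.min (p.2 - n%:~R) 0 * h (iterz T (n - 1) p.1).
have fst_it k : iterz T k p.1 @[p --> (w0, s0)] --> iterz T k w0.
  by apply: (cvg_comp fst (iterz T k) cvg_fst); exact: iterz_continuous.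
have [mx mn] : (Num.max (p.2 - n%:~R) 0 @[p --> (w0, s0)] --> Num.max (s0 - n%:~R) 0) /\
    (Num.min (p.2 - n%:~R) 0 @[p --> (w0, s0)] --> Num.min (s0 - n%:~R) 0).
  by apply: cvg_max_min; apply: cvgB; [exact: cvg_snd|exact: cvg_cst].
have Lc : L p @[p --> (w0, s0)] --> L (w0, s0).
  apply: cvgD; [apply: cvgD|].
  - exact: (cvg_comp _ l (fst_it n) lc).
  - by apply: cvgM => //; apply: (cvg_comp _ h (fst_it n)); exact: h_continuous.
  - by apply: cvgM => //; apply: (cvg_comp _ h (fst_it (n - 1))); exact: h_continuous.
have LE : \forall p \near (w0, s0), pi (L p) = suspension_angle p.1 p.2.
  have H1 : \forall p \near (w0, s0), exists m : int,
      l (iterz T n p.1) = theta (iterz T n p.1) + m%:~R by exact: (fst_it n _ ln).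
  have H2 : \forall p \near (w0, s0), n%:~R - 1 < p.2 < n%:~R + 1.
    have sn : p.2 @[p --> (w0, s0)] --> s0 by exact: cvg_snd.
    exact: (sn _ (near_int_itv (floor_near_itv s0))).
  apply: filterS2 H1 H2 => -[w s] /= [m lE] sn.
  have e1 k : angle_lift w (k + 1) - angle_lift w k = h (iterz T k w).
    by rewrite angle_liftS addrC addKr.
  have := e1 (n - 1); rewrite subrK => e2.
  rewrite /suspension_angle (pl_local _ sn) e1 e2.
  have -> : L (w, s) = angle_lift w n + Num.max (s - n%:~R) 0 * h (iterz T n w) +
     Num.min (s - n%:~R) 0 * h (iterz T (n - 1) w) + (m - cum (d w) n)%:~R.
    by rewrite /L /= lE /angle_lift intrB; ring.
  by rewrite circle_addz.
have pLc : pi (L p) @[p --> (w0, s0)] --> pi (L (w0, s0)).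
  apply: (cvg_comp L (fun r => pi r) Lc).
  exact: (@pi_continuous _ (circle R)).
rewrite /prop_for /continuous_at -(nbhs_singleton LE).
by apply: cvg_trans pLc; apply: near_eq_cvg; exact: LE.
Qed.

Lemma winding_map_continuous : continuous winding_map.
Proof.
apply/continuousP => A oA; apply: open_susp.
rewrite (_ : _ @^-1` _ = (fun p : Omega * R => suspension_angle p.1 p.2) @^-1` A).
  by apply: open_comp => // p _; exact: suspension_angle_continuous.
by apply/seteqP; split=> p; rewrite /preimage /= winding_mapE.
Qed.

Let A : set (borel Omega) := [set w | fl w].

Lemma angle_lift_hits w (n : nat) : angle_lift w n%:Z = theta (iter n T w) - hits T A n w.
Proof.
rewrite /angle_lift /cum; congr (_ + _).
rewrite -[(_ : int)%:~R]/(intmul 1 _) rmorph_sum /= -sumrN; apply: eq_bigr => k _.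
rewrite /d mulrNz indicE; congr (- _).
rewrite -[(_%:Z)%:~R]/((fl (iterz T k w))%:R); congr (nat_of_bool _)%:R.
by apply/idP/idP; rewrite inE.
Qed.

Lemma angle_lift_step_bound w n : `|angle_lift w (n + 1) - angle_lift w n| <= 3.
Proof.
rewrite angle_liftS addrC addKr /h; set w' := iterz T n w.
apply: (le_trans (ler_normB _ _)).
have := ler_normB (theta (T w')) (theta w').
have := theta_bound (T w'); have := theta_bound w'.
have : `|(fl w')%:R| <= 1 :> R by case: (fl w'); rewrite ?normr1 ?normr0.
lra.
Qed.

Lemma angle_lift_slope w s m : hits_density T A m w ->
  pl (angle_lift w) (s + t) / t @[t --> +oo%R] --> - m.
Proof.
move=> dens; apply/cvgrPdist_lt => e e0.
have [K hK] := dens (e / 3) (divr_gt0 e0 (ltr0Sn _ _)).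
(* The 4 is the bound 3 on the interpolation error plus the bound 1 on [theta]; [|m|] pays for the
   fractional part of [u]. *)
have plb u : 0 <= u -> `|pl (angle_lift w) u + m * u| <= e / 3 * u + (`|K| + 4 + `|m|).
  move=> u0; pose k := absz (Num.floor u).
  have kE : Num.floor u = k%:Z.
    by rewrite /k gez0_abs// floor_ge0.
  have := pl_near_floor u (ler0n R 3) (angle_lift_step_bound w).
  rewrite kE angle_lift_hits => h1.
  have := floor_near_itv u; rewrite kE => /andP[_ u2].
  have := floor_le u; rewrite kE => u1.
  have h2 := hK k; have h3 := theta_bound (iter k T w).
  have -> : pl (angle_lift w) u + m * u =
    (pl (angle_lift w) u - (theta (iter k T w) - hits T A k w)) + theta (iter k T w)
    - (hits T A k w - m * k%:R) + m * (u - k%:R) by ring.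
  have h4 : `|m * (u - k%:R)| <= `|m|.
    rewrite normrM ler_piMr// ger0_norm; last by rewrite subr_ge0.
    by move: u2; rewrite -[k%:~R]/(k%:R); lra.
  have h5 : e / 3 * k%:R <= e / 3 * u by rewrite ler_wpM2l// divr_ge0// ltW.
  apply: (le_trans (ler_normD _ _)); apply: (le_trans (lerD (ler_normB _ _) (lexx _))).
  apply: (le_trans (lerD (lerD (ler_normD _ _) (lexx _)) (lexx _))).
  by have := ler_norm K; lra.
pose K' := `|K| + 4 + `|m| + `|m * s| + e / 3 * `|s|.
have K'0 : 0 <= K' by rewrite !addr_ge0// mulr_ge0// divr_ge0// ltW.
near=> t.
have t0 : 0 < t by near: t; apply: nbhs_pinfty_gt; exact: num_real.
have ts : `|s| < t by near: t; apply: nbhs_pinfty_gt; exact: num_real.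
have tK : 3 * K' / e < t by near: t; apply: nbhs_pinfty_gt; exact: num_real.
have st : 0 <= s + t by have := ler_norm (- s); rewrite normrN; lra.
have := plb _ st => {}plb.
have -> : - m - pl (angle_lift w) (s + t) / t = - (pl (angle_lift w) (s + t) + m * t) / t.
  by field; rewrite gt_eqF.
rewrite normrM normrN normfV (gtr0_norm t0) ltr_pdivrMr//.
have -> : pl (angle_lift w) (s + t) + m * t =
  (pl (angle_lift w) (s + t) + m * (s + t)) - m * s by ring.
apply: (le_lt_trans (ler_normB _ _)).
have : 3 * K' < t * e by rewrite -ltr_pdivrMr.
have : e / 3 * s <= e / 3 * `|s| by rewrite ler_wpM2l ?ler_norm// divr_ge0// ltW.
have : 0 < e * t by rewrite mulr_gt0.
rewrite /K' in K'0 *; lra.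
Unshelve. all: by end_near.
Qed.

Theorem winding_in_group : measurable A -> schwartzman_group T mu (- fine (mu A)).
Proof.
move=> mA; exists (homotopy_class winding_map).
  by exists winding_map => //; exact: winding_map_continuous.
exists winding_map.
  split; first exact: winding_map_continuous.
  exists (fun p => winding_map p.1); split => //.
  apply: continuous_subspaceT => p.
  apply: (cvg_comp fst winding_map cvg_fst); exact: winding_map_continuous.
have [N0 [mN0 N00 N0P]] := birkhoff mu_ergodic mA.
have [N [mN NN0 NP]] := susp_null_set mu_ergodic mN0 N00.
exists N; split=> // x /= nx; have [w [s xE]] := susp_class_surj x; rewrite xE.
apply: NP; apply: N0P => /= dens; apply: nx.
exists (fun t => pl (angle_lift w) (s + t)); last exact: angle_lift_slope.
split.
  move=> t; apply: (@cvg_comp _ _ _ (fun t => s + t) (pl (angle_lift w))).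
    by apply: cvgD; [exact: cvg_cst|exact: cvg_id].
  exact: pl_continuous.
by move=> t; rewrite xE susp_flowE winding_mapE.
Qed.

End winding_number.

(** * The gap labels *)

Section projective_angle.
Context {R : realType}.
Implicit Types (p q : R * R).

(* A homeomorphism from the projective line to R/Z, lifted to [-1/2, 1/2[; the linear
   maps of [step] act on it as a rotation by 1/2 followed by a shear. *)
Definition tau p : R := sg p * p.2 / (2 * (`|p.1| + `|p.2|)).

Lemma norm1_gt0 p : p <> (0, 0) -> 0 < `|p.1| + `|p.2|.
Proof.
case: p => x y p0; rewrite lt0r addr_ge0// andbT paddr_eq0// !normr_eq0 /=.
by apply/negP => /andP[/eqP x0 /eqP y0]; apply: p0; rewrite x0 y0.
Qed.

Lemma tau_bound p : p <> (0, 0) -> `|tau p| <= 1.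
Proof.
move=> p0; have n0 := norm1_gt0 p0.
rewrite /tau normrM normfV (gtr0_norm (mulr_gt0 (ltr0Sn _ 1) n0)) ler_pdivrMr ?mulr_gt0//.
rewrite normrM; have -> : `|sg p| = 1 by rewrite /sg; case: ifP; rewrite ?normrN normr1.
by have := normr_ge0 p.1; have := normr_ge0 p.2; lra.
Qed.

Lemma det2_parallel p q : p <> (0, 0) -> q <> (0, 0) -> det2 p q = 0 ->
  exists2 k, k != 0 & q = (k * p.1, k * p.2).
Proof.
case: p q => x y [z t]; rewrite /det2 /= => p0 q0 /eqP; rewrite subr_eq0 => /eqP e.
have [x0|x0] := eqVneq x 0.
  have y0 : y != 0 by apply/eqP => y0; apply: p0; rewrite x0 y0.
  have z0 : z = 0 by apply: (mulfI y0); rewrite -e x0 mul0r mulr0.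
  exists (t / y); last by rewrite z0 x0 mulr0 divfK.
  rewrite mulf_neq0 ?invr_eq0//; apply/eqP => t0; apply: q0.
  by rewrite z0 t0.
exists (z / x); last by rewrite divfK// mulrAC [z * y]mulrC -e mulrC mulKf.
rewrite mulf_neq0 ?invr_eq0//; apply/eqP => z0; apply: q0; rewrite z0; congr (_, _).
by apply: (mulfI x0); rewrite e z0 !mulr0.
Qed.

Lemma sgZ k p : k != 0 -> p <> (0, 0) ->
  sg (k * p.1, k * p.2) = Num.sg k * sg p.
Proof.
case: p => x y k0 p0; rewrite /sg /=; case: (ltgtP k 0) k0 => // k1 _.
  rewrite nmulr_rgt0// mulf_eq0 lt_eqF//= nmulr_rlt0//.
  case: (ltgtP x 0) => x0 /=; rewrite ?ltr0_sg ?mulN1r ?opprK//.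
  case: (ltgtP y 0) => y0 /=; rewrite ?opprK//.
  by exfalso; apply: p0; rewrite x0 y0.
rewrite pmulr_rgt0// mulf_eq0 gt_eqF//= pmulr_rlt0// gtr0_sg// mul1r//.
Qed.

Lemma tauZ k p : k != 0 -> p <> (0, 0) -> tau (k * p.1, k * p.2) = tau p.
Proof.
move=> k0 p0; have n0 := norm1_gt0 p0.
rewrite /tau sgZ//= !normrM (normrEsg k); field.
by rewrite (gt_eqF n0) -mulrDr !mulf_neq0 ?sgr_eq0 ?(gt_eqF n0).
Qed.

Lemma flipZ k p : k != 0 -> flip (k * p.1, k * p.2) = flip p.
Proof.
move=> k0; rewrite /flip /= mulrACA pmulr_rlt0; last by rewrite -expr2 exprn_even_gt0.
by rewrite mulf_eq0 (negbTE k0).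
Qed.

(** Twice the shear part of [step] in the coordinate [tau], up to the sign of [y]. It is continuous
    for [(x, y)] nonzero and vanishes at [y = 0], so that its product with [Num.sg y] in [tau_step]
    is continuous too. *)
Definition bracket (k x y : R) := (k * y - x) / (`|y| + `|k * y - x|) + x / (`|y| + `|x|).

Lemma tau_step k p : p <> (0, 0) -> tau (step k p) - tau p - (flip p)%:R =
  - 2^-1 + Num.sg p.2 / 2 * bracket k p.1 p.2.
Proof.
move=> p0; rewrite /tau (sg_step k p0) /step /bracket /= /flip /sg.
case: p p0 => x y /= p0; set s := k * y - x.
have s0 : 0 <= `|s| by [].
case: (ltgtP y 0) => y0; [clear p0|clear p0|].
- rewrite ltr0_sg// (ltr0_norm y0); case: (ltgtP x 0) => x0.
  + rewrite (ltr0_norm x0) nmulr_rlt0// ltNge (ltW y0) /=; field.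
    by do ?[apply/andP; split]; apply/eqP => ?; lra.
  + rewrite (gtr0_norm x0) pmulr_rlt0// y0 /=; field.
    by do ?[apply/andP; split]; apply/eqP => ?; lra.
  + rewrite x0 normr0 mul0r ltxx /=; field.
    by do ?[apply/andP; split]; apply/eqP => ?; lra.
- rewrite gtr0_sg// (gtr0_norm y0); case: (ltgtP x 0) => x0.
  + rewrite (ltr0_norm x0) nmulr_rlt0// y0 /=; field.
    by do ?[apply/andP; split]; apply/eqP => ?; lra.
  + rewrite (gtr0_norm x0) pmulr_rlt0// ltNge (ltW y0) /=; field.
    by do ?[apply/andP; split]; apply/eqP => ?; lra.
  + rewrite x0 normr0 mul0r ltxx /=; field.
    by do ?[apply/andP; split]; apply/eqP => ?; lra.
- rewrite /s y0 sgr0 !mulr0 !sub0r normr0 normrN !mul0r ltxx /=.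
  case: (ltgtP x 0) => x0.
  + by rewrite ltr0_norm//=; field; rewrite lt_eqF.
  + by rewrite gtr0_norm//=; field; rewrite gt_eqF.
  + by exfalso; apply: p0; rewrite x0 y0.
Qed.

End projective_angle.

(** * The label of a gap *)

Section gap_label.
Context {R : realType} {Omega : pmetricType R}.
Variables (T : homeomorphism Omega) (mu : probability (borel Omega) R).
Variables (f : Omega -> R) (E : R).
Hypotheses (Omega_compact : compact [set: Omega]) (f_cont : continuous f).
Hypothesis mu_ergodic : ergodic T mu.
Hypothesis gapE : gap T f E.

(** An arbitrary choice, without continuity in [w]; [theta] and [flips_at] are invariant under
    scaling and can be computed from a local section instead. *)
Definition stable_vec w : R * R := xget (0, 0) [set p | stable T f E w p].

Lemma stable_vecP w : stable T f E w (stable_vec w).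
Proof.
have [V HV _] := local_section Omega_compact f_cont gapE w.
by rewrite /stable_vec; case: xgetP => [p -> //|/(_ (V w))]; case; exact: HV.
Qed.

Definition theta w := tau (stable_vec w).
Definition flips_at w := flip (stable_vec w).

Lemma stable_parallel w p : stable T f E w p ->
  exists2 k, k != 0 & stable_vec w = (k * p.1, k * p.2).
Proof.
move=> sp; have sv := stable_vecP w.
exact: det2_parallel (proj1 sp) (proj1 sv) (stable_det sp sv).
Qed.

Lemma theta_stable w p : stable T f E w p -> theta w = tau p.
Proof.
by move=> sp; have [k k0 kE] := stable_parallel sp; rewrite /theta kE tauZ//; case: sp.
Qed.

Lemma flips_at_stable w p : stable T f E w p -> flips_at w = flip p.
Proof. by move=> sp; have [k k0 kE] := stable_parallel sp; rewrite /flips_at kE flipZ. Qed.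

Lemma theta_step w p : stable T f E w p ->
  theta (T w) - theta w - (flips_at w)%:R =
  - 2^-1 + Num.sg p.2 / 2 * bracket (E - f w) p.1 p.2.
Proof.
move=> sp; rewrite (theta_stable sp) (flips_at_stable sp) (theta_stable (stable_step sp)).
by apply: tau_step; case: sp.
Qed.

Lemma near_sgr (g : Omega -> R) w1 : {for w1, continuous g} -> g w1 != 0 ->
  \forall w \near w1, Num.sg (g w) = Num.sg (g w1).
Proof.
move=> gc; case: (ltgtP (g w1) 0) => // g1 _.
  have := gc; move/cvgr_lt/(_ _ g1); apply: filterS => w gw.
  by rewrite !ltr0_sg.
have := gc; move/cvgr_gt/(_ _ g1); apply: filterS => w gw.
by rewrite !gtr0_sg.
Qed.

(** Where the first entry of the section is nonzero its sign is locally constant and [tau] is itself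
    continuous. At a vertical direction the angle is measured from the endpoint 1/2 instead, which
    changes it by 0 or 1. *)
Lemma theta_lift w1 : exists2 l : Omega -> R, l w @[w --> w1] --> l w1 &
  \forall w \near w1, exists m : int, l w = theta w + m%:~R.
Proof.
have [V HV [V1 V2]] := local_section Omega_compact f_cont gapE w1.
have nV w := norm1_gt0 (proj1 (HV w)).
have den : (`|(V w).1| + `|(V w).2|) @[w --> w1] --> `|(V w1).1| + `|(V w1).2|.
  by apply: cvgD; apply: cvg_norm.
have den0 : 2 * (`|(V w1).1| + `|(V w1).2|) != 0 by rewrite mulf_neq0// gt_eqF.
have frac (g : Omega -> R) : g w @[w --> w1] --> g w1 ->
    g w / (2 * (`|(V w).1| + `|(V w).2|)) @[w --> w1] -->
    g w1 / (2 * (`|(V w1).1| + `|(V w1).2|)).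
  by move=> gc; apply: cvgM => //; apply: cvgV => //; exact: cvgMr.
have [x0|x0] := eqVneq (V w1).1 0.
  have y0 : (V w1).2 != 0.
    by apply/eqP => y0; case: (HV w1) => + _; apply; case: (V w1) x0 y0 => ? ? /= -> ->.
  set sigma := Num.sg (V w1).2.
  exists (fun w => 2^-1 - sigma * ((V w).1 / (2 * (`|(V w).1| + `|(V w).2|)))).
    by apply: cvgB; [exact: cvg_cst|apply: cvgMr; exact: frac].
  apply: filterS (near_sgr V2 y0) => w; rewrite -/sigma => sE.
  have : (V w).2 != 0 by rewrite -sgr_eq0 sE sgr_eq0.
  rewrite -sE (theta_stable (HV w)) /tau /sg; have := nV w.
  case: (V w) => x y /= n0.
  case: (ltgtP y 0) => // yy _; case: (ltgtP x 0) => xx /=;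
    rewrite ?(ltr0_sg yy) ?(gtr0_sg yy) ?(ltr0_norm yy) ?(gtr0_norm yy)
     ?(ltr0_norm xx) ?(gtr0_norm xx) ?xx ?yy ?normr0.
  - by exists 0; rewrite mulr0z; field; apply/eqP => ?; lra.
  - by exists 1; field; apply/eqP => ?; lra.
  - by exists 1; field; apply/eqP => ?; lra.
  - by exists 1; field; apply/eqP => ?; lra.
  - by exists 0; rewrite mulr0z; field; apply/eqP => ?; lra.
  - by exists 1; field; apply/eqP => ?; lra.
set sigma := Num.sg (V w1).1.
exists (fun w => sigma * ((V w).2 / (2 * (`|(V w).1| + `|(V w).2|)))).
  by apply: cvgMr; exact: frac.
apply: filterS (near_sgr V1 x0) => w; rewrite -/sigma => sE.
have xn : (V w).1 != 0 by rewrite -sgr_eq0 sE sgr_eq0.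
exists 0; rewrite mulr0z addr0 -sE (theta_stable (HV w)) /tau /sg (negbTE xn) /= orbF.
rewrite mulrA; congr (_ * _ / _); case: (ltgtP (V w).1 0) xn => // x1 _.
  exact: ltr0_sg.
exact: gtr0_sg.
Qed.

Lemma theta_step_continuous :
  continuous (fun w => theta (T w) - theta w - (flips_at w)%:R).
Proof.
move=> w1; have [V HV [V1 V2]] := local_section Omega_compact f_cont gapE w1.
pose k w := E - f w.
pose br w := bracket (k w) (V w).1 (V w).2.
have hE w : theta (T w) - theta w - (flips_at w)%:R =
    - 2^-1 + Num.sg (V w).2 / 2 * br w by exact: theta_step.
have kc : k w @[w --> w1] --> k w1 by apply: cvgB; [exact: cvg_cst|exact: f_cont].
have brc : br w @[w --> w1] --> br w1.
  have d1 : `|(V w1).2| + `|k w1 * (V w1).2 - (V w1).1| != 0.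
    by rewrite gt_eqF//; exact: norm1_gt0 (step_neq0 (k := k w1) (proj1 (HV w1))).
  have d2 : `|(V w1).2| + `|(V w1).1| != 0.
    by rewrite addrC gt_eqF//; exact: norm1_gt0 (proj1 (HV w1)).
  have sc : k w * (V w).2 - (V w).1 @[w --> w1] --> k w1 * (V w1).2 - (V w1).1.
    by apply: cvgB => //; exact: cvgM.
  apply: cvgD; apply: cvgM => //; apply: cvgV => //; apply: cvgD; exact: cvg_norm.
rewrite /prop_for /continuous_at hE; under eq_fun do rewrite hE.
apply: cvgD; first exact: cvg_cst.
have [y0|y0] := eqVneq (V w1).2 0; last first.
  have L : Num.sg (V w1).2 / 2 * br w @[w --> w1] --> Num.sg (V w1).2 / 2 * br w1.
    exact: cvgMr.
  apply: cvg_trans L; apply: near_eq_cvg.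
  by apply: filterS (near_sgr V2 y0) => w ->.
have br0 : br w1 = 0.
  rewrite /br /bracket y0 mulr0 sub0r normr0 !add0r normrN.
  have x0 : `|(V w1).1| != 0.
    rewrite normr_eq0; apply/eqP => x0.
    by case: (HV w1) => + _; apply; case: (V w1) x0 y0 => ? ? /= -> ->.
  by field.
rewrite br0 mulr0; apply/cvgrPdist_lt => e e0.
have := brc; rewrite br0 => /cvgrPdist_lt/(_ _ e0); apply: filterS => w.
rewrite !sub0r !normrN => bre; rewrite normrM (le_lt_trans _ bre)// ler_piMl//.
rewrite normrM normfV normr_sg [`|2|]ger0_norm//.
by case: (_ != 0) => /=; lra.
Qed.

(** [x y < 0] and [x != 0] are open conditions invariant under scaling, hence open along local
    sections; the flips form the union of an open and a closed set. *)
Lemma flips_at_measurable : measurable ([set w | flips_at w] : set (borel Omega)).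
Proof.
have loc (P : set (R * R)) : (forall k p, k != 0 -> P (k * p.1, k * p.2) -> P p) ->
    (forall k p, k != 0 -> P p -> P (k * p.1, k * p.2)) ->
    (forall w1 V, {for w1, continuous (fun w => (V w).1)} ->
      {for w1, continuous (fun w : Omega => (V w).2)} -> P (V w1) ->
      \forall w \near w1, P (V w)) ->
    open [set w | P (stable_vec w)].
  move=> PZ PZ' Pn; rewrite openE => w1 /= Pw1.
  have [V HV [V1 V2]] := local_section Omega_compact f_cont gapE w1.
  have PV w : P (stable_vec w) <-> P (V w).
    have [k k0 ->] := stable_parallel (HV w).
    by split; [exact: PZ|exact: PZ'].
  have : \forall w \near w1, P (V w) by apply: Pn => //; apply/PV.
  by apply: filterS => w /PV.
have kE (k x y : R) : k != 0 -> (k * x * (k * y) < 0) = (x * y < 0).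
  by move=> k0; rewrite mulrACA pmulr_rlt0// -expr2 exprn_even_gt0.
have o1 : open [set w | (stable_vec w).1 * (stable_vec w).2 < 0].
  apply: (loc [set p | p.1 * p.2 < 0]).
  - by move=> k p k0; rewrite /= kE.
  - by move=> k p k0; rewrite /= kE.
  - move=> w1 V V1 V2 /= lt.
    have : (V w).1 * (V w).2 @[w --> w1] --> (V w1).1 * (V w1).2 by exact: cvgM.
    by move/cvgr_lt/(_ _ lt).
have o2 : open [set w | (stable_vec w).1 != 0].
  apply: (loc [set p | p.1 != 0]).
  - by move=> k p k0; rewrite /= mulf_eq0 negb_or => /andP[].
  - by move=> k p k0; rewrite /= mulf_eq0 negb_or k0.
  - by move=> w1 V V1 _ /=; exact: cvgr_neq0.
rewrite (_ : [set w | _] = [set w | (stable_vec w).1 * (stable_vec w).2 < 0] `|`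
    ~` [set w | (stable_vec w).1 != 0]).
  by apply: measurableU; [exact: open_borel|apply: measurableC; exact: open_borel].
apply/seteqP; split=> w; rewrite /flips_at /flip /=.
  by case/orP => [?|/eqP x0]; [left|right => /eqP].
by case=> [->//|/negP/negPn ->]; rewrite orbT.
Qed.

Definition gap_label : R := fine (mu ([set w | flips_at w] : set (borel Omega))).

Lemma gap_label_in_group : schwartzman_group T mu (- gap_label).
Proof.
apply: winding_in_group => //; [exact: theta_lift|exact: theta_step_continuous|
  |exact: flips_at_measurable].
by move=> w; apply: tau_bound; case: (stable_vecP w).
Qed.

Lemma gap_label_itv : 0 <= gap_label <= 1.
Proof.
rewrite /gap_label fine_ge0//= -lee_fin fineK.
  by apply: probability_le1; exact: flips_at_measurable.
by apply: fin_num_measure; exact: flips_at_measurable.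
Qed.

Lemma flips_hits w p n : stable T f E w p ->
  (flips (fpot T f E w) p n)%:R = hits T [set w | flips_at w] n w.
Proof.
move=> sp; rewrite /flips /hits natr_sum; apply: eq_bigr => k _.
have sk m : stable T f E (iter m T w) (vec (fpot T f E w) p m).
  by elim: m => [//|m IH] /=; exact: stable_step.
rewrite indicE -(flips_at_stable (sk k)); congr (nat_of_bool _)%:R.
by apply/idP/idP; rewrite inE.
Qed.

End gap_label.

(** * Strict monotonicity of the labels *)

Section label_monotone.
Context {R : realType} {Omega : pmetricType R}.
Variables (T : homeomorphism Omega) (mu : probability (borel Omega) R).
Variable f : Omega -> R.
Hypotheses (Omega_compact : compact [set: Omega]) (f_cont : continuous f).
Hypotheses (mu_ergodic : ergodic T mu) (mu_supp : supp mu = [set: Omega]).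

Lemma flipsD (c : nat -> R) p n m :
  flips c p (n + m) = (flips c p n + flips (fun k => c (n + k)%N) (vec c p n) m)%N.
Proof.
rewrite /flips big_split_ord /=; congr (_ + _)%N.
by apply: eq_bigr => k _; rewrite vec_shift.
Qed.

Lemma extra_flipsD (c c' : nat -> R) p q n m : extra_flips c c' p q (n + m) =
  extra_flips c c' p q n + extra_flips (fun k => c (n + k)%N) (fun k => c' (n + k)%N)
    (vec c p n) (vec c' q n) m.
Proof. rewrite /extra_flips !flipsD; lia. Qed.

Lemma lex_addl (i j D : int) (x : R) : lex (i + j) (i + D) x <-> lex j D x.
Proof.
rewrite /lex ltrD2l.
by split=> -[?|[e ?]]; [left|right; split=> //; lia|left|right; rewrite e].
Qed.

Lemma fpot_iter E w n : (fun k => fpot T f E w (n + k)) = fpot T f E (iter n T w).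
Proof. by apply/funext => k; rewrite fpot_shift. Qed.

(** The orbit is cut into blocks: a visit to [U] opens one of length [L] that gains a half-turn, any
    other point is a block of length 1. All visits lie in gaining blocks, except those in the last
    at most [L] steps, whence [i.+1]. The level [j] is any integer because the count of flips
    restarts with each block. *)
Lemma hits_extra_flips E E' (U : set Omega) L : E < E' -> (0 < L)%N ->
  (forall w p q j, U w -> p <> (0, 0) -> q <> (0, 0) -> lex j 0 (sig p q) ->
    lex (j + 1) (extra_flips (fpot T f E w) (fpot T f E' w) p q L)
      (sig (vec (fpot T f E w) p L) (vec (fpot T f E' w) q L))) ->
  forall N w p q j, p <> (0, 0) -> q <> (0, 0) -> lex j 0 (sig p q) ->
  exists2 i : nat, lex (j + i%:Z) (extra_flips (fpot T f E w) (fpot T f E' w) p q N)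
    (sig (vec (fpot T f E w) p N) (vec (fpot T f E' w) q N)) &
    hits T U N w <= L%:R * i.+1%:R.
Proof.
move=> EE' L0 gain; have cc w n : fpot T f E w n < fpot T f E' w n by rewrite ltrD2r.
have D0 w p q : extra_flips (fpot T f E w) (fpot T f E' w) p q 0 = 0.
  by rewrite /extra_flips /flips !big_ord0.
have mono w p q j n : p <> (0, 0) -> q <> (0, 0) -> lex j 0 (sig p q) ->
    lex j (extra_flips (fpot T f E w) (fpot T f E' w) p q n)
    (sig (vec (fpot T f E w) p n) (vec (fpot T f E' w) q n)).
  move=> p0 q0 l; apply: (lex_mono (cc w) p0 q0 (leq0n n)).
  by rewrite D0.
move=> N; have [m] := ubnP N; elim: m N => // m IH N Nm w p q j p0 q0 l.
have rec n j' i0 : (0 < n)%N -> (n <= N)%N ->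
    lex j' (extra_flips (fpot T f E w) (fpot T f E' w) p q n)
    (sig (vec (fpot T f E w) p n) (vec (fpot T f E' w) q n)) ->
    j' = j + i0%:Z -> hits T U n w <= L%:R * i0%:R ->
    exists2 i : nat, lex (j + i%:Z) (extra_flips (fpot T f E w) (fpot T f E' w) p q N)
      (sig (vec (fpot T f E w) p N) (vec (fpot T f E' w) q N)) &
      hits T U N w <= L%:R * i.+1%:R.
  move=> n0 nN ln j'E hn; set D := extra_flips _ _ _ _ n in ln.
  have NE : N = (n + (N - n))%N by rewrite subnKC.
  have lt : (N - n < m)%N by rewrite ltn_subLR// (leq_trans Nm)// -addn1 addnC leq_add2r.
  have [|i li hi] := IH (N - n)%N lt (iter n T w) (vec (fpot T f E w) p n)
    (vec (fpot T f E' w) q n) (j' - D) (vec_neq0 (c := _) (n := n) p0)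
    (vec_neq0 (c := _) (n := n) q0).
    by rewrite -(lex_addl D) addr0 addrC subrK.
  exists (i0 + i)%N.
    rewrite NE extra_flipsD !vec_shift !fpot_iter -/D.
    by rewrite (_ : j + _ = D + (j' - D + i%:Z)) ?lex_addl// j'E PoszD; lia.
  by rewrite NE hitsD -addnS natrD mulrDr lerD.
have [NL|LN] := leqP N L.
  exists 0%N; first by rewrite addr0; exact: mono.
  by rewrite mulr1 (le_trans (hits_le _ _ _ _))// ler_nat.
have [Uw|nUw] := pselect (U w).
  apply: (rec L (j + 1) 1%N) => //; first exact: ltnW.
    exact: gain.
  by rewrite mulr1 hits_le.
apply: (rec 1%N j 0%N) => //; first exact: leq_trans LN.
- exact: mono.
- by rewrite addr0.
- rewrite mulr0 /hits big_ord1 /= indicE (_ : (w \in _) = false)//.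
  by apply/negbTE; rewrite notin_setE.
Qed.

Lemma open_window E E' E0 : E < E0 -> E0 < E' -> ~ gap T f E0 ->
  exists (U : set Omega) (L : nat), [/\ open U, U !=set0, (0 < L)%N &
  forall w p q j, U w -> p <> (0, 0) -> q <> (0, 0) -> lex j 0 (sig p q) ->
    lex (j + 1) (extra_flips (fpot T f E w) (fpot T f E' w) p q L)
      (sig (vec (fpot T f E w) p L) (vec (fpot T f E' w) q L))].
Proof.
move=> EE0 E0E' ng; pose a := E0 - E; pose b := E' - E0.
have a0 : 0 < a by rewrite subr_gt0.
have b0 : 0 < b by rewrite subr_gt0.
pose M := 1 + (a - b) ^+ 2 / (2 * (a * b)).
have M0 : 0 < M.
  by rewrite ltr_pwDl// divr_ge0 ?sqr_ge0// mulr_ge0// mulr_ge0// ltW.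
(* The ratio of the two constants in [window_gain]. As [E0] is not in a gap, some test vector
   violates the lower bound with this constant, and the violation persists nearby. *)
pose k := a * b / 2 / M.
have k0 : 0 < k by rewrite !divr_gt0// mulr_gt0.
have [w0 [a1 [n [psi [sp lt]]]]] : exists w0 a1 n psi, supp_in a1 n psi /\
    wsum (a1 - 1) (n + 2) (fun i => jac (pot T f E0 w0) psi i ^+ 2) <
    k * wsum a1 n (fun i => psi i ^+ 2).
  apply: contrapT => H; apply: ng; exists k => // w a1 n psi sp.
  rewrite expr0n mul0r addr0 leNgt; apply/negP => lt; apply: H.
  by exists w, a1, n, psi.
(* The translation puts the four zeros required by [window_gain] in front of the support. *)
pose L := (n + 5)%N; pose ps (m : nat) := psi (a1 + m%:Z - 4).
pose F w := M * \sum_(i < L) (ps i.+2 + ps i - (E0 - f (iter i T w)) * ps i.+1) ^+ 2.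
pose S := a * b / 2 * \sum_(i < L) ps i.+1 ^+ 2.
exists [set w | F w < S], L; split => //.
- apply: (@open_comp _ _ F [set r | r < S]); last exact: open_lt.
  move=> w _; apply: cvgMr; apply: (@cvg_sum_ord _ _ _ _ L
    (fun w i => (ps i.+2 + ps i - (E0 - f (iter i T w)) * ps i.+1) ^+ 2)
    (fun i => (ps i.+2 + ps i - (E0 - f (iter i T w)) * ps i.+1) ^+ 2)) => i.
  under eq_fun do rewrite expr2; rewrite expr2.
  have H : ps i.+2 + ps i - (E0 - f (iter i T w')) * ps i.+1 @[w' --> w] -->
     ps i.+2 + ps i - (E0 - f (iter i T w)) * ps i.+1.
    apply: cvgB; first exact: cvg_cst.
    apply: cvgMl; apply: cvgB; first exact: cvg_cst.
    exact: iter_continuous.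
  exact: cvgM.
(* Index 0 of the window tests the equation at [ps 1], that is at site [a1 - 3]. *)
- exists (iterz T (a1 - 3) w0); rewrite /= /F /S.
  rewrite (eq_bigr (fun i : 'I_L => jac (pot T f E0 w0) psi (a1 - 3 + i%:Z) ^+ 2)); last first.
    move=> i _; rewrite /jac /pot /ps -[iter i T _]/(iterz T i%:Z _) -iterzD.
    rewrite (_ : a1 + i.+2%:Z - 4 = a1 - 3 + i%:Z + 1); last lia.
    rewrite (_ : a1 + i%:Z - 4 = a1 - 3 + i%:Z - 1); last lia.
    rewrite (_ : a1 + i.+1%:Z - 4 = a1 - 3 + i%:Z); last lia.
    by rewrite [i%:Z + _]addrC; congr (_ ^+ 2); ring.
  rewrite [X in _ < _ * X](eq_bigr (fun i : 'I_L => psi (a1 - 3 + i%:Z) ^+ 2)); last first.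
    by move=> i _; rewrite /ps; congr (psi _ ^+ 2); lia.
  rewrite -/(wsum (a1 - 3) L (fun i => jac (pot T f E0 w0) psi i ^+ 2)).
  rewrite -/(wsum (a1 - 3) L (fun i => psi i ^+ 2)).
  have sq c m G : supp_in c m G -> supp_in c m (fun i => G i ^+ 2 : R).
    by move=> G0 i /G0 ->; rewrite expr0n.
  rewrite (wsum_ext (sq _ _ _ (supp_in_jac _ sp))); [|rewrite /L; lia..].
  rewrite (wsum_ext (sq _ _ _ sp)); [|rewrite /L; lia..].
  by rewrite mulrC -ltr_pdivlMr// mulrAC.
- by rewrite /L addnS.
- move=> w p q j Uw p0 q0 l.
  have cc m : fpot T f E w m < fpot T f E' w m.
    by rewrite ltrD2r; exact: lt_trans E0E'.
  apply: (@window_gain _ _ _ _ _ j cc p0 q0 a b ps L a0 b0) => //.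
  + by move=> m; rewrite /fpot /a /b; ring.
  + by move=> m mL; apply: sp; move: mL; rewrite /L; lia.
  + by rewrite /L !addnS.
  + move: Uw; rewrite /= /F /S -/M; congr (_ * _ < _); apply: eq_bigr => i _.
    by congr ((_ - _ * _) ^+ 2); rewrite /fpot /a; ring.
  + by rewrite /extra_flips /flips !big_ord0.
Qed.

Theorem gap_label_lt E E' E0 : gap T f E -> gap T f E' -> E < E0 -> E0 < E' ->
  ~ gap T f E0 -> gap_label T mu f E' < gap_label T mu f E.
Proof.
move=> gE gE' EE0 E0E' ng.
have [U [L [oU U0 L0 gain]]] := open_window EE0 E0E' ng.
have mU : measurable (U : set (borel Omega)) by exact: open_borel.
have muU : 0 < fine (mu U).
  by rewrite fine_gt0// supp_gt0//= (le_lt_trans (probability_le1 _ mU))// ltry.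
have mA := flips_at_measurable Omega_compact f_cont gE.
have mA' := flips_at_measurable Omega_compact f_cont gE'.
have [w [[dA dA'] dU]] : exists w, (hits_density T [set w | flips_at T f E w]
    (gap_label T mu f E) w /\ hits_density T [set w | flips_at T f E' w]
    (gap_label T mu f E') w) /\ hits_density T U (fine (mu U)) w.
  apply: (ae_exists (mu := mu)); apply: ae_and; last exact: birkhoff.
  by apply: ae_and; exact: birkhoff.
rewrite ltNge; apply/negP => le.
move: muU dU; set m := fine (mu U) => m0 dU.
have L1 : 0 < 1 + 2 * L%:R :> R by rewrite ltr_pwDl// mulr_ge0.
(* Then [e * (1 + 2 * L%:R) = m / 2]: the errors of the three frequencies use up half of the
   gain. *)
pose e := m / (2 * (1 + 2 * L%:R)).
have e0 : 0 < e by rewrite divr_gt0// mulr_gt0.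
have [K1 h1] := dA e e0; have [K2 h2] := dA' e e0; have [K3 h3] := dU e e0.
have sp := stable_vecP Omega_compact f_cont gE w.
have sq := stable_vecP Omega_compact f_cont gE' w.
have bound N : m / 2 * N%:R <= K3 + L%:R * (K1 + K2 + 2).
  (* Level -1 holds whatever the two initial directions are, and costs only a constant. *)
  have l0 : lex (-1) 0 (sig (stable_vec T f E w) (stable_vec T f E' w)) by left.
  have [i li hi] := hits_extra_flips (lt_trans EE0 E0E') L0 gain N w
    (proj1 sp) (proj1 sq) l0.
  have iD : (i%:R : R) <= hits T [set w | flips_at T f E w] N w -
      hits T [set w | flips_at T f E' w] N w + 1.
    rewrite -(flips_hits Omega_compact f_cont gE _ sp).
    rewrite -(flips_hits Omega_compact f_cont gE' _ sq).
    move: li; rewrite /extra_flips /lex.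
    move: (flips _ _ _) (flips _ _ _) => x y li.
    rewrite addrAC lerBrDr natr1 -natrD ler_nat.
    by case: li => [|[]]; lia.
  have := h1 N; have := h2 N; have := h3 N.
  move: hi iD; move: (hits _ _ _ _) (hits _ _ _ _) (hits _ _ _ _) => x y z.
  rewrite !ler_norml => hi iD /andP[x1 _] /andP[z1 _] /andP[_ y1].
  have N0 := ler0n R N.
  have lN : gap_label T mu f E * N%:R <= gap_label T mu f E' * N%:R.
    by rewrite ler_wpM2r.
  have i1 : i.+1%:R <= 2 * e * N%:R + (K1 + K2 + 2) by rewrite -natr1; lra.
  have : L%:R * i.+1%:R <= L%:R * (2 * e * N%:R + (K1 + K2 + 2)) by rewrite ler_wpM2l.
  have : e * N%:R + 2 * (L%:R * (e * N%:R)) = m / 2 * N%:R.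
    by rewrite /e; field; rewrite gt_eqF.
  lra.
have [N] : exists N : nat, (`|K3 + L%:R * (K1 + K2 + 2)|) / (m / 2) < N%:R.
  by eexists; apply: archi_boundP; rewrite !divr_ge0// ltW.
rewrite ltr_pdivrMr ?divr_gt0// [N%:R * _]mulrC => lt.
by have := lt_le_trans lt (bound N); rewrite ltNge ler_norm.
Qed.

End label_monotone.

(** * Counting the components *)

Section components.
Context {R : realType} {Omega : pmetricType R}.
Variables (T : homeomorphism Omega) (mu : probability (borel Omega) R).
Variables (f : Omega -> R) (n : nat).
Hypotheses (Omega_compact : compact [set: Omega]) (f_cont : continuous f).
Hypotheses (mu_ergodic : ergodic T mu) (mu_supp : supp mu = [set: Omega]).
Hypotheses (n0 : (0 < n)%N)
  (group : schwartzman_group T mu = [set n%:R^-1 * k%:~R | k in [set: int]]).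

Let label E : R := n%:R * gap_label T mu f E.

Lemma label_nat E : gap T f E -> exists2 k : nat, (k <= n)%N & label E = k%:R.
Proof.
move=> gE; have := gap_label_in_group Omega_compact f_cont mu_ergodic gE.
rewrite group => -[k _ kE].
have nn : n%:R != 0 :> R by rewrite pnatr_eq0 -lt0n.
have lE : label E = (- k)%:~R by rewrite mulrNz -[k%:~R](mulVKf nn) kE mulrN opprK.
have /andP[l0 l1] := gap_label_itv mu Omega_compact f_cont gE.
have k0 : 0 <= - k by rewrite -(ler_int R) -lE mulr_ge0.
have kn : - k <= n%:Z by rewrite -(ler_int R) -lE ler_piMr.
exists (absz (- k)%R); first by rewrite -lez_nat gez0_abs.
by rewrite lE -[in LHS](gez0_abs k0).
Qed.

Lemma label_lt E E' E0 : gap T f E -> gap T f E' -> E < E0 -> E0 < E' ->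
  spec T f E0 -> label E' < label E.
Proof.
move=> gE gE' h1 h2 h3; rewrite ltr_pM2l ?ltr0n//.
exact: (gap_label_lt Omega_compact f_cont mu_ergodic mu_supp gE gE' h1 h2 h3).
Qed.

(** Points of the spectrum are sorted by the least label, in units of [1 / n], of the gap energies
    below them. That label is at least 1, since a further drop happens above the point. *)
Definition component (i : 'I_n) : set R := [set s | [/\ spec T f s,
  exists E, [/\ E < s, gap T f E & label E = i.+1%:R] &
  forall E, E < s -> gap T f E -> i.+1%:R <= label E]].

Lemma component_interval i : is_interval (component i).
Proof.
move=> s1 s2 [S1 [E1 [Es1 g1 l1]] _] [S2 _ min2] x /andP[s1x xs2].
split; last 1 first.
- by move=> E Ex; apply: min2; exact: lt_le_trans xs2.
- move=> gx.
  have {}s1x : s1 < x.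
    by rewrite lt_neqAle s1x andbT; apply/eqP => e; apply: S1; rewrite e.
  have {}xs2 : x < s2.
    by rewrite lt_neqAle xs2 andbT; apply/eqP => e; apply: S2; rewrite -e.
  (* A gap energy [x] between [s1] and [s2] would have a label below [i.+1], against the minimality
     at [s2]. *)
  have := label_lt g1 gx Es1 s1x S1; rewrite l1 ltNge => /negP; apply.
  exact: min2.
- by exists E1; split=> //; exact: lt_le_trans s1x.
Qed.

Lemma spec_components : spec T f = \bigcup_i component i.
Proof.
apply/seteqP; split=> [s Ss|s [i _ []]//].
have [B B0 HB] := gap_large T Omega_compact f_cont.
(* [Em] shows that some label occurs below [s]; [Ep], whose label is nonnegative, shows that the
   least one is positive. *)
pose Em := - (B + `|s|) - 1; pose Ep := B + `|s| + 1.
have ns := ler_norm s; have ns' := ler_norm (- s); rewrite normrN in ns'.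
have gm : gap T f Em.
  by apply: HB; rewrite /Em ler0_norm; [have := normr_ge0 s; lra|lra].
have gp : gap T f Ep.
  by apply: HB; rewrite /Ep ger0_norm; [have := normr_ge0 s; lra|lra].
have ms : Em < s by rewrite /Em; lra.
have sp : s < Ep by rewrite /Ep; lra.
pose P k := `[< exists E, [/\ E < s, gap T f E & label E = k%:R] >].
have exP : exists k, P k.
  by have [k _ kE] := label_nat gm; exists k; apply/asboolP; exists Em.
case: (ex_minnP exP) => k /asboolP[E1 [E1s g1 l1]] kmin.
have kn : (k <= n)%N.
  by have [k' k'n] := label_nat g1; rewrite l1 => /eqP; rewrite eqr_nat => /eqP ->.
have k0 : (0 < k)%N.
  have := label_lt g1 gp E1s sp Ss; have [k' _ ->] := label_nat gp.
  by rewrite l1 ltr_nat; exact: leq_ltn_trans.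
have kn' : (k.-1 < n)%N by rewrite prednK.
exists (Ordinal kn') => //; split=> //=; rewrite prednK//; first by exists E1.
move=> E Es gE; have [k' _ kE] := label_nat gE; rewrite kE ler_nat.
by apply: kmin; apply/asboolP; exists E.
Qed.

End components.

Theorem corollary1p2 (R : realType) (Omega : pmetricType R)
    (Omega_compact : compact [set: Omega])
    (T : homeomorphism Omega) (mu : probability (borel Omega) R)
    (mu_ergodic : ergodic T mu) (mu_supp : supp mu = [set: Omega]) :
  (schwartzman_group T mu = [set k%:~R | k in [set: int]] ->
   forall f : Omega -> R, continuous f ->
     exists2 S : set R, almost_sure_spectrum T mu f S & is_interval S) /\
  (forall n : nat, (0 < n)%N ->
   schwartzman_group T mu = [set n%:R^-1 * k%:~R | k in [set: int]] ->
   forall f : Omega -> R, continuous f ->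
     exists2 S : set R, almost_sure_spectrum T mu f S &
       exists (m : nat) (I : 'I_m -> set R),
         [/\ (m <= n)%N, forall i, is_interval (I i) & S = \bigcup_i I i]).
Proof.
split=> [group|n n0 group] f f_cont; exists (spec T f);
  try exact: almost_sure_spectrum_spec.
- have group1 : schwartzman_group T mu = [set 1%:R^-1 * k%:~R | k in [set: int]].
    by rewrite group; congr image; apply/funext => k; rewrite invr1 mul1r.
  have -> : spec T f = component T mu f (n := 1) ord0.
    rewrite (spec_components Omega_compact f_cont mu_ergodic mu_supp (ltn0Sn 0) group1).
    apply/seteqP; split=> [x [i _]|x h]; last by exists ord0.
    by rewrite (ord1 i).
  exact: (component_interval Omega_compact f_cont mu_ergodic mu_supp (ltn0Sn 0)).
- exists n, (component T mu f (n := n)); split=> //.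
  + exact: (component_interval Omega_compact f_cont mu_ergodic mu_supp n0).
  + exact: (spec_components Omega_compact f_cont mu_ergodic mu_supp n0 group).
Qed.
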